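(* Let $a_i,b_i,c_i,d_i$ ($1\le i\le k$) be complex numbers with $|c_i|<1$ and $|d_i|<1$, let $A=\{a_1,\dots,a_k\}$, $B=\{b_1,\dots,b_k\}$, $C=\{c_1,\dots,c_k\}$, $D=\{d_1,\dots,d_k\}$, and $$\phi(e^{i\theta})=\prod_{i=1}^k\frac{(1-a_ie^{-i\theta})(1-b_ie^{i\theta})}{(1-c_ie^{-i\theta})(1-d_ie^{i\theta})}.$$ Then $$\int_{U(N)}\det\phi(U)\,dU=\sum_{S\subset A,\;T\subset B,\;|S|=|T|}S^NT^N\,Z\big(A-S+T^{-1},\,B-T+S^{-1};\,C,\,D\big).$$
   Context: For a matrix $U$ with eigenvalues $e^{i\theta_1},\dots,e^{i\theta_N}$, $\det\phi(U)=\prod_j\phi(e^{i\theta_j})$; $U(N)$ is the unitary group with normalized Haar measure. For finite sets (multisets) of complex numbers, $Z(A,B)=\prod_{a\in A,b\in B}(1-ab)^{-1}$ and $Z(A,B;C,D)=\frac{Z(A,B)Z(C,D)}{Z(A,D)Z(B,C)}$. For $S\subset A$, $T\subset B$: $A-S+T^{-1}$ is $A$ with the elements of $S$ removed and the reciprocals of the elements of $T$ added (similarly $B-T+S^{-1}$), $|S|$ is the cardinality, and $S^N=\prod_{a\in S}a^N$. *)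

(* Defs.v *)
From HB Require Import structures.
From mathcomp Require Import all_boot all_order all_algebra.
From mathcomp Require Import spectral complex.
From mathcomp Require Import all_classical all_reals all_analysis.

Set Implicit Arguments.
Unset Strict Implicit.
Unset Printing Implicit Defensive.

Import Order.TTheory GRing.Theory Num.Theory.
Import numFieldNormedType.Exports.

Local Open Scope classical_set_scope.
Local Open Scope ring_scope.

(* The cast selects the topology that every numFieldType carries. *)
Definition cplx (R : realType) : numClosedFieldType := R[i].

(* N x N complex matrices with their Borel sigma-algebra. *)
Definition borelMx (R : realType) (N : nat) :=
  g_sigma_algebraType (@open 'M[cplx R]_N).

Definition unitary_group (R : realType) (N : nat) : set 'M[cplx R]_N :=
  [set U | U \is unitarymx].

(* Haar measure of U(N), as a Borel probability measure on the matrices that is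
   carried by U(N); a left-invariant one is unique and also right-invariant. *)
Definition is_unitary_haar (R : realType) (N : nat)
    (mu : probability (borelMx R N) R) : Prop :=
  mu (@unitary_group R N) = 1%E /\
  forall V : 'M[cplx R]_N, @unitary_group R N V ->
  forall E : set (borelMx R N), measurable E ->
    mu [set U : 'M[cplx R]_N | E (V *m U)] = mu E.

Definition complex_integral (R : realType) (d : measure_display)
    (T : measurableType d) (mu : {measure set T -> \bar R}) (D : set T)
    (f : T -> cplx R) : cplx R :=
  Complex (Rintegral mu D (fun x => complex.Re (f x)))
          (Rintegral mu D (fun x => complex.Im (f x))).

(* With multiplicity: char_poly M is the product of the 'X - z%:P over these. *)
Definition eigenvalues (C : numClosedFieldType) (N : nat) (M : 'M[C]_N) :
    seq C :=
  sval (closed_field_poly_normal (char_poly M)).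

Definition det_symbol (C : numClosedFieldType) (N : nat) (phi : C -> C)
    (U : 'M[C]_N) : C :=
  \prod_(z <- eigenvalues U) phi z.

(* For z = e^{i theta}, one has e^{-i theta} = z^-1. *)
Definition ratio_symbol (C : numClosedFieldType) (k : nat)
    (a b c d : 'rV[C]_k) (z : C) : C :=
  \prod_(i < k) (((1 - a 0 i * z^-1) * (1 - b 0 i * z)) /
                 ((1 - c 0 i * z^-1) * (1 - d 0 i * z))).

(* Multisets of complex numbers are represented by sequences. *)
Definition Z2 (C : numClosedFieldType) (A B : seq C) : C :=
  \prod_(a <- A) \prod_(b <- B) (1 - a * b)^-1.

(* Since 0^-1 = 0, (Z2 A D)^-1 is the product of the 1 - a * d also when one of
   these factors vanishes. *)
Definition Z4 (C : numClosedFieldType) (A B X Y : seq C) : C :=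
  Z2 A B * Z2 X Y / (Z2 A Y * Z2 B X).

Definition entries (C : numClosedFieldType) (k : nat) (a : 'rV[C]_k) : seq C :=
  [seq a 0 i | i <- enum 'I_k].

(* A - S + T^-1, where S and T are sets of indices into A = a and B = b. *)
Definition swap (C : numClosedFieldType) (k : nat) (a b : 'rV[C]_k)
    (S T : {set 'I_k}) : seq C :=
  [seq a 0 i | i <- enum (~: S)] ++ [seq (b 0 j)^-1 | j <- enum T].

Definition setpow (C : numClosedFieldType) (k N : nat) (a : 'rV[C]_k)
    (S : {set 'I_k}) : C :=
  \prod_(i in S) a 0 i ^+ N.

(* If a 0 i = 0 for some i in S (or b 0 j = 0 for some j in T) and N > 0, the
   summand is 0, which is the limit of the summand as that entry tends to 0. *)
Definition ratio_sum (C : numClosedFieldType) (k N : nat)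
    (a b c d : 'rV[C]_k) : C :=
  \sum_(S : {set 'I_k}) \sum_(T : {set 'I_k} | #|S| == #|T|)
    setpow N a S * setpow N b T *
    Z4 (swap a b S T) (swap b a T S) (entries c) (entries d).

(* The (a, b) at which no summand of ratio_sum has a pole: summands contain
   1 / (1 - a_i a_j^-1), 1 / (1 - b_i b_j^-1) and 1 / (1 - a_i b_j), i <> j in
   the first two, and the last one also with a_i^-1, b_j^-1.  The complement
   consists of removable singularities of the whole sum. *)
Definition nonsingular (C : numClosedFieldType) (k : nat)
    (ab : 'rV[C]_k * 'rV[C]_k) : Prop :=
  [/\ injective (fun i => ab.1 0 i), injective (fun j => ab.2 0 j)
    & forall i j, ab.1 0 i * ab.2 0 j != 1].

(* Main.v *)
(* The integral of det phi over U(N) is the Toeplitz determinant of phi (Heine-Szego), which for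
   a rational symbol is evaluated by Day's formula.

   Heine-Szego without Weyl integration: let q be the characteristic polynomial of U and
   G(y) the mean of det(U)^-m q(y_1) ... q(y_M).  Invariance of Haar measure under the rank-one
   unitary matrices 1 + (w - 1) p p^* / |p|^2 gives, from the coefficients of w and w^2, linear
   relations between means of products of traces of resolvents.  The product of G with the
   Vandermonde determinant is a combination of monomials y^nu, on which these relations act
   diagonally; they leave only the exponents nu for which the sum of (nu_a - m)(nu_a - m - N + 1)
   is maximal, namely the permutations of [0, N + M) minus [m, m + N).  The Toeplitz determinant
   is supported on the same exponents, so the two are proportional.

   Day's formula: expand the symbol in partial fractions; in a basis of polynomials adapted to
   the poles the bordered Vandermonde determinant splits into blocks, and its Laplace expansion
   is the sum over the subsets M of the zeros a_i, 1/b_j with |M| = k.  Writing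
   M = A - S + T^-1 gives the sum over S and T.  Laurent truncation passes from Laurent
   polynomials to rational symbols, and a perturbation of the parameters removes the genericity
   assumptions. *)
Require Import Defs.
From HB Require Import structures.
From mathcomp Require Import all_boot all_order all_algebra.
From mathcomp Require Import spectral complex.
From mathcomp Require Import all_classical all_reals all_analysis.
From mathcomp Require Import measurable_realfun fingroup perm ring lra zify.

Set Implicit Arguments.
Unset Strict Implicit.
Unset Printing Implicit Defensive.

Import Order.TTheory GRing.Theory Num.Theory.
Import numFieldNormedType.Exports.

Local Open Scope ring_scope.

(** * Toeplitz determinants and Day's formula *)

(** Why the relations act diagonally: the trace of the resolvent [U (y - U)^-1] is
    [y q'(y) / q(y) - N], so means of traces against [q(y_1) ... q(y_M)] are Euler operators
    [y_a d/dy_a] applied to the mean of that product. After multiplication by the Vandermonde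
    determinant, whose own derivatives absorb the terms in [y_a / (y_a - y_b)], such an operator
    multiplies [y^nu] by a polynomial in [nu]. The first relation fixes the sum of the [nu_a], the
    second one then the sum of their squares, hence the sum of any fixed quadratic polynomial;
    [(j - m) (j - m - N + 1)] is positive off the block [[m, m + N)] and nonpositive on it, which
    turns an equality of sums into a statement on supports. The relations are used only at integers
    [y_a > 1], where the resolvents are bounded on the group. In Day's formula the determinants of
    the basis changes are never computed: the case where the zeros coincide with the poles, with
    symbol 1, eliminates them. *)

Section Toeplitz.
Variable F : comNzRingType.
Implicit Types (p q : {poly F}) (g : int -> F).

Definition toeplitz (N : nat) (g : int -> F) : F :=
  \det (\matrix_(i < N, j < N) g (i%:Z - j%:Z)).

(** Coefficients of the product of [p] with the formal two-sided series whose coefficients are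
    [g]. *)
Definition conv p g (j : int) : F := \sum_(r < size p) p`_r * g (j - r%:Z).

Lemma conv_widen n p g j : (size p <= n)%N ->
  conv p g j = \sum_(r < n) p`_r * g (j - r%:Z).
Proof.
move=> le_pn; rewrite /conv (big_ord_widen _ (fun r => p`_r * g (j - r%:Z)) le_pn).
rewrite big_mkcond; apply: eq_bigr => r _; case: ltnP => // le_pr.
by rewrite nth_default ?mul0r.
Qed.

Lemma conv_exp0 p j : conv p (fun i => (i == 0)%:R) j =
  if j is Posz n then p`_n else 0.
Proof.
rewrite /conv; case: j => n; last first.
  rewrite big1 // => r _; suff /negPf->: Negz n - r%:Z != 0 by rewrite mulr0.
  by lia.
case: (ltnP n (size p)) => hn; last first.
  rewrite nth_default // big1 // => r _.
  suff /negPf->: (n%:Z - r%:Z != 0) by rewrite mulr0.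
  by have := ltn_ord r; lia.
rewrite (bigD1 (Ordinal hn)) //= subrr eqxx mulr1 big1 ?addr0 // => r.
rewrite -val_eqE /= => nr; suff /negPf->: (n%:Z - r%:Z != 0) by rewrite mulr0.
by lia.
Qed.

Lemma convD p q g j : conv (p + q) g j = conv p g j + conv q g j.
Proof.
set n := maxn (size p) (size q).
rewrite (conv_widen _ _ (size_polyD p q)) -/n (@conv_widen n p) ?leq_maxl //.
rewrite (@conv_widen n q) ?leq_maxr // -big_split /=.
by apply: eq_bigr => r _; rewrite coefD mulrDl.
Qed.

Lemma convZ a p g j : conv (a *: p) g j = a * conv p g j.
Proof.
rewrite !(@conv_widen (size p)) ?size_scale_leq // mulr_sumr.
by apply: eq_bigr => r _; rewrite coefZ mulrA.
Qed.

Lemma conv0 g j : conv 0 g j = 0.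
Proof. by rewrite /conv size_poly0 big_ord0. Qed.

Lemma convC a g j : conv a%:P g j = a * g j.
Proof.
by rewrite (@conv_widen 1) ?size_polyC_leq1 // big_ord1 coefC eqxx /= subr0.
Qed.

Lemma conv_sum (I : Type) (s : seq I) (P : pred I) (f : I -> {poly F}) g j :
  conv (\sum_(i <- s | P i) f i) g j = \sum_(i <- s | P i) conv (f i) g j.
Proof.
elim/big_rec2: _ => [|i x y _ <-]; first by rewrite conv0.
by rewrite convD.
Qed.

Lemma convMX p g j : conv (p * 'X) g j = conv p g (j - 1).
Proof.
rewrite (@conv_widen (size p).+1); last first.
  by apply: leq_trans (size_polyMleq _ _) _; rewrite size_polyX addn2.
rewrite big_ord_recl coefMX eqxx mul0r add0r; apply: eq_bigr => r _.
rewrite coefMX /=; congr (_ * g _); rewrite /bump /=; lia.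
Qed.

Lemma convM p q g j : conv (p * q) g j = conv p (conv q g) j.
Proof.
elim/poly_ind: p j => [|p c IH] j; first by rewrite mul0r !conv0.
rewrite mulrDl !convD mul_polyC convZ convC; congr (_ + _).
by rewrite -mulrA -commr_polyX mulrA !convMX IH.
Qed.

Lemma convMXn p g n j : conv ('X^n * p) g j = conv p g (j - n%:Z).
Proof.
elim: n j => [|n IH] j; first by rewrite expr0 mul1r subr0.
by rewrite exprSr -mulrA -commr_polyX mulrA convMX IH; congr (conv _ _ _); lia.
Qed.

Lemma convE p g1 g2 j : (forall r, (r < size p)%N -> g1 (j - r%:Z) = g2 (j - r%:Z)) ->
  conv p g1 j = conv p g2 j.
Proof. by move=> h; apply: eq_bigr => r _; rewrite h. Qed.

Definition coefmx n (e : 'I_n -> {poly F}) : 'M[F]_n := \matrix_(l, r) (e r)`_l.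

(** Acts on coefficient vectors of polynomials of degree below [M + N]: the top rows evaluate at the
    points [x], the bottom rows extract the coefficients [0, ..., N - 1] of the product with [g]. *)
Definition evalmx (M N : nat) (x : 'I_M -> F) (g : int -> F) : 'M[F]_(M + N) :=
  col_mx (\matrix_(s < M, l < M + N) x s ^+ l)
         (\matrix_(i < N, l < M + N) g (i%:Z - l%:Z)).

Lemma evalmx_mul (M N : nat) (x : 'I_M -> F) g (e : 'I_(M + N) -> {poly F}) :
  (forall r, size (e r) <= M + N)%N ->
  evalmx N x g *m coefmx e =
  col_mx (\matrix_(s, r) (e r).[x s]) (\matrix_(i, r) conv (e r) g i%:Z).
Proof.
move=> he; rewrite /evalmx mul_col_mx; congr col_mx; apply/matrixP => s r.
  rewrite !mxE (horner_coef_wide _ (he r)); apply: eq_bigr => l _.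
  by rewrite !mxE mulrC.
rewrite !mxE (conv_widen _ _ (he r)); apply: eq_bigr => l _.
by rewrite !mxE mulrC.
Qed.

Definition vdet (M : nat) (x : 'I_M -> F) : F := \det (\matrix_(s < M, l < M) x s ^+ l).

(** In the basis [1, ..., X^(M-1), P, X P, ..., X^(N-1) P], unitriangular over the monomials, the
    multiples of [P] vanish at every [x s], so the matrix becomes block triangular with a
    Vandermonde and a Toeplitz block. *)
Lemma det_evalmx (M N : nat) (x : 'I_M -> F) g (P : {poly F}) :
    P = \prod_(s < M) ('X - (x s)%:P) ->
  \det (evalmx N x g) = vdet x * toeplitz N (conv P g).
Proof.
move=> defP.
have szP : size P = M.+1 by rewrite defP size_prod_XsubC /index_enum -enumT size_enum_ord.
have monP : P \is monic by rewrite defP monic_prod_XsubC.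
have P_root s : P.[x s] = 0.
  by rewrite defP horner_prod (bigD1 s) //= hornerXsubC subrr mul0r.
pose e (r : 'I_(M + N)) : {poly F} :=
  match fintype.split r with inl r => 'X^r | inr r => 'X^r * P end.
have sz_e r : (size (e r) <= M + N)%N.
  rewrite /e; case: splitP => l _; rewrite ?size_polyXn.
    by rewrite ltn_addr.
  by rewrite size_monicM ?monicXn // ?monic_neq0 // size_polyXn szP /=; have := ltn_ord l; lia.
have det_e : \det (coefmx e) = 1.
  have -> : coefmx e = block_mx 1%:M (ursubmx (coefmx e)) 0 (drsubmx (coefmx e)).
    rewrite -[LHS]submxK; congr block_mx; apply/matrixP => l r; rewrite !mxE /e.
      by rewrite (unsplitK (inl r)) coefXn.
    rewrite (unsplitK (inl r)) coefXn /=; case: eqP => //=.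
    by have := ltn_ord r; lia.
  rewrite det_ublock det1 mul1r -det_tr det_trig; last first.
    apply/is_trig_mxP => r l ltrl; rewrite !mxE /e (unsplitK (inr r)) coefXnM /=.
    case: ltnP => // _; rewrite nth_default // szP; lia.
  rewrite big1 // => l _; rewrite !mxE /e (unsplitK (inr l)) coefXnM /=.
  rewrite ltnNge leq_addl /= addnK; move/monicP: monP; rewrite lead_coefE szP //.
rewrite -[LHS]mulr1 -{1}det_e -det_mulmx evalmx_mul //.
set B := col_mx _ _.
have -> : B = block_mx (\matrix_(s < M, l < M) x s ^+ l) 0 (dlsubmx B)
   (\matrix_(i < N, j < N) conv P g (i%:Z - j%:Z)).
  rewrite -[LHS]submxK; congr block_mx; apply/matrixP => l r.
  - by rewrite !mxE (unsplitK (inl _)) mxE /e (unsplitK (inl r)) hornerXn.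
  - by rewrite !mxE (unsplitK (inl _)) mxE /e (unsplitK (inr r)) hornerM P_root mulr0.
  - by rewrite !mxE (unsplitK (inr _)) mxE /e (unsplitK (inr r)) convMXn.
by rewrite det_lblock.
Qed.
End Toeplitz.

(** * Vandermonde determinants and a Laplace expansion *)

Section Interleaved.
Variable F : fieldType.

Lemma vdetE (n : nat) (x : 'I_n -> F) :
  vdet x = \prod_(i < n) \prod_(j < n | (i < j)%N) (x j - x i).
Proof.
rewrite /vdet -det_tr; transitivity (\det (Vandermonde n (\row_j x j))).
  by congr (\det _); apply/matrixP => i j; rewrite !mxE.
by rewrite det_Vandermonde; do 2!apply: eq_bigr => ? _; rewrite !mxE.
Qed.

Lemma vdet_neq0 (n : nat) (x : 'I_n -> F) : injective x -> vdet x != 0.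
Proof.
move=> injx; rewrite vdetE; apply/prodf_neq0 => i _; apply/prodf_neq0 => j ltij.
by rewrite subr_eq0 (inj_eq injx) -val_eqE gtn_eqF.
Qed.

Lemma vdet_split (m n : nat) (x : 'I_(m + n) -> F) :
  vdet x = vdet (x \o @lshift m n) * vdet (x \o @rshift m n) *
    \prod_(i < m) \prod_(j < n) (x (rshift m j) - x (lshift n i)).
Proof.
rewrite !vdetE big_split_ord /= mulrAC -big_split /=; congr (_ * _).
  by apply: eq_bigr => i _; rewrite big_split_ord /=; congr (_ * _);
    apply: eq_bigl => j /=; rewrite ltn_addr.
apply: eq_bigr => i _; rewrite big_split_ord /= big1 ?mul1r; last first.
  by move=> j; rewrite ltnNge leq_eqVlt ltn_addr ?orbT.
by apply: eq_bigl => j; rewrite ltn_add2l.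
Qed.

Lemma vdet_perm (n : nat) (x : 'I_n -> F) (t : 'S_n) :
  vdet (x \o t) = (-1) ^+ t * vdet x.
Proof.
rewrite -det_perm -det_mulmx -row_permE; congr (\det _).
by apply/matrixP => i j; rewrite !mxE.
Qed.

(** Listing [M] and then its complement moves the rows of [M] to the first half, which makes the
    matrices attached to [M] block diagonal. *)
Lemma perm_half (k : nat) (M : {set 'I_(k + k)}) : #|M| = k ->
  {t : 'S_(k + k) | forall i, (t (lshift k i) \in M) && (t (rshift k i) \notin M)}.
Proof.
move=> cM; have cM' : #|~: M| = k by rewrite cardsCs finset.setCK card_ord cM addnK.
have sz1 : size (enum M) = k by rewrite -cardE.
have sz2 : size (enum (~: M)) = k by rewrite -cardE.
pose f (s : 'I_(k + k)) := nth s (enum M ++ enum (~: M)) s.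
have injf : injective f.
  move=> s t; rewrite /f (set_nth_default t) ?size_cat ?sz1 ?sz2 // => /eqP.
  rewrite nth_uniq ?size_cat ?sz1 ?sz2 // => [/eqP/val_inj //|].
  rewrite cat_uniq !enum_uniq andbT /=; apply/hasPn => i.
  by rewrite !mem_enum inE.
exists (perm injf) => i; rewrite !permE /f !nth_cat sz1 /= ltn_ord ltnNge leq_addr /=.
rewrite -mem_enum mem_nth ?sz1 //= addKn.
by have := @mem_nth _ (rshift k i) (enum (~: M)) i; rewrite sz2 mem_enum inE => /(_ (ltn_ord i)).
Qed.

(** Form taken by the bordered determinant once inner and outer poles are separated: [u] will be the
    product over the outer poles, [v] that over the inner poles together with the shift [x ^+ N]. *)
Definition halves_det (k : nat) (u v x : 'I_(k + k) -> F) : F :=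
  \det (\matrix_(s < k + k, l < k + k)
     match fintype.split l with inl i => u s * x s ^+ i | inr i => v s * x s ^+ i end).

(** Laplace expansion along the two halves of the columns: the minors are Vandermonde determinants,
    and division by the full Vandermonde determinant leaves only the differences between [M] and its
    complement. *)
Lemma halves_detE (k : nat) (u v x : 'I_(k + k) -> F) : injective x ->
  halves_det u v x = vdet x *
   \sum_(M : {set 'I_(k + k)} | #|M| == k)
     \prod_s (if s \in M then u s else v s) /
     \prod_(s in M) \prod_(t in ~: M) (x t - x s).
Proof.
move=> injx.
pose a (s l : 'I_(k + k)) := if fintype.split l is inl i then x s ^+ i else 0.
pose b (s l : 'I_(k + k)) := if fintype.split l is inr i then x s ^+ i else 0.
pose B (M : {set 'I_(k + k)}) := \matrix_(s, l) (if s \in M then a s l else b s l).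
have -> : halves_det u v x =
    \sum_(M : {set 'I_(k + k)}) \prod_s (if s \in M then u s else v s) * \det (B M).
  rewrite /halves_det /determinant.
  under eq_bigr => t _.
    under eq_bigr => s _.
      rewrite mxE (_ : match _ with inl _ => _ | inr _ => _ end =
         u s * a s (t s) + v s * b s (t s)); last first.
        by rewrite /a /b; case: (fintype.split (t s)) => i; rewrite mulr0 ?addr0 ?add0r.
      over.
    rewrite bigA_distr mulr_sumr; over.
  rewrite exchange_big /=; apply: eq_bigr => M _; rewrite mulr_sumr.
  apply: eq_bigr => t _; rewrite mulrCA; congr (_ * _); rewrite -big_split /=.
  by apply: eq_bigr => s _; rewrite mxE; case: ifP.
(* Only [#|M| = k] survives: a permutation with a nonzero term sends the rows of [M] exactly onto
   the first [k] columns. *)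
rewrite (bigID (fun M : {set 'I_(k + k)} => #|M| == k)) /= [X in _ + X]big1 ?addr0; last first.
  move=> M cM; apply/eqP; rewrite mulf_eq0; apply/orP; right; apply/eqP.
  rewrite /determinant big1 // => t _; apply/eqP; rewrite mulf_eq0; apply/orP; right.
  apply: contraR cM => /prodf_neq0 h.
  have h1 s : s \in M -> (t s < k)%N.
    by move=> sM; have := h s isT; rewrite mxE sM /a; case: splitP => //; rewrite eqxx.
  have h2 s : s \notin M -> (k <= t s)%N.
    move=> sM; have := h s isT; rewrite mxE (negPf sM) /b; case: splitP => //; first by rewrite eqxx.
    by move=> j -> _; rewrite leq_addr.
  have -> : M = [set t^-1%g (lshift k i) | i : 'I_k].
    apply/finset.setP => s; apply/idP/imsetP => [/h1 lts|[i _ ->]].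
      by exists (Ordinal lts) => //; apply/(canRL (permK t)); apply: val_inj.
    by apply: contraT => /h2; rewrite permKV /= leqNgt ltn_ord.
  by rewrite card_imset ?card_ord // => i j /perm_inj/lshift_inj.
rewrite mulr_sumr; apply: eq_bigr => M /eqP cM.
rewrite mulrCA; congr (_ * _).
have [t tP] := perm_half cM.
have prE : \prod_(s in M) \prod_(r in ~: M) (x r - x s) =
   \prod_(i < k) \prod_(j < k) (x (t (rshift k j)) - x (t (lshift k i))).
  rewrite (reindex_inj (@perm_inj _ t)) /= big_split_ord /= [X in _ * X]big_pred0 ?mulr1; last first.
    by move=> i; have /andP[_ /negPf] := tP i.
  apply: eq_big => [i|i _]; first by have /andP[->] := tP i.
  rewrite (reindex_inj (@perm_inj _ t)) /= big_split_ord /= big_pred0 ?mul1r; last first.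
    by move=> j; rewrite inE; have /andP[->] := tP j.
  by apply: eq_bigl => j; rewrite inE; have /andP[_ ->] := tP j.
have pr_neq0 : \prod_(s in M) \prod_(r in ~: M) (x r - x s) != 0.
  apply/prodf_neq0 => s sM; apply/prodf_neq0 => r; rewrite inE => rM.
  by rewrite subr_eq0 (inj_eq injx); apply: contraNneq rM => ->.
apply: (mulIf pr_neq0); rewrite mulfVK // prE.
(* The sign of the row permutation occurs both in [\det (B M)] and in [vdet x], hence cancels. *)
apply: (mulfI (negbT (signr_eq0 F t))).
rewrite -vdet_perm vdet_split mulrA -det_perm -det_mulmx -row_permE; congr (_ * _).
have -> : row_perm t (B M) =
    block_mx (\matrix_(i, j) x (t (lshift k i)) ^+ j) 0 0
             (\matrix_(i, j) x (t (rshift k i)) ^+ j).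
  rewrite -[LHS]submxK; congr block_mx; apply/matrixP => i j; rewrite !mxE;
    have /andP[tl /negPf tr] := tP i; rewrite ?tl ?tr.
  - by rewrite /a (unsplitK (inl j)).
  - by rewrite /a (unsplitK (inr j)).
  - by rewrite /b (unsplitK (inl j)).
  - by rewrite /b (unsplitK (inr j)).
by rewrite det_ublock.
Qed.
End Interleaved.

(** * Partial fractions through Lagrange interpolation *)

Section Lagrange.
Variables (F : fieldType) (n : nat) (p : 'I_n -> F).
Hypothesis injp : injective p.

Definition omit (r : 'I_n) : {poly F} := \prod_(s < n | s != r) ('X - (p s)%:P).

Lemma size_omit r : size (omit r) = n.
Proof.
rewrite /omit size_prod => [|s _]; last by rewrite polyXsubC_eq0.
under eq_bigr do rewrite size_XsubC.
rewrite sum_nat_const cardC1 card_ord; have := ltn_ord r; lia.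
Qed.

Lemma omit_mul r : \prod_(s < n) ('X - (p s)%:P) = ('X - (p r)%:P) * omit r.
Proof. by rewrite (bigD1 r). Qed.

Lemma omit_neq r s : s != r -> (omit r).[p s] = 0.
Proof.
by move=> nsr; rewrite horner_prod (bigD1 s) //= hornerXsubC subrr mul0r.
Qed.

Lemma omit_diag r : (omit r).[p r] != 0.
Proof.
rewrite horner_prod; apply/prodf_neq0 => s nsr.
by rewrite hornerXsubC subr_eq0 (inj_eq injp) eq_sym.
Qed.

Lemma lagrange_interp (h : {poly F}) : (size h <= n)%N ->
  h = \sum_r (h.[p r] / (omit r).[p r]) *: omit r.
Proof.
move=> szh; apply/eqP; rewrite -subr_eq0; apply/eqP.
apply: (@roots_geq_poly_eq0 _ _ [seq p s | s : 'I_n]).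
- apply/allP => _ /mapP[s _ ->]; rewrite rootE !hornerE horner_sum (bigD1 s) //= big1.
    by rewrite addr0 hornerZ divfK ?omit_diag ?subrr.
  by move=> r nrs; rewrite hornerZ (@omit_neq r s) ?mulr0 // eq_sym.
- by rewrite map_inj_uniq ?enum_uniq.
rewrite size_map size_enum_ord (leq_trans (size_polyD _ _)) // geq_max szh size_polyN.
apply: leq_trans (size_sum _ _ _) _; apply/bigmax_leqP => r _.
by rewrite (leq_trans (size_scale_leq _ _)) // size_omit.
Qed.

(** Laurent coefficients of [1 / (x - z)] on the unit circle: powers of [x] when the pole is outside
    ([out]), powers of [x^-1] when it is inside. *)
Definition pole_seq (out : bool) (z : F) (j : int) : F :=
  if out then - (z ^ (- j - 1) *+ (0 <= j)%R) else z ^ (- j - 1) *+ (j < 0)%R.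

Lemma conv_pole_seq (out : bool) (z : F) (j : int) : (out -> z != 0) ->
  conv ('X - z%:P) (pole_seq out z) j = (j == 0)%:R.
Proof.
move=> z0; rewrite convD -polyCN convC -['X]mul1r convMX (convC 1) mul1r /pole_seq.
case: out z0 => [/(_ isT) z0|_].
  have -> : (0 <= j - 1) = (0 <= j) && (j != 0) by lia.
  have -> : - (j - 1) - 1 = - j - 1 + 1 :> int by ring.
  rewrite [z ^ (_ + 1)]expfzDr ?expr1z //.
  case: (ltrP j 0) => /= [|j0]; first by case: eqP => [->//|]; rewrite !mulr0n oppr0 mulr0 addr0.
  have [->|_] := eqVneq j 0; last by rewrite !mulr1n mulr0n; ring.
  by rewrite mulr0n oppr0 add0r mulr1n oppr0 add0r mulrNN exprN1 mulfV.
have -> : (j - 1 < 0) = (j < 0) || (j == 0) by lia.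
have [->|nj0] /= := eqVneq j 0; first by rewrite oppr0 add0r subrr ?mulr0 ?addr0 ?expr0z.
rewrite orbF; case: (ltrP j 0) => /= j0; last by rewrite mulr0 addr0.
rewrite !mulr1n; have -> : - (j - 1) - 1 = - j - 1 + 1 :> int by ring.
rewrite [z ^ (_ + 1)]exprzD_ss ?expr1z; [ring|lia].
Qed.

(** Partial fractions of the reciprocal of [\prod_s (x - p s)], each pole expanded on its own side.
    For [n = 0] the function is 1, which the empty sum would miss. *)
Definition pole_sum (out : 'I_n -> bool) (j : int) : F :=
  if n == 0%N then (j == 0)%:R else
  \sum_r (omit r).[p r]^-1 * pole_seq (out r) (p r) j.

(** Multiplication by [h] acts on the partial fraction at [p r] as multiplication by [h.[p r]], up
    to polynomial parts [q r] whose weighted sum vanishes because [h] has degree below [n]. *)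
Lemma conv_pole_sum (out : 'I_n -> bool) (h : {poly F}) (j : int) :
    (forall r, out r -> p r != 0) -> (size h <= n)%N ->
  conv h (pole_sum out) j =
  \sum_r h.[p r] / (omit r).[p r] * pole_seq (out r) (p r) j.
Proof.
move=> out0 szh; have [n0|n_gt0] := posnP n.
  have -> : h = 0 by apply/eqP; rewrite -size_poly_leq0 (leq_trans szh) ?n0.
  by rewrite conv0 big1 // => r _; rewrite horner0 !mul0r.
pose q r := (h - h.[p r]%:P) %/ ('X - (p r)%:P).
have qE r : h = q r * ('X - (p r)%:P) + h.[p r]%:P.
  rewrite divpK ?subrK // dvdp_XsubCl rootE !hornerE subrr //.
have q0 : \sum_r (omit r).[p r]^-1 *: q r = 0.
  have /monic_neq0 Q0 : \prod_(s < n) ('X - (p s)%:P) \is monic by rewrite monic_prod_XsubC.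
  apply: (mulfI Q0); rewrite mulr0 mulr_sumr.
  (* Times the product of all [X - p s], the sum is [h] times the interpolant of 1, minus the
     interpolant of [h]. *)
  transitivity (h * \sum_r (1.[p r] / (omit r).[p r]) *: omit r -
                \sum_r (h.[p r] / (omit r).[p r]) *: omit r).
    rewrite mulr_sumr -sumrB; apply: eq_bigr => r _.
    rewrite (omit_mul r) -!scalerAr hornerC mul1r.
    have -> : ('X - (p r)%:P) * omit r * q r = (h - h.[p r]%:P) * omit r.
      by rewrite mulrAC [_ * q r]mulrC; congr (_ * _); rewrite {1}(qE r) addrK.
    by rewrite mulrBl scalerBr mul_polyC scalerA [_^-1 * _]mulrC.
  by rewrite -!lagrange_interp ?size_poly1 // mulr1 subrr.
transitivity (\sum_r (omit r).[p r]^-1 * conv h (pole_seq (out r) (p r)) j).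
  rewrite /conv; under [RHS]eq_bigr do rewrite mulr_sumr.
  rewrite exchange_big /=; apply: eq_bigr => l _; rewrite /pole_sum.
  by rewrite gtn_eqF // mulr_sumr; apply: eq_bigr => r _; rewrite mulrCA.
have -> : \sum_r (omit r).[p r]^-1 * conv h (pole_seq (out r) (p r)) j =
  conv (\sum_r (omit r).[p r]^-1 *: q r) (fun i => (i == 0)%:R) j +
  \sum_r h.[p r] / (omit r).[p r] * pole_seq (out r) (p r) j.
  rewrite conv_sum -big_split /=; apply: eq_bigr => r _.
  rewrite {1}(qE r) convD convM convC convZ mulrDr; congr (_ * _ + _).
    by apply: convE => l _; rewrite conv_pole_seq //; apply: out0.
  by rewrite mulrCA mulrA.
by rewrite q0 conv0 add0r.
Qed.

Lemma conv_omit_pole_sum (out : 'I_n -> bool) r (j : int) :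
    (forall r, out r -> p r != 0) ->
  conv (omit r) (pole_sum out) j = pole_seq (out r) (p r) j.
Proof.
move=> out0; rewrite conv_pole_sum ?size_omit // (bigD1 r) //= big1 => [|s nsr].
  by rewrite divff ?omit_diag // mul1r addr0.
by rewrite omit_neq // !mul0r.
Qed.

Lemma conv_prod_pole_sum (out : 'I_n -> bool) (j : int) :
    (forall r, out r -> p r != 0) ->
  conv (\prod_(s < n) ('X - (p s)%:P)) (pole_sum out) j = (j == 0)%:R.
Proof.
move=> out0; have [n0|n_gt0] := posnP n.
  rewrite (eq_bigl xpred0) ?big_pred0_eq => [|s]; last by case: s; rewrite n0.
  by rewrite (convC 1) mul1r /pole_sum (introT eqP n0).
pose r := Ordinal n_gt0.
rewrite (omit_mul r) convM -(@conv_pole_seq (out r) (p r)); last exact: out0.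
by apply: convE => l _; rewrite conv_omit_pole_sum.
Qed.
End Lagrange.

(** * Day's formula for simple poles *)

Section Day.
Variables (F : fieldType) (k N : nat) (p : 'I_(k + k) -> F).
Hypothesis injp : injective p.
Hypothesis p_neq0 : forall j, p (rshift k j) != 0.

Let out (s : 'I_(k + k)) : bool := (k <= s)%N.
Let qin (z : F) := \prod_(i < k) (z - p (lshift k i)).
Let qout (z : F) := \prod_(j < k) (z - p (rshift k j)).
Let g := pole_sum p out.

Definition day_sum (x : 'I_(k + k) -> F) : F :=
  \sum_(M : {set 'I_(k + k)} | #|M| == k)
     \prod_s (if s \in M then qout (x s) else qin (x s) * x s ^+ N) /
     \prod_(s in M) \prod_(t in ~: M) (x t - x s).

Let D (x : 'I_(k + k) -> F) := halves_det (qout \o x) (fun s => qin (x s) * x s ^+ N) x.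

(** The factor [X^N] at the outer poles pushes their sequences, supported on nonnegative indices,
    beyond the window [0 <= i < N]; those of the inner poles are supported on negative indices. *)
Let e (s : 'I_(k + k)) : {poly F} := if out s then 'X^N * omit p s else omit p s.
Let Q := \prod_(s < k + k) ('X - (p s)%:P).
Let f (r : 'I_(k + k + N)) : {poly F} :=
  match fintype.split r with inl s => e s | inr l => 'X^l * Q end.

Let out_neq0 s : out s -> p s != 0.
Proof. by rewrite /out; case: (split_ordP s) => i -> //=; rewrite leqNgt ltn_ord. Qed.

Let szQ : size Q = (k + k).+1.
Proof. by rewrite /Q size_prod_XsubC /index_enum -enumT size_enum_ord. Qed.

Let size_f r : (size (f r) <= k + k + N)%N.
Proof.
rewrite /f; case: (fintype.split r) => [s|l]; rewrite /e.
  case: ifP => _; last by rewrite size_omit leq_addr.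
  by rewrite (leq_trans (size_polyMleq _ _)) // size_polyXn size_omit addSn /= addnC.
rewrite (leq_trans (size_polyMleq _ _)) // size_polyXn szQ /=; have := ltn_ord l; lia.
Qed.

Let W (x : 'I_(k + k) -> F) := \det (\matrix_(s, r) (e r).[x s]).

(** In the basis [f] the bottom rows of [evalmx] become a zero block and an identity block, so only
    the values of the [e r] at the points [x] remain. *)
Let det_W (x : 'I_(k + k) -> F) :
  vdet x * toeplitz N (conv (\prod_(s < k + k) ('X - (x s)%:P)) g) * \det (coefmx f) = W x.
Proof.
rewrite -(det_evalmx _ _ erefl) -det_mulmx evalmx_mul //.
set B := col_mx _ _.
have -> : B = block_mx (\matrix_(s, r) (e r).[x s]) (ursubmx B) 0 1%:M.
  rewrite -[LHS]submxK; congr block_mx; apply/matrixP => l r.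
  - by rewrite !mxE (unsplitK (inl _)) mxE /f (unsplitK (inl r)).
  - rewrite !mxE (unsplitK (inr _)) mxE /f (unsplitK (inl r)) /e.
    case: ifP => o; rewrite ?convMXn conv_omit_pole_sum // /pole_seq o.
      have -> : (0 <= l%:Z - N%:Z) = false by have := ltn_ord l; lia.
      by rewrite mulr0n oppr0.
    by rewrite mulr0n.
  rewrite !mxE (unsplitK (inr _)) mxE /f (unsplitK (inr r)) convMXn.
  by rewrite conv_prod_pole_sum // subr_eq0.
by rewrite det_ublock det1 mulr1.
Qed.

Let h (b : bool) (i : 'I_k) : {poly F} :=
  \prod_(j < k | j != i) ('X - (p (if b then rshift k j else lshift k j))%:P).

Let size_h b i : size (h b i) = k.
Proof. exact: (size_omit (fun j => p (if b then rshift k j else lshift k j)) i). Qed.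

(** [omit p s] contains the whole product over the poles of the other kind; the cofactor [h] has
    degree below [k], so its coefficients split off as a block diagonal matrix independent of
    [x]. *)
Let W_D (x : 'I_(k + k) -> F) :
  W x = D x * (\det (coefmx (h false)) * \det (coefmx (h true))).
Proof.
rewrite -(@det_lblock _ k k _ 0) -det_mulmx; congr (\det _).
set A := matrix_of_fun _ _; set C := matrix_of_fun _ _.
apply/matrixP => s r; rewrite [RHS]mxE big_split_ord /=.
case: (split_ordP r) => j ->; rewrite [LHS]mxE /e.
- rewrite [X in _ + X]big1 ?addr0 => [|i _]; last first.
    by rewrite block_mxEdl [X in _ * X]mxE mulr0.
  have -> : out (lshift k j) = false by rewrite /out leqNgt /= ltn_ord.
  have -> : omit p (lshift k j) = \prod_(i < k) ('X - (p (rshift k i))%:P) * h false j.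
    rewrite /omit big_split_ord /= mulrC; congr (_ * _); apply: eq_bigl => i.
    by rewrite eq_rlshift.
  rewrite hornerM [X in _ * X](@horner_coef_wide _ k) ?size_h // mulr_sumr; apply: eq_bigr => i _.
  rewrite block_mxEul mxE (unsplitK (inl i)) mxE horner_prod /qout /=.
  by under eq_bigr do rewrite hornerXsubC; ring.
rewrite big1 ?add0r => [|i _]; last first.
  by rewrite block_mxEur [X in _ * X]mxE mulr0.
have -> : out (rshift k j) by rewrite /out leq_addr.
have -> : omit p (rshift k j) = \prod_(i < k) ('X - (p (lshift k i))%:P) * h true j.
  rewrite /omit big_split_ord /=; congr (_ * _); apply: eq_bigl => i.
    by rewrite eq_lrshift.
  by rewrite (inj_eq (@rshift_inj _ _)).
rewrite !hornerM hornerXn [X in _ * (_ * X)](@horner_coef_wide _ k) ?size_h // !mulr_sumr.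
apply: eq_bigr => i _.
rewrite block_mxEdr mxE (unsplitK (inr i)) mxE horner_prod /qin /=.
by under eq_bigr do rewrite hornerXsubC; ring.
Qed.

(** At [x = p] the matrix of values is diagonal with nonzero entries. This makes the block diagonal
    factor of [W_D] cancellable. *)
Let W_p : W p != 0.
Proof.
rewrite /W det_trig.
  apply/prodf_neq0 => s _; rewrite mxE /e; case: ifP => [/out_neq0 ps0|_].
    by rewrite hornerM hornerXn mulf_neq0 ?expf_neq0 ?omit_diag.
  by rewrite omit_diag.
apply/is_trig_mxP => s r ltsr; rewrite mxE /e.
have nsr : s != r by rewrite -val_eqE ltn_eqF.
by case: ifP => _; rewrite ?hornerM omit_neq ?mulr0.
Qed.

Let D_p : D p = vdet p * (\prod_(i < k) \prod_(j < k) (p (lshift k i) - p (rshift k j)) *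
   \prod_(j < k) p (rshift k j) ^+ N).
Proof.
have qin0 i : qin (p (lshift k i)) = 0 by rewrite /qin (bigD1 i) //= subrr mul0r.
have qout0 i : qout (p (rshift k i)) = 0 by rewrite /qout (bigD1 i) //= subrr mul0r.
rewrite vdet_split /D /halves_det.
set A := matrix_of_fun _ _.
have -> : A = block_mx (\matrix_(i, j) (qout (p (lshift k i)) * p (lshift k i) ^+ j)) 0 0
   (\matrix_(i, j) (qin (p (rshift k i)) * p (rshift k i) ^+ N * p (rshift k i) ^+ j)).
  rewrite -[LHS]submxK; congr block_mx; apply/matrixP => i j; rewrite !mxE.
  - by rewrite (unsplitK (inl j)).
  - by rewrite (unsplitK (inr j)) qin0 !mul0r.
  - by rewrite (unsplitK (inl j)) /= qout0 !mul0r.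
  - by rewrite (unsplitK (inr j)).
rewrite det_ublock.
have scale_rows (u y : 'I_k -> F) : \det (\matrix_(i < k, j < k) (u i * y i ^+ j)) =
    \prod_i u i * vdet y.
  rewrite /vdet -[X in X * _](_ : \det (diag_mx (\row_i u i)) = _); last first.
    by rewrite det_diag; apply: eq_bigr => i _; rewrite mxE.
  rewrite -det_mulmx; congr (\det _); apply/matrixP => i j.
  by rewrite mul_diag_mx !mxE.
rewrite !scale_rows big_split /=.
have -> : \prod_(j < k) qin (p (rshift k j)) =
    \prod_(i < k) \prod_(j < k) (p (rshift k j) - p (lshift k i)).
  by rewrite exchange_big.
have -> : \prod_(i < k) qout (p (lshift k i)) =
  \prod_(i < k) \prod_(j < k) (p (lshift k i) - p (rshift k j)) by [].
by rewrite /comp; ring.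
Qed.

(** [det_W] and [W_D] involve the same unknown determinants at [x] and at [x = p]. At [x = p] the
    symbol and its Toeplitz determinant are 1, which eliminates the unknowns. *)
Lemma toeplitz_pole_sum (x : 'I_(k + k) -> F) : injective x ->
  toeplitz N (conv (\prod_(s < k + k) ('X - (x s)%:P)) g) *
    (\prod_(i < k) \prod_(j < k) (p (lshift k i) - p (rshift k j)) *
     \prod_(j < k) p (rshift k j) ^+ N) = day_sum x.
Proof.
move=> injx; set T := toeplitz _ _; set E := (X in T * X = _).
have := det_W p; rewrite W_D D_p (_ : toeplitz _ _ = 1) ?mulr1; last first.
  rewrite /toeplitz -[RHS](det1 F N); congr (\det _); apply/matrixP => i j.
  by rewrite !mxE conv_prod_pole_sum // subr_eq0.
have := W_p; rewrite W_D mulf_eq0 negb_or => /andP[_ H0].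
rewrite -/E -mulrA => /(mulfI (vdet_neq0 injp)) kE.
have := det_W x; rewrite -/T W_D kE mulrA => /(mulIf H0).
by rewrite /D halves_detE // -mulrA => /(mulfI (vdet_neq0 injx)).
Qed.
End Day.

(** * Alternating sums supported on one orbit of exponents *)

Section LogDerivative.
Variable F : fieldType.

Lemma deriv_prod_XsubC (n : nat) (z : 'I_n -> F) (P : pred 'I_n) (x : F) :
    (forall i, P i -> x != z i) ->
  (\prod_(i < n | P i) ('X - (z i)%:P))^`().[x] =
  (\prod_(i < n | P i) ('X - (z i)%:P)).[x] * \sum_(i < n | P i) (x - z i)^-1.
Proof.
move=> xz; apply: (big_rec2 (fun (p : {poly F}) s => p^`().[x] = p.[x] * s)).
  by rewrite derivC !hornerE.
move=> i p s Pi IH.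
rewrite derivM !hornerE IH derivXsubC hornerC mul1r.
have : x - z i != 0 by rewrite subr_eq0 xz.
by move=> ?; field.
Qed.

(** Leibniz expansion of the Vandermonde determinant, each term weighted by [f]. *)
Definition altsum (M : nat) (y : 'I_M -> F) (f : 'S_M -> F) : F :=
  \sum_(t : 'S_M) (-1) ^+ t * \prod_a y a ^+ t a * f t.

Lemma altsumD M (y : 'I_M -> F) f1 f2 :
  altsum y (fun t => f1 t + f2 t) = altsum y f1 + altsum y f2.
Proof. by rewrite -big_split; apply: eq_bigr => t _; rewrite mulrDr. Qed.

Lemma altsumZ M (y : 'I_M -> F) c f : altsum y (fun t => c * f t) = c * altsum y f.
Proof. by rewrite mulr_sumr; apply: eq_bigr => t _; rewrite mulrCA. Qed.

Lemma altsum1 M (y : 'I_M -> F) : altsum y (fun=> 1) = vdet y.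
Proof.
apply: eq_bigr => t _; rewrite mulr1; congr (_ * _).
by apply: eq_bigr => a _; rewrite mxE.
Qed.

(** Weighting by the exponent of [y a] is the Euler operator [y_a d/dy_a]; the logarithmic
    derivative of the Vandermonde determinant in [y a] is the sum of the [1 / (y a - y b)]. *)
Lemma altsum_index M (y : 'I_M -> F) a : injective y ->
  altsum y (fun t => (t a)%:R) = vdet y * \sum_(b < M | b != a) y a / (y a - y b).
Proof.
move=> injy.
(* The Vandermonde determinant as a polynomial in its node [a]: of degree below [M] and zero at the
   other nodes, hence a multiple of [omit y a]. *)
pose v : {poly F} := \sum_(t : 'S_M) ((-1) ^+ t * \prod_(b | b != a) y b ^+ t b) *: 'X^(t a).
have vE x : v.[x] = \det (\matrix_(b < M, l < M) (if b == a then x else y b) ^+ l).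
  rewrite horner_sum; apply: eq_bigr => t _; rewrite hornerZ hornerXn -mulrA; congr (_ * _).
  rewrite [RHS](bigD1 a) //= mxE eqxx mulrC; congr (_ * _).
  by apply: eq_bigr => b /negPf nba; rewrite mxE nba.
have va : v.[y a] = vdet y.
  rewrite vE; congr (\det _); apply/matrixP => b l; rewrite !mxE.
  by case: eqP => [->|].
have vb b : b != a -> v.[y b] = 0.
  move=> nba; rewrite vE; apply: (determinant_alternate nba) => l.
  by rewrite !mxE eqxx (negPf nba).
have szv : (size v <= M)%N.
  apply: leq_trans (size_sum _ _ _) _; apply/bigmax_leqP => t _.
  by rewrite (leq_trans (size_scale_leq _ _)) // size_polyXn.
have vF : v = (vdet y / (omit y a).[y a]) *: omit y a.
  rewrite {1}(lagrange_interp injy szv) (bigD1 a) //= va big1 ?addr0 // => b nba.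
  by rewrite vb // mul0r scale0r.
have -> : altsum y (fun t => (t a)%:R) = y a * v^`().[y a].
  rewrite /v raddf_sum horner_sum mulr_sumr; apply: eq_bigr => t _.
  rewrite (bigD1 a) //= linearZ /= hornerZ derivXn hornerMn hornerXn.
  move: ((-1) ^+ t) (\prod_(_ < _ | _) _) => e1 e2.
  case: (nat_of_ord (t a)) => [|l]; first by rewrite !mulr0n !mulr0.
  by rewrite exprS -[_ *+ _.+1]mulr_natr; set n := _%:R; ring.
rewrite vF linearZ /= hornerZ deriv_prod_XsubC => [|b nba]; last by rewrite (inj_eq injy) eq_sym.
rewrite -/(omit y a) -mulr_sumr; set S := \sum_(_ < _ | _) _.
by have := omit_diag injy a; move: (omit y a).[y a] => o o0; field.
Qed.
End LogDerivative.

(** * Monomial expansion of a product of values times the Vandermonde determinant *)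

Section Expansion.
Variables (F : fieldType) (M N : nat).
Implicit Types (q : {poly F}) (y : 'I_M -> F) (nu : {ffun 'I_M -> 'I_(M + N)}).

(** Coefficient of [y^nu] in [\prod_a q.[y a] * vdet y]; see [alt_coef_sum]. *)
Definition alt_coef q nu : F := \det (\matrix_(a < M, l < M) ('X^l * q)`_(nu a)).

Definition monom y nu : F := \prod_a y a ^+ nu a.

Lemma alt_coef_weight q (w : 'I_M -> nat -> F) :
  \sum_nu alt_coef q nu * \prod_a w a (nu a) =
  \sum_(t : 'S_M) (-1) ^+ t * \prod_a \sum_(j < M + N) ('X^(t a) * q)`_j * w a j.
Proof.
under [RHS]eq_bigr do rewrite bigA_distr_bigA mulr_sumr.
rewrite exchange_big /=; apply: eq_bigr => nu _; rewrite /alt_coef /determinant mulr_suml.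
apply: eq_bigr => t _; rewrite big_split /= mulrA; congr (_ * _ * _).
by apply: eq_bigr => a _; rewrite mxE.
Qed.

(** A factor [nu a] on [y^nu] is the operator [y_a d/dy_a], and on [y^t q(y)] this operator is
    multiplication by [t + y q'(y) / q(y)]. *)
Lemma alt_coef_expand q y (S : pred 'I_M) :
    (size q <= N.+1)%N -> (forall a, S a -> q.[y a] != 0) ->
  \sum_nu alt_coef q nu * monom y nu * \prod_(a | S a) (nu a)%:R =
  \prod_a q.[y a] *
  altsum y (fun t => \prod_(a | S a) ((t a)%:R + y a * q^`().[y a] / q.[y a])).
Proof.
move=> szq q0.
pose w a (j : nat) := y a ^+ j * (if S a then j%:R else 1).
have -> : \sum_nu alt_coef q nu * monom y nu * \prod_(a | S a) (nu a)%:R =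
    \sum_nu alt_coef q nu * \prod_a w a (nu a).
  apply: eq_bigr => nu _; rewrite /w big_split -mulrA; congr (_ * (_ * _)).
  by rewrite big_mkcond.
rewrite alt_coef_weight /altsum mulr_sumr; apply: eq_bigr => t _.
rewrite [X in _ = _ * (_ * X)]big_mkcond mulrCA -mulrA -!big_split; congr (_ * _).
apply: eq_bigr => a _ /=.
have sz : (size ('X^(t a) * q)%R <= M + N)%N.
  rewrite (leq_trans (size_polyMleq _ _)) // size_polyXn addSn /=.
  by rewrite (leq_trans (leq_add (leqnn _) szq)) // addnS -addSn leq_add2r.
rewrite /w; case: ifP => [Sa|_]; last first.
  under eq_bigr do rewrite mulr1.
  by rewrite -(horner_coef_wide _ sz) hornerM hornerXn /= mulr1.
transitivity (y a * ('X^(t a) * q)^`().[y a]).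
  rewrite (@horner_coef_wide _ (M + N).-1) => [|]; last first.
    rewrite (leq_trans (size_poly _ _)) //; have := ltn_ord (t a); lia.
  have := ltn_ord (t a); case: (M + N)%N sz => [|n] _ _; first by rewrite !big_ord0 mulr0.
  rewrite big_ord_recl /= mulr0n !mulr0 add0r mulr_sumr; apply: eq_bigr => j _.
  by rewrite coef_deriv /bump /= add1n -[_ *+ _.+1]mulr_natr exprS; set n' := _%:R; ring.
rewrite derivM !hornerE derivXn hornerMn hornerXn.
have : q.[y a] != 0 by apply: q0.
rewrite /=; case: (nat_of_ord (t a)) => [|l] qa; first by rewrite mulr0n expr0; field.
by rewrite exprS -[_ *+ _.+1]mulr_natr; set n' := _%:R; field.
Qed.

Lemma alt_coef_sum q y : (size q <= N.+1)%N ->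
  \sum_nu alt_coef q nu * monom y nu = \prod_a q.[y a] * vdet y.
Proof.
move=> szq; rewrite -altsum1.
transitivity (\sum_nu alt_coef q nu * monom y nu * \prod_(a | pred0 a) (nu a)%:R).
  apply: eq_bigr => nu _; rewrite [X in _ = _ * X](_ : _ = 1) ?mulr1 //.
  exact: big_pred0.
rewrite alt_coef_expand //; congr (_ * _); apply: eq_bigr => t _.
by congr (_ * _); apply: big_pred0.
Qed.

Let s1 : F := \sum_(a < M) a%:R.
Let s2 : F := \sum_(a < M) a%:R ^+ 2.

(** The exponents [t a] add up to [s1] for every permutation [t], so only the logarithmic
    derivatives of [q] remain. *)
Lemma alt_coef_degree q y : injective y ->
    (size q <= N.+1)%N -> (forall a, q.[y a] != 0) ->
  \sum_nu alt_coef q nu * monom y nu * (\sum_a (nu a)%:R - s1) =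
  \prod_a q.[y a] * vdet y * \sum_a y a * q^`().[y a] / q.[y a].
Proof.
move=> injy szq q0; set t_ := fun a => y a * q^`().[y a] / q.[y a].
have -> : \sum_nu alt_coef q nu * monom y nu * (\sum_a (nu a)%:R - s1) =
   \sum_a (\sum_nu alt_coef q nu * monom y nu * (nu a)%:R) -
   s1 * \sum_nu alt_coef q nu * monom y nu.
  rewrite exchange_big /= mulr_sumr -sumrB; apply: eq_bigr => nu _.
  by rewrite mulrBr mulr_sumr [s1 * _]mulrC.
have e1 a : \sum_nu alt_coef q nu * monom y nu * (nu a)%:R =
    \prod_a q.[y a] * altsum y (fun t => (t a)%:R + t_ a).
  have pr (G : 'I_M -> F) : \prod_(c | pred1 a c) G c = G a by exact: big_pred1_eq.
  transitivity (\sum_nu alt_coef q nu * monom y nu * \prod_(c | pred1 a c) (nu c)%:R).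
    by apply: eq_bigr => nu _; rewrite pr.
  rewrite alt_coef_expand //; congr (_ * _); apply: eq_bigr => t _.
  by rewrite pr.
rewrite (eq_bigr _ (fun a _ => e1 a)).
rewrite alt_coef_sum // -mulr_sumr -!mulrA [s1 * _]mulrCA -mulrBr; congr (_ * _).
have -> : \sum_a altsum y (fun t => (t a)%:R + t_ a) = altsum y (fun t => (s1 + \sum_a t_ a) * 1).
  rewrite /altsum exchange_big /=; apply: eq_bigr => t _.
  rewrite -mulr_sumr mulr1; congr (_ * _); rewrite big_split /=; congr (_ + _).
  by rewrite /s1 [RHS](reindex_inj (@perm_inj _ t)).
by rewrite altsumZ altsum1; ring.
Qed.

(** In the product of [t a + t_ a] and [t b + t_ b] over [a != b], the terms free of [t_] give
    [s1 ^+ 2 - s2]. In the mixed terms the other exponents sum to [s1 - t a], and the leftover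
    weight [t a] is evaluated by [altsum_index]. *)
Lemma alt_coef_pairs q y : injective y ->
    (size q <= N.+1)%N -> (forall a, q.[y a] != 0) ->
  let t_ a := y a * q^`().[y a] / q.[y a] in
  \sum_nu alt_coef q nu * monom y nu * \sum_a \sum_(b | b != a) (nu a)%:R * (nu b)%:R =
  \prod_a q.[y a] * vdet y * (s1 ^+ 2 - s2 + 2 * s1 * \sum_a t_ a +
   \sum_a \sum_(b | b != a) (t_ a * t_ b - 2 * t_ a * (y a / (y a - y b)))).
Proof.
move=> injy szq q0 t_.
have e2 a b : b != a -> \sum_nu alt_coef q nu * monom y nu * ((nu a)%:R * (nu b)%:R) =
    \prod_a q.[y a] * altsum y (fun t => ((t a)%:R + t_ a) * ((t b)%:R + t_ b)).
  move=> nba.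
  have pr (G : 'I_M -> F) : \prod_(c | pred2 a b c) G c = G a * G b.
    rewrite (bigD1 a) /=; last by rewrite eqxx.
    congr (_ * _); rewrite (eq_bigl (pred1 b)) ?big_pred1_eq // => c /=.
    by case: (eqVneq c a) => [->|]; rewrite ?andbF ?andbT //= eq_sym (negPf nba).
  transitivity (\sum_nu alt_coef q nu * monom y nu * \prod_(c | pred2 a b c) (nu c)%:R).
    by apply: eq_bigr => nu _; rewrite pr.
  rewrite alt_coef_expand //; congr (_ * _); apply: eq_bigr => t _.
  by rewrite pr.
transitivity (\prod_a q.[y a] * \sum_a \sum_(b | b != a)
    altsum y (fun t => ((t a)%:R + t_ a) * ((t b)%:R + t_ b))).
  transitivity (\sum_a \sum_(b | b != a)
     \sum_nu alt_coef q nu * monom y nu * ((nu a)%:R * (nu b)%:R)).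
    rewrite [RHS](_ : _ = \sum_a \sum_nu \sum_(b | b != a)
      alt_coef q nu * monom y nu * ((nu a)%:R * (nu b)%:R)); last first.
      by apply: eq_bigr => a _; rewrite exchange_big.
    rewrite exchange_big /=; apply: eq_bigr => nu _; rewrite mulr_sumr.
    by apply: eq_bigr => a _; rewrite mulr_sumr.
  by rewrite mulr_sumr; apply: eq_bigr => a _; rewrite mulr_sumr; apply: eq_bigr => b /e2.
rewrite -mulrA; congr (_ * _).
have sumt (t : 'S_M) : \sum_a (t a)%:R = s1 :> F.
  by rewrite /s1 [RHS](reindex_inj (@perm_inj _ t)).
have split_ne (G : 'I_M -> 'I_M -> F) : \sum_a \sum_(b | b != a) G a b =
    \sum_a \sum_b G a b - \sum_a G a a.
  rewrite -sumrB; apply: eq_bigr => a _.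
  by rewrite [X in _ = X - _](bigD1 a) //= addrC addrK.
have -> : \sum_a \sum_(b | b != a) altsum y (fun t => ((t a)%:R + t_ a) * ((t b)%:R + t_ b)) =
   altsum y (fun t => (s1 ^+ 2 - s2 + 2 * s1 * \sum_a t_ a +
      \sum_a \sum_(b | b != a) t_ a * t_ b) * 1 + (-1) * \sum_a 2 * t_ a * (t a)%:R).
  rewrite /altsum.
  transitivity (\sum_(t : 'S_M) \sum_a \sum_(b | b != a) (-1) ^+ t * \prod_c y c ^+ t c *
       (((t a)%:R + t_ a) * ((t b)%:R + t_ b))).
    rewrite exchange_big /=; apply: eq_bigr => a _; by rewrite exchange_big.
  apply: eq_bigr => t _.
  transitivity ((-1) ^+ t * \prod_c y c ^+ t c *
      \sum_a \sum_(b | b != a) ((t a)%:R + t_ a) * ((t b)%:R + t_ b)).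
    by rewrite mulr_sumr; apply: eq_bigr => a _; rewrite mulr_sumr.
  congr (_ * _); rewrite !split_ne.
  have sq (G : 'I_M -> F) : \sum_a \sum_b G a * G b = (\sum_a G a) ^+ 2.
    by rewrite expr2 mulr_suml; apply: eq_bigr => a _; rewrite mulr_sumr.
  rewrite !sq big_split /= sumt.
  have -> : \sum_i ((t i)%:R + t_ i) * ((t i)%:R + t_ i) =
     s2 + \sum_i 2 * t_ i * (t i)%:R + \sum_i t_ i * t_ i.
    rewrite /s2 [X in _ = X + _ + _](reindex_inj (@perm_inj _ t)) -!big_split /=.
    by apply: eq_bigr => i _; ring.
  by ring.
rewrite altsumD altsumZ altsum1 altsumZ.
have -> : altsum y (fun t => \sum_a 2 * t_ a * (t a)%:R) =
    vdet y * \sum_a \sum_(b | b != a) 2 * t_ a * (y a / (y a - y b)).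
  transitivity (\sum_a altsum y (fun t => 2 * t_ a * (t a)%:R)).
    by rewrite /altsum exchange_big /=; apply: eq_bigr => t _; rewrite mulr_sumr.
  rewrite mulr_sumr; apply: eq_bigr => a _; rewrite altsumZ altsum_index //.
  by rewrite mulrCA; congr (_ * _); rewrite mulr_sumr.
rewrite (_ : \sum_a \sum_(b | b != a) (_ - _) = \sum_a \sum_(b | b != a) t_ a * t_ b -
   \sum_a \sum_(b | b != a) 2 * t_ a * (y a / (y a - y b))); first by ring.
by rewrite -sumrB; apply: eq_bigr => a _; rewrite -sumrB.
Qed.
End Expansion.

(** * Exponents that avoid the block [[m, m + N)] *)

Section Support.
Variables (M N m : nat).
Implicit Types nu : {ffun 'I_M -> 'I_(M + N)}.

Definition in_block (j : nat) : bool := (m <= j < m + N)%N.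

(** The quadratic whose zeros are the two ends [m] and [m + N - 1] of the block; its sign tells the
    block from the rest. *)
Definition casimir (j : nat) : int := (j%:Z - m%:Z) * (j%:Z - m%:Z - N%:Z + 1).

(** Increasing enumeration of the naturals outside the block. *)
Definition skip_block (a : nat) : nat := if (a < m)%N then a else (a + N)%N.

Lemma skip_block_subproof (a : 'I_M) : (skip_block a < M + N)%N.
Proof. by have := ltn_ord a; rewrite /skip_block; case: ifP; lia. Qed.

Definition nu0 : {ffun 'I_M -> 'I_(M + N)} := [ffun a => Ordinal (skip_block_subproof a)].

Lemma nu0_inj : injective nu0.
Proof.
move=> a b; rewrite !ffunE => /(congr1 val) /=; rewrite /skip_block => h.
by apply: ord_inj; move: h; case: ltnP => ?; case: ltnP => ? ?; lia.
Qed.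

Lemma nu0_out a : ~~ in_block (nu0 a).
Proof. by rewrite ffunE /= /skip_block /in_block; case: ltnP; lia. Qed.

Hypotheses (N_gt0 : (0 < N)%N) (le_mM : (m <= M)%N).

Lemma casimir_out j : ~~ in_block j -> 0 < casimir j.
Proof.
rewrite /in_block /casimir negb_and -!ltnNge => /orP[h|h]; last by apply: mulr_gt0; lia.
by rewrite -mulrNN; apply: mulr_gt0; lia.
Qed.

Lemma casimir_in j : in_block j -> casimir j <= 0.
Proof. by rewrite /in_block /casimir => h; apply: mulr_ge0_le0; lia. Qed.

Lemma image_nu0 : [set nu0 a | a : 'I_M] = [set j : 'I_(M + N) | ~~ in_block j].
Proof.
apply/finset.setP => j; rewrite inE; apply/imsetP/idP => [[a _ ->]|jo]; first exact: nu0_out.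
have ltj := ltn_ord j; move: (jo); rewrite /in_block negb_and -!ltnNge => /orP[h|h].
  have ltjM : (j < M)%N by lia.
  by exists (Ordinal ltjM) => //; apply: val_inj; rewrite ffunE /= /skip_block h.
have ltjM : (j - N < M)%N by lia.
exists (Ordinal ltjM) => //; apply: val_inj; rewrite ffunE /= /skip_block.
by case: ltnP; lia.
Qed.

(** Exchanging an exponent of the block for a missing one outside replaces a nonpositive value by a
    positive one, so a set that meets the block has a strictly smaller sum than the complement of
    the block. *)
Lemma casimir_max nu : injective nu ->
  \sum_a casimir (nu a) = \sum_a casimir (nu0 a) -> forall a, ~~ in_block (nu a).
Proof.
move=> injnu eqs a; apply: contraPN eqs => blk; apply/eqP; rewrite lt_eqF //.
pose f (j : 'I_(M + N)) := casimir j.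
rewrite -[ltLHS](@big_imset _ _ _ _ _ nu predT f) /=; last by move=> ? ? _ _ /injnu.
rewrite -[ltRHS](@big_imset _ _ _ _ _ nu0 predT f) /=; last by move=> ? ? _ _ /nu0_inj.
set A := imset _ _; set B := imset _ _.
have BE : B = [set j : 'I_(M + N) | ~~ in_block j] by rewrite -image_nu0.
have cAB : #|A| = #|B| by rewrite !card_imset //; exact: nu0_inj.
have [j jB jA] : exists2 j, j \in B & j \notin A.
  apply/subsetPn; apply: contraL blk => sBA.
  have /eqP eAB : B == A by rewrite eqEcard sBA cAB leqnn.
  have : nu a \in A by apply: imset_f.
  by rewrite -eAB BE inE.
rewrite (big_setID B) /=; apply: (@le_lt_trans _ _ (\sum_(j in A :&: B) f j)).
  rewrite gerDl; apply: sumr_le0 => i; rewrite !inE => /andP[iB _].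
  by apply: casimir_in; move: iB; rewrite BE inE negbK.
rewrite [ltRHS](big_setID A) /= finset.setIC ltrDl (bigD1 j) /=; last by rewrite inE jA.
have fpos i : i \in B -> 0 < f i by rewrite BE inE => /casimir_out.
by rewrite ltr_wpDr ?fpos // sumr_ge0 // => i; rewrite inE -andbA => /and3P[_ iB _]; rewrite ltW ?fpos.
Qed.

(** Shifting [a] by [N] raises [casimir] by [N (2 (a - m) + 1)], and consecutive odd numbers sum to
    a square. *)
Lemma sum_casimir_nu0 : \sum_a casimir (nu0 a) =
  \sum_(a < M) casimir a + N%:Z * (M%:Z - m%:Z) ^+ 2.
Proof.
have -> : \sum_a casimir (nu0 a) =
  \sum_(a < M) casimir a + \sum_(a < M) (if (a < m)%N then 0 else N%:Z * (2 * (a%:Z - m%:Z) + 1)).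
  rewrite -big_split; apply: eq_bigr => a _; rewrite ffunE /= /skip_block.
  case: ifP => _; first by rewrite addr0.
  by rewrite /casimir PoszD; ring.
congr (_ + _); rewrite -(subnKC le_mM); elim: (M - m)%N => [|n IH].
  rewrite addn0 subrr expr0n mulr0 big1 // => a _.
  by rewrite ltn_ord.
rewrite addnS big_ord_recr /= IH ltnNge leq_addr /= -addnS !PoszD intS; ring.
Qed.

End Support.

(** * Comparison of coefficients at integer points *)

Section Kronecker.
Variables (F : numFieldType) (M N : nat).
Implicit Types (nu : {ffun 'I_M -> 'I_(M + N)}) (y : 'I_M -> F).

(* Kronecker substitution: distinct exponents give distinct powers of the base. *)
Definition kron (nu : {ffun 'I_M -> 'I_(M + N)}) : nat := \sum_(a < M) nu a * (M + N) ^ a.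

Lemma base_digits (b n : nat) (f g : nat -> nat) :
    (forall i, f i < b)%N -> (forall i, g i < b)%N ->
  (\sum_(i < n) f i * b ^ i = \sum_(i < n) g i * b ^ i)%N ->
  forall i, (i < n)%N -> f i = g i.
Proof.
elim: n f g => // n IH f g fb gb; rewrite !big_ord_recl !expn0 !muln1.
have E (h : nat -> nat) : (\sum_(i < n) h (bump 0 i) * b ^ bump 0 i =
     b * \sum_(i < n) h i.+1 * b ^ i)%N.
  rewrite big_distrr; apply: eq_bigr => i _ /=; rewrite /bump add1n expnS; lia.
rewrite !E => e; have b0 : (0 < b)%N by apply: leq_ltn_trans (fb 0%N).
have e0 : f 0%N = g 0%N.
  by have := congr1 (modn^~ b) e; rewrite /= ![(b * _)%N]mulnC ![(_ + _ * b)%N]addnC !modnMDl !modn_small.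
move: e; rewrite e0 => /addnI/eqP; rewrite eqn_pmul2l // => /eqP e1.
case=> [|i] // ltin; exact: (IH (fun i => f i.+1) (fun i => g i.+1)).
Qed.

Lemma kron_inj : injective kron.
Proof.
move=> nu mu; rewrite /kron => e; apply/ffunP => a; apply: ord_inj.
have n_gt0 : (0 < M)%N by apply: leq_ltn_trans (ltn_ord a).
pose ext (f : {ffun 'I_M -> 'I_(M + N)}) (i : nat) : nat :=
  if insub i is Some a then f a else 0%N.
have extE f (b : 'I_M) : ext f b = f b by rewrite /ext valK.
have ext_lt f i : (ext f i < M + N)%N.
  by rewrite /ext; case: insubP => [b _ _|_]; rewrite ?ltn_ord // addn_gt0 n_gt0.
have := @base_digits (M + N) M (ext nu) (ext mu) (ext_lt nu) (ext_lt mu) _ a (ltn_ord a).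
rewrite !extE; apply.
under eq_bigr do rewrite extE.
by under [RHS]eq_bigr do rewrite extE.
Qed.

Definition kron_pt (T : nat) (a : 'I_M) : F := (T ^ ((M + N) ^ a))%:R.

Lemma kron_pt_inj T : (1 < T)%N -> injective (kron_pt T).
Proof.
move=> T_gt1 a b /eqP; rewrite eqr_nat eqn_exp2l // => /eqP.
have [->//|nab] := eqVneq a b.
have K_gt1 : (1 < M + N)%N.
  have := ltn_ord a; have := ltn_ord b; move: nab; rewrite -val_eqE /=; lia.
by move/eqP; rewrite eqn_exp2l // => /eqP/val_inj.
Qed.

Lemma kron_pt_monom T nu : monom (kron_pt T) nu = T%:R ^+ kron nu.
Proof.
rewrite /monom /kron /kron_pt; under eq_bigr do rewrite -natrX -expnM mulnC.
by rewrite -natr_prod -expn_sum natrX.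
Qed.

(** On the points [kron_pt T] the sum is a polynomial in the single variable [T] with distinct
    exponents [kron nu]. The points have integer coordinates above 1, where characteristic
    polynomials of unitary matrices do not vanish. *)
Lemma monom_coef_eq0 (c : {ffun 'I_M -> 'I_(M + N)} -> F) :
    (forall T, (1 < T)%N -> \sum_nu c nu * monom (kron_pt T) nu = 0) ->
  forall nu, c nu = 0.
Proof.
move=> h nu; pose p : {poly F} := \sum_nu c nu *: 'X^(kron nu).
have p0 : p = 0.
  apply: (@roots_geq_poly_eq0 _ _ [seq (i.+2)%:R | i <- iota 0 (size p)]).
  - apply/allP => _ /mapP[T _ ->]; rewrite rootE -(h T.+2) // horner_sum; apply/eqP.
    by apply: eq_bigr => mu _; rewrite kron_pt_monom hornerZ hornerXn.
  - by rewrite map_inj_uniq ?iota_uniq // => i j /eqP; rewrite eqr_nat => /eqP[].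
  by rewrite size_map size_iota.
have := congr1 (fun q : {poly F} => q`_(kron nu)) p0.
rewrite coef0 coef_sum (bigD1 nu) //= big1 ?addr0 ?coefZ ?coefXn ?eqxx ?mulr1 // => mu nmu.
by rewrite coefZ coefXn (inj_eq kron_inj) eq_sym (negPf nmu) mulr0.
Qed.
End Kronecker.

(** * Bordered determinants of the symbol [z^-m] *)

Section DeltaExpansion.
Variables (F : numFieldType) (M N m : nat).
Hypotheses (N_gt0 : (0 < N)%N) (le_mM : (m <= M)%N).
Implicit Types (nu : {ffun 'I_M -> 'I_(M + N)}) (y : 'I_M -> F).

Definition delta_seq (j : int) : F := (j == - m%:Z)%:R.

(** Coefficient of [y^nu] in the bordered determinant: each top row becomes the unit row that
    selects its power. *)
Definition delta_minor (nu : {ffun 'I_M -> 'I_(M + N)}) : F :=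
  \det (col_mx (\matrix_(a < M, l < M + N) (l == nu a)%:R)
               (\matrix_(i < N, l < M + N) delta_seq (i%:Z - l%:Z))).

Lemma det_evalmx_delta y :
  \det (evalmx N y delta_seq) = \sum_nu delta_minor nu * monom y nu.
Proof.
under [RHS]eq_bigr do rewrite /delta_minor /determinant mulr_suml.
rewrite exchange_big /=; apply: eq_bigr => t _.
under [RHS]eq_bigr do rewrite -mulrA.
rewrite -mulr_sumr; congr (_ * _).
rewrite big_split_ord /=.
rewrite [RHS](_ : _ = (\sum_(nu : {ffun 'I_M -> 'I_(M + N)})
    \prod_a (t (lshift N a) == nu a)%:R * monom y nu) *
    \prod_(i < N) delta_seq (i%:Z - (t (rshift M i))%:Z)); last first.
  rewrite mulr_suml; apply: eq_bigr => nu _; rewrite big_split_ord mulrAC.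
  by congr (_ * _ * _); apply: eq_bigr => i _; rewrite ?col_mxEu ?col_mxEd mxE.
congr (_ * _); last first.
  by apply: eq_bigr => i _; rewrite !col_mxEd !mxE.
have E (a : 'I_M) : evalmx N y delta_seq (lshift N a) (t (lshift N a)) =
    \sum_(j < M + N) (t (lshift N a) == j)%:R * y a ^+ j.
  rewrite /evalmx col_mxEu mxE (bigD1 (t (lshift N a))) //= eqxx mul1r big1 ?addr0 // => j.
  by rewrite eq_sym => /negPf->; rewrite mul0r.
under eq_bigr do rewrite E.
rewrite bigA_distr_bigA; apply: eq_bigr => nu _; by rewrite big_split.
Qed.

Lemma delta_minor_perm nu (t : 'S_M) :
  delta_minor [ffun a => nu (t a)] = (-1) ^+ t * delta_minor nu.
Proof.
have -> : (-1) ^+ t = \det (block_mx (perm_mx t) 0 0 (1%:M : 'M[F]_N)).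
  by rewrite det_ublock det_perm det1 mulr1.
rewrite -det_mulmx mul_block_col !mul0mx addr0 add0r mul1mx -row_permE.
congr (\det (col_mx _ _)); apply/matrixP => a l; rewrite !mxE; congr (_ == _)%:R.
by rewrite ffunE.
Qed.

(** The bottom rows are the unit rows at [m, ..., m + N - 1], so an exponent in the block repeats
    one of them. *)
Lemma delta_minor_eq0 nu a : in_block N m (nu a) -> delta_minor nu = 0.
Proof.
rewrite /in_block => blk; have lti : (nu a - m < N)%N by lia.
apply: (determinant_alternate (i1 := lshift N a) (i2 := rshift M (Ordinal lti))).
  by rewrite eq_lrshift.
move=> l; rewrite col_mxEu col_mxEd !mxE /delta_seq /=; congr (_)%:R; congr nat_of_bool.
rewrite -val_eqE /=; lia.
Qed.

(** The rows are now pairwise distinct unit rows, so the matrix is a permutation matrix. *)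
Lemma delta_minor_nu0 : delta_minor (nu0 M N m) != 0.
Proof.
have ltb (i : 'I_N) : (m + i < M + N)%N by have := ltn_ord i; lia.
pose f (r : 'I_(M + N)) : 'I_(M + N) :=
  match fintype.split r with inl a => nu0 M N m a | inr i => Ordinal (ltb i) end.
have injf : injective f.
  move=> r1 r2; rewrite /f.
  case: (split_ordP r1) => x ->; case: (split_ordP r2) => y ->.
  - by move/nu0_inj->.
  - by move=> e; have := @nu0_out M N m x; rewrite e /in_block /=; have := ltn_ord y; lia.
  - by move=> e; have := @nu0_out M N m y; rewrite -e /in_block /=; have := ltn_ord x; lia.
  by move/(congr1 val) => /= /addnI/ord_inj->.
rewrite /delta_minor (_ : col_mx _ _ = perm_mx (perm injf)) ?det_perm ?signr_eq0 //.
apply/matrixP => r l; rewrite [RHS]mxE [in RHS]mxE permE /f; case: (split_ordP r) => x ->.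
  by rewrite col_mxEu mxE eq_sym.
rewrite col_mxEd mxE /delta_seq -val_eqE /=; congr (nat_of_bool _)%:R; lia.
Qed.
End DeltaExpansion.

Section AltCoef.
Variables (F : fieldType) (M N : nat).
Implicit Types (nu : {ffun 'I_M -> 'I_(M + N)}).

Lemma alt_coef_perm (q : {poly F}) nu (t : 'S_M) :
  alt_coef q [ffun a => nu (t a)] = (-1) ^+ t * alt_coef q nu.
Proof.
rewrite /alt_coef -det_perm -det_mulmx -row_permE; congr (\det _).
by apply/matrixP => a l; rewrite !mxE ffunE.
Qed.

Lemma alt_coef_eq0 (q : {poly F}) nu a b : a != b -> nu a = nu b -> alt_coef q nu = 0.
Proof.
by move=> nab e; apply: (determinant_alternate nab) => l; rewrite !mxE e.
Qed.
End AltCoef.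

Lemma poly_nat_eq0 (F : numFieldType) (p : {poly F}) :
  (forall T : nat, p.[T%:R] = 0) -> p = 0.
Proof.
move=> h; apply: (@roots_geq_poly_eq0 _ _ [seq i%:R | i <- iota 0 (size p)]).
- by apply/allP => _ /mapP[T _ ->]; rewrite rootE h.
- by rewrite map_inj_uniq ?iota_uniq // => i j /eqP; rewrite eqr_nat => /eqP.
by rewrite size_map size_iota.
Qed.

Section PolynomialOnLines.
Variables (F : numFieldType) (M : nat).

(** As much of the notion of a multivariate polynomial as is needed to extend an identity from
    pairwise distinct nodes to all nodes. *)
Definition poly_on_lines (f : ('I_M -> F) -> F) :=
  forall y v : 'I_M -> F, exists p : {poly F}, forall t, f (fun a => y a + t * v a) = p.[t].

Lemma poly_on_lines_const c : poly_on_lines (fun=> c).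
Proof. by move=> y v; exists c%:P => t; rewrite hornerC. Qed.

Lemma poly_on_lines_coord a : poly_on_lines (fun y => y a).
Proof.
move=> y v; exists ((y a)%:P + v a *: 'X) => t.
by rewrite !hornerE mulrC.
Qed.

Lemma poly_on_linesD f g : poly_on_lines f -> poly_on_lines g ->
  poly_on_lines (fun y => f y + g y).
Proof.
move=> hf hg y v; have [p hp] := hf y v; have [q hq] := hg y v.
by exists (p + q) => t; rewrite hornerD hp hq.
Qed.

Lemma poly_on_linesM f g : poly_on_lines f -> poly_on_lines g ->
  poly_on_lines (fun y => f y * g y).
Proof.
move=> hf hg y v; have [p hp] := hf y v; have [q hq] := hg y v.
by exists (p * q) => t; rewrite hornerM hp hq.
Qed.

Lemma poly_on_lines_sum (I : Type) (s : seq I) (P : pred I) (f : I -> ('I_M -> F) -> F) :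
  (forall i, poly_on_lines (f i)) -> poly_on_lines (fun y => \sum_(i <- s | P i) f i y).
Proof.
move=> hf; elim: s => [|i s IH] y v.
  by exists 0 => t; rewrite big_nil horner0.
have [p hp] := IH y v; have [q hq] := hf i y v.
exists (if P i then q + p else p) => t; rewrite big_cons hp.
by case: ifP; rewrite ?hornerD ?hq.
Qed.

Lemma poly_on_lines_prod (I : Type) (s : seq I) (P : pred I) (f : I -> ('I_M -> F) -> F) :
  (forall i, poly_on_lines (f i)) -> poly_on_lines (fun y => \prod_(i <- s | P i) f i y).
Proof.
move=> hf; elim: s => [|i s IH] y v.
  by exists 1 => t; rewrite big_nil hornerC.
have [p hp] := IH y v; have [q hq] := hf i y v.
exists (if P i then q * p else p) => t; rewrite big_cons hp.
by case: ifP; rewrite ?hornerM ?hq.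
Qed.

Lemma poly_on_lines_conv (s : seq 'I_M) (g : int -> F) j :
  poly_on_lines (fun y => conv (\prod_(a <- s) ('X - (y a)%:P)) g j).
Proof.
elim: s g j => [|a s IH] g j y v.
  by exists (g j)%:P => t; rewrite big_nil hornerC (convC 1) mul1r.
have [p hp] := IH g (j - 1) y v; have [q hq] := IH g j y v.
exists (p - ((y a)%:P + v a *: 'X) * q) => t.
rewrite big_cons mulrBl convD -mulNr -polyCN mul_polyC convZ -commr_polyX convMX hp hq.
by rewrite !hornerE; ring.
Qed.

Lemma poly_on_lines_toeplitz (N : nat) (g : int -> F) :
  poly_on_lines (fun y => toeplitz N (conv (\prod_a ('X - (y a)%:P)) g)).
Proof.
rewrite /toeplitz /determinant; apply: poly_on_lines_sum => t.
apply: poly_on_linesM; first exact: poly_on_lines_const.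
apply: poly_on_lines_prod => i y v.
have [p hp] := poly_on_lines_conv (index_enum 'I_M) g (i%:Z - (t i)%:Z) y v.
by exists p => x; rewrite mxE hp.
Qed.

(** Along the direction [(0, 1, ..., M - 1)] two given coordinates agree for at most one parameter,
    so [f] vanishes at all but finitely many points of the line. *)
Lemma poly_on_lines_eq0 f : poly_on_lines f ->
  (forall y, injective y -> f y = 0) -> forall y, f y = 0.
Proof.
move=> hf f0 y; have [p hp] := hf y (fun a => a%:R).
suff p0 : p = 0.
  rewrite -(horner0 0) -p0 -hp; congr f.
  by apply/funext => a; rewrite mul0r addr0.
(* [r ab] is the difference of two coordinates along the line; [p] times all these factors vanishes
   at every natural number. *)
pose r (ab : 'I_M * 'I_M) : {poly F} :=
  (y ab.1 - y ab.2)%:P + (ab.1%:R - ab.2%:R) *: 'X.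
have r_neq0 : \prod_(ab | ab.1 != ab.2) r ab != 0.
  apply/prodf_neq0 => -[a b] /= nab; apply/eqP => /(congr1 (fun q : {poly F} => q`_1)).
  rewrite /r coefD coefC coefZ coefX coef0 /= mulr1 add0r => /eqP.
  by rewrite subr_eq0 eqr_nat val_eqE (negPf nab).
apply: (mulIf r_neq0); rewrite mul0r; apply: poly_nat_eq0 => T; rewrite hornerM.
have [injT|] := boolP (injectiveb [ffun a => y a + T%:R * a%:R]).
  rewrite -hp f0 ?mul0r // => a b e; apply: (injectiveP _ injT).
  by rewrite !ffunE.
case/injectivePn => a [b nab]; rewrite !ffunE => e.
rewrite horner_prod (bigD1 (a, b)) //= /r /= !hornerE.
have -> : y a - y b + (a%:R - b%:R) * T%:R = 0.
  by move/eqP: e; rewrite -subr_eq0 => /eqP <-; ring.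
by rewrite /= ?(mulr0, mul0r).
Qed.
End PolynomialOnLines.

(** * Means of products of characteristic polynomials, for an abstract mean [L] *)

Section Functional.
Variables (F : numFieldType) (T : Type) (Adm : (T -> F) -> Prop) (L : (T -> F) -> F).
Hypothesis AdmC : forall c, Adm (fun=> c).
Hypothesis AdmD : forall f g, Adm f -> Adm g -> Adm (fun U => f U + g U).
Hypothesis AdmM : forall f g, Adm f -> Adm g -> Adm (fun U => f U * g U).
Hypothesis LD : forall f g, Adm f -> Adm g -> L (fun U => f U + g U) = L f + L g.
Hypothesis LZ : forall c f, Adm f -> L (fun U => c * f U) = c * L f.

Lemma Adm_sum (I : Type) (s : seq I) (P : pred I) (f : I -> T -> F) :
  (forall i, Adm (f i)) -> Adm (fun U => \sum_(i <- s | P i) f i U).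
Proof.
move=> hf; elim: s => [|i s IH].
  by under eq_fun do rewrite big_nil; apply: AdmC.
under eq_fun do rewrite big_cons.
by case: (P i) => //; apply: AdmD.
Qed.

Lemma Adm_prod (I : Type) (s : seq I) (P : pred I) (f : I -> T -> F) :
  (forall i, Adm (f i)) -> Adm (fun U => \prod_(i <- s | P i) f i U).
Proof.
move=> hf; elim: s => [|i s IH].
  by under eq_fun do rewrite big_nil; apply: AdmC.
under eq_fun do rewrite big_cons.
by case: (P i) => //; apply: AdmM.
Qed.

Lemma Adm_det n (A : T -> 'M[F]_n) :
  (forall i j, Adm (fun U => A U i j)) -> Adm (fun U => \det (A U)).
Proof.
move=> hA; apply: Adm_sum => t; apply: AdmM; first exact: AdmC.
exact: Adm_prod.
Qed.

Lemma L_sum (I : Type) (s : seq I) (P : pred I) (f : I -> T -> F) :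
  (forall i, Adm (f i)) ->
  L (fun U => \sum_(i <- s | P i) f i U) = \sum_(i <- s | P i) L (f i).
Proof.
move=> hf; elim: s => [|i s IH].
  under eq_fun do rewrite big_nil; rewrite big_nil.
  rewrite -[RHS](mul0r (L (fun=> 0))) -LZ; last exact: AdmC.
  by congr L; apply/funext => U; rewrite mul0r.
under eq_fun do rewrite big_cons; rewrite big_cons.
by case: (P i) => //; rewrite LD ?IH //; apply: Adm_sum.
Qed.

Lemma L_lin (f : T -> F) (g : T -> F) c : Adm g -> (forall U, f U = c * g U) -> L f = c * L g.
Proof. by move=> ag e; rewrite -LZ //; congr L; apply/funext. Qed.

Variables (N m M : nat) (q : T -> {poly F}).
Hypotheses (N_gt0 : (0 < N)%N) (le_mM : (m <= M)%N).
Hypothesis size_q : forall U, (size (q U) <= N.+1)%N.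
Hypothesis lead_q : forall U, (q U)`_N = 1.
Hypothesis Adm_q : forall i, Adm (fun U => (q U)`_i).
Hypothesis L_q0 : L (fun U => (q U)`_0 ^+ m) = (-1) ^+ (m * N).

(** The relations are assumed only at such nodes: integers above 1 avoid the roots of [q U], and the
    points [kron_pt] supply enough of them. *)
Let node (y : 'I_M -> F) := injective y /\ forall a, exists2 n, (1 < n)%N & y a = n%:R.
Hypothesis q_neq0 : forall U n, (1 < n)%N -> (q U).[n%:R] != 0.

Let pr (y : 'I_M -> F) U := \prod_a (q U).[y a].
Let t_ (y : 'I_M -> F) a U := y a * (q U)^`().[y a] / (q U).[y a].
Let d := M%:R - m%:R : F.
(** The first summand is the mean of the pairs of traces; the others come from passing from traces
    to logarithmic derivatives. *)
Let kappa := N%:R * (N%:R + 1) * (m%:R * (m%:R - 1)) + 2 * N%:R * (M%:R - 1) * d * N%:R -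
  M%:R * (M%:R - 1) * N%:R * (N%:R + 1) : F.

Hypothesis L_degree : forall y, node y ->
  L (fun U => pr y U * \sum_a t_ y a U) = N%:R * d * L (pr y).
Hypothesis L_pairs : forall y, node y ->
  L (fun U => pr y U *
     \sum_a \sum_(b | b != a) (t_ y a U * t_ y b U - 2 * t_ y a U * (y a / (y a - y b)))) =
  kappa * L (pr y).

Let psi (nu : {ffun 'I_M -> 'I_(M + N)}) := L (fun U => alt_coef (q U) nu).

Let Adm_alt (nu : {ffun 'I_M -> 'I_(M + N)}) : Adm (fun U => alt_coef (q U) nu).
Proof.
apply: Adm_det => a l; case lt: (nu a < l)%N; under eq_fun do rewrite mxE coefXnM lt.
  exact: AdmC.
exact: Adm_q.
Qed.

Let Adm_pr y : Adm (pr y).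
Proof.
apply: Adm_prod => a.
under eq_fun do rewrite (horner_coef_wide _ (size_q _)).
by apply: Adm_sum => i; apply: AdmM; [apply: Adm_q | apply: AdmC].
Qed.

Let L_alt (c : {ffun 'I_M -> 'I_(M + N)} -> F) :
  L (fun U => \sum_nu alt_coef (q U) nu * c nu) = \sum_nu psi nu * c nu.
Proof.
rewrite L_sum => [|nu]; last by apply: AdmM.
by apply: eq_bigr => nu _; rewrite mulrC; apply: L_lin => // U; rewrite mulrC.
Qed.

Let Adm_altc (c : {ffun 'I_M -> 'I_(M + N)} -> F) :
  Adm (fun U => \sum_nu alt_coef (q U) nu * c nu).
Proof. by apply: Adm_sum => nu; apply: AdmM. Qed.

Let psi_sum y : \sum_nu psi nu * monom y nu = vdet y * L (pr y).
Proof.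
rewrite -L_alt; apply: L_lin => // U.
by rewrite alt_coef_sum // mulrC.
Qed.

Let s1 : F := \sum_(a < M) a%:R.
Let s2 : F := \sum_(a < M) a%:R ^+ 2.

Let node_kron n : (1 < n)%N -> node (kron_pt F N n).
Proof.
move=> n_gt1; split; first exact: kron_pt_inj.
move=> a; exists (n ^ ((M + N) ^ a))%N => //.
have K_gt0 : (0 < M + N)%N by rewrite addn_gt0 N_gt0 orbT.
by rewrite -(exp1n ((M + N) ^ a)) ltn_exp2r // expn_gt0 K_gt0.
Qed.

Let q_node y : node y -> forall U a, (q U).[y a] != 0.
Proof. by move=> [_ hy] U a; have [n n1 ->] := hy a; apply: q_neq0. Qed.

(** [h] is recovered from an admissible combination through division by [vdet y], so linearity of
    [L] applies to it. *)
Let L_weight y (c : {ffun 'I_M -> 'I_(M + N)} -> F) (h : T -> F) : injective y ->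
    (forall U, \sum_nu alt_coef (q U) nu * (monom y nu * c nu) = vdet y * h U) ->
  \sum_nu psi nu * (monom y nu * c nu) = vdet y * L h.
Proof.
move=> injy e; have v0 := vdet_neq0 injy.
rewrite -L_alt (@L_lin h (fun U => (vdet y)^-1 * (vdet y * h U)) 1); last first.
- by move=> U; rewrite mulKf ?mul1r.
- under eq_fun do rewrite -e mulr_sumr; apply: Adm_sum => nu.
  by apply: AdmM; [apply: AdmC | apply: AdmM].
rewrite mul1r LZ ?mulVKf //; first by congr L; apply/funext.
by under eq_fun do rewrite -e; apply: Adm_altc.
Qed.

(** The first relation at the points [kron_pt], read coefficient by coefficient. *)
Let psi_degree (nu : {ffun 'I_M -> 'I_(M + N)}) : psi nu * (\sum_a (nu a)%:R - s1 - N%:R * d) = 0.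
Proof.
pose c mu := psi mu * (\sum_a (mu a)%:R - s1 - N%:R * d).
apply: (@monom_coef_eq0 _ _ _ c) => {nu} n /node_kron hy.
set y := kron_pt F N n in hy *; have injy : injective y by case: hy.
transitivity (\sum_nu psi nu * (monom y nu * (\sum_a (nu a)%:R - s1)) -
   N%:R * d * \sum_nu psi nu * monom y nu).
  by rewrite mulr_sumr -sumrB; apply: eq_bigr => mu _; rewrite /c; ring.
rewrite psi_sum (L_weight (h := fun U => pr y U * \sum_a t_ y a U)) //.
  by rewrite L_degree //; ring.
move=> U; have e := alt_coef_degree injy (size_q U) (q_node hy U).
rewrite mulrCA mulrA /pr /t_ -e.
by apply: eq_bigr => nu _; rewrite mulrA.
Qed.

Let psi_pairs (nu : {ffun 'I_M -> 'I_(M + N)}) : psi nu * (\sum_a \sum_(b | b != a) (nu a)%:R * (nu b)%:R -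
   (s1 ^+ 2 - s2) - 2 * s1 * (\sum_a (nu a)%:R - s1) - kappa) = 0.
Proof.
pose c0 (mu : {ffun 'I_M -> 'I_(M + N)}) := \sum_a \sum_(b | b != a) (mu a)%:R * (mu b)%:R -
   (s1 ^+ 2 - s2) - 2 * s1 * (\sum_a (mu a)%:R - s1).
apply: (@monom_coef_eq0 _ _ _ (fun mu => psi mu * (c0 mu - kappa))) => {nu} n /node_kron hy.
set y := kron_pt F N n in hy *; have injy : injective y by case: hy.
transitivity (\sum_nu psi nu * (monom y nu * c0 nu) - kappa * \sum_nu psi nu * monom y nu).
  by rewrite mulr_sumr -sumrB; apply: eq_bigr => mu _; ring.
rewrite psi_sum (L_weight (h := fun U => pr y U * \sum_a \sum_(b | b != a)
    (t_ y a U * t_ y b U - 2 * t_ y a U * (y a / (y a - y b))))) //.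
  by rewrite L_pairs //; ring.
move=> U.
have e1 := alt_coef_sum y (size_q U).
have e2 := alt_coef_degree injy (size_q U) (q_node hy U).
have e3 := alt_coef_pairs injy (size_q U) (q_node hy U).
transitivity (\sum_(nu : {ffun 'I_M -> 'I_(M + N)}) alt_coef (q U) nu * monom y nu *
      (\sum_a \sum_(b | b != a) (nu a)%:R * (nu b)%:R) -
   (s1 ^+ 2 - s2) * (\sum_(nu : {ffun 'I_M -> 'I_(M + N)}) alt_coef (q U) nu * monom y nu) -
   2 * s1 * \sum_(nu : {ffun 'I_M -> 'I_(M + N)}) alt_coef (q U) nu * monom y nu * (\sum_a (nu a)%:R - s1)).
  rewrite [X in _ - X - _]mulr_sumr [X in _ - _ - X]mulr_sumr -!sumrB; apply: eq_bigr => nu _.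
  by rewrite /c0; move: (\sum_a _) (\sum_a _) => x z; ring.
rewrite e3 e2 e1 /s1 /s2 /pr /t_; ring.
Qed.

Let L0 : L (fun=> 0) = 0.
Proof. by rewrite -[RHS](mul0r (L (fun=> 0))); apply: L_lin => // U; rewrite mul0r. Qed.

Let psi_inj (nu : {ffun 'I_M -> 'I_(M + N)}) : psi nu != 0 -> injective nu.
Proof.
move=> nz a b e; apply/eqP; apply: contraNT nz => nab; apply/eqP; rewrite -[RHS]L0.
by congr L; apply/funext => U; apply: alt_coef_eq0 nab e.
Qed.

Let sum_casimir (f : 'I_M -> nat) : ((\sum_a casimir N m (f a))%:~R : F) =
  \sum_a (f a)%:R ^+ 2 - (2 * m%:R + N%:R - 1) * (\sum_a (f a)%:R) +
  M%:R * (m%:R * (m%:R + N%:R - 1)).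
Proof.
have -> : M%:R * (m%:R * (m%:R + N%:R - 1)) = \sum_(a < M) (m%:R * (m%:R + N%:R - 1)) :> F.
  by rewrite sumr_const card_ord mulr_natl.
rewrite rmorph_sum mulr_sumr -sumrB -big_split; apply: eq_bigr => a _.
by rewrite /casimir !(rmorphM, rmorphD, rmorphN) /= ?mulr1n; ring.
Qed.

(** [psi_degree] and [psi_pairs] fix the sums of the exponents and of their squares, hence the sum
    of [casimir], which turns out to be that of [nu0]; [casimir_max] then applies. *)
Let psi_out (nu : {ffun 'I_M -> 'I_(M + N)}) : psi nu != 0 ->
  forall a, ~~ in_block N m (nu a).
Proof.
move=> nz; apply: (casimir_max N_gt0 le_mM) => //; first exact: psi_inj.
have := psi_degree nu; have := psi_pairs nu.
move=> /eqP; rewrite mulf_eq0 (negPf nz) /= => /eqP e2.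
move=> /eqP; rewrite mulf_eq0 (negPf nz) /= => /eqP e1.
apply: (@intr_inj F); rewrite sum_casimir_nu0 // [RHS]rmorphD /= !sum_casimir.
have e3 : \sum_a \sum_(b | b != a) (nu a)%:R * (nu b)%:R =
    (\sum_a (nu a)%:R) ^+ 2 - \sum_a (nu a)%:R ^+ 2 :> F.
  rewrite expr2 mulr_suml -sumrB; apply: eq_bigr => a _.
  by rewrite mulr_sumr [in RHS](bigD1 a) //= expr2 addrAC subrr add0r.
move: e2; rewrite e3 -/s1 -/s2.
rewrite !(rmorphM, rmorphXn, rmorphB) /= /kappa.
move: e1; set S := \sum_a (nu a)%:R; set S2 := \sum_a (nu a)%:R ^+ 2 => e1 e2.
have eS : S = s1 + N%:R * d by apply/eqP; rewrite -subr_eq0 -e1; apply/eqP; ring.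
rewrite /kappa in e2.
have eS2 : S2 = S ^+ 2 - (s1 ^+ 2 - s2 + 2 * s1 * (S - s1) + kappa).
  by apply/eqP; rewrite -subr_eq0 -oppr0 -e2 /kappa; apply/eqP; ring.
(* [s1] and [s2] cancel; what is left is [N^2 d^2 - kappa - (2 m + N - 1) N d = N d^2]. *)
rewrite eS2 eS /kappa /d.
apply/eqP; rewrite -subr_eq0; apply/eqP.
rewrite -!pmulrn; ring.
Qed.

Let delta nu := @delta_minor F M N m nu.

Let delta_inj nu : delta nu != 0 -> injective nu.
Proof.
move=> nz a b e; apply/eqP; apply: contraNT nz => nab; apply/eqP.
apply: (determinant_alternate (i1 := lshift N a) (i2 := lshift N b)).
  by rewrite (inj_eq (@lshift_inj _ _)).
by move=> l; rewrite !col_mxEu !mxE e.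
Qed.

Let c := psi (nu0 M N m) / delta (nu0 M N m).

(** Both families are alternating and supported on the rearrangements of [nu0], so their values at
    [nu0] decide the ratio. *)
Let psi_delta nu : psi nu = c * delta nu.
Proof.
have delta0 : delta (nu0 M N m) != 0 by apply: delta_minor_nu0.
have onto : injective nu -> (forall a, ~~ in_block N m (nu a)) -> psi nu = c * delta nu.
  move=> injnu outnu.
  have h a : {b | nu0 M N m b = nu a}.
    suff /imsetP/cid2[b _ ->] : nu a \in [set nu0 M N m b | b : 'I_M] by exists b.
    by rewrite image_nu0 // inE.
  pose t a := sval (h a); have tE a : nu0 M N m (t a) = nu a := svalP (h a).
  have injt : injective t by move=> a b e; apply: injnu; rewrite -!tE e.
  have -> : nu = [ffun a => nu0 M N m (perm injt a)].
    by apply/ffunP => a; rewrite ffunE permE tE.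
  rewrite /delta delta_minor_perm -/(delta _) /psi.
  rewrite (@L_lin _ (fun U => alt_coef (q U) (nu0 M N m)) ((-1) ^+ perm injt)) //.
    by rewrite -/(psi _) /c mulrCA divfK.
  by move=> U; rewrite alt_coef_perm.
have [p0|pn0] := eqVneq (psi nu) 0; last by apply: onto; [apply: psi_inj | apply: psi_out].
have [d0|dn0] := eqVneq (delta nu) 0; first by rewrite p0 d0 mulr0.
apply: onto; first exact: delta_inj.
by move=> a; apply/negP => h; case/eqP: dn0; apply: delta_minor_eq0 h.
Qed.

Let toep (y : 'I_M -> F) := toeplitz N (conv (\prod_a ('X - (y a)%:P)) (delta_seq F m)).

Let L_toep_inj y : injective y -> L (pr y) = c * toep y.
Proof.
move=> injy; apply: (mulfI (vdet_neq0 injy)).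
rewrite -psi_sum mulrCA -(det_evalmx _ _ erefl) det_evalmx_delta mulr_sumr.
by apply: eq_bigr => nu _; rewrite psi_delta mulrA.
Qed.

(** Both sides are polynomial in [y], so the nodes may coincide; [c_sign] will use coinciding
    nodes. *)
Let L_toep y : L (pr y) = c * toep y.
Proof.
apply/eqP; rewrite -subr_eq0; apply/eqP; move: y.
apply: poly_on_lines_eq0 => [|y injy]; last by rewrite L_toep_inj // subrr.
have -> : (fun y => L (pr y) - c * toep y) =
    (fun y => \sum_(r : {ffun 'I_M -> 'I_N.+1}) L (fun U => \prod_a (q U)`_(r a)) *
        \prod_a y a ^+ r a + (- c) * toep y).
  apply/funext => y; rewrite mulNr; congr (_ - _).
  have -> : pr y = fun U => \sum_(r : {ffun 'I_M -> 'I_N.+1})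
      (\prod_a y a ^+ r a) * \prod_a (q U)`_(r a).
    apply/funext => U; rewrite /pr.
    under eq_bigr do rewrite (horner_coef_wide _ (size_q U)).
    rewrite bigA_distr_bigA; apply: eq_bigr => r _; rewrite -big_split.
    by apply: eq_bigr => a _ /=; rewrite mulrC.
  rewrite L_sum => [|r]; last by apply: AdmM => //; apply: Adm_prod.
  by apply: eq_bigr => r _; rewrite LZ 1?mulrC //; apply: Adm_prod.
apply: poly_on_linesD; last first.
  by apply: poly_on_linesM; [apply: poly_on_lines_const | apply: poly_on_lines_toeplitz].
apply: poly_on_lines_sum => r; apply: poly_on_linesM; first exact: poly_on_lines_const.
apply: poly_on_lines_prod => a.
elim: (nat_of_ord (r a)) => [|n IH].
  by under eq_fun do rewrite expr0; apply: poly_on_lines_const.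
by under eq_fun do rewrite exprS; apply: (poly_on_linesM (poly_on_lines_coord a) IH).
Qed.

Let Adm_exp n i : Adm (fun U => (q U ^+ n)`_i).
Proof.
elim: n i => [|n IH] i; first by under eq_fun do rewrite expr0; apply: AdmC.
by under eq_fun do rewrite exprS coefM; apply: Adm_sum => j; apply: AdmM.
Qed.

Let q_monic U : q U \is monic.
Proof.
have sz : size (q U) = N.+1.
  apply/eqP; rewrite eqn_leq size_q /=; apply: contraT; rewrite -leqNgt => h.
  by have := oner_neq0 F; rewrite -(lead_q U) nth_default ?eqxx.
by rewrite monicE lead_coefE sz lead_q.
Qed.

Let size_exp U n : size (q U ^+ n) = (n * N).+1.
Proof.
have sz : size (q U) = N.+1.
  apply/eqP; rewrite eqn_leq size_q /=; apply: contraT; rewrite -leqNgt => h.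
  by have := oner_neq0 F; rewrite -(lead_q U) nth_default ?eqxx.
rewrite -[LHS]prednK ?size_poly_gt0 ?expf_neq0 ?monic_neq0 //.
by rewrite size_exp sz /= mulnC.
Qed.

(** Comparison of the leading coefficients in [T'] at [m] nodes equal to 0 and [M - m] nodes equal
    to [T']. *)
Let c_sign : c = (-1) ^+ (M * N).
Proof.
pose n := (M - m)%N; pose A j := L (fun U => (q U)`_0 ^+ m * (q U ^+ n)`_j).
have AdmA j : Adm (fun U => (q U)`_0 ^+ m * (q U ^+ n)`_j).
  apply: AdmM => //; elim: (m) => [|l IH]; first by under eq_fun do rewrite expr0; apply: AdmC.
  by under eq_fun do rewrite exprS; apply: AdmM.
have E (T' : nat) : \sum_(j < (n * N).+1) A j * T'%:R ^+ j = c * (- T'%:R) ^+ (n * N).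
  pose y (a : 'I_M) : F := if (a < m)%N then 0 else T'%:R.
  have := L_toep y.
  have prM (R' : comNzRingType) (u v : R') :
      \prod_(a < M) (if (a < m)%N then u else v) = u ^+ m * v ^+ n.
    rewrite -(big_mkord xpredT (fun a => if (a < m)%N then u else v)) -[in LHS](subnKC le_mM).
    rewrite big_mkord big_split_ord /=; congr (_ * _).
      under eq_bigr do rewrite ltn_ord; by rewrite prodr_const card_ord.
    under eq_bigr do rewrite ltnNge leq_addr /=; by rewrite prodr_const card_ord.
  have -> : pr y = fun U => \sum_(j < (n * N).+1) T'%:R ^+ j * ((q U)`_0 ^+ m * (q U ^+ n)`_j).
    apply/funext => U; rewrite /pr /y.
    rewrite (eq_bigr (fun a : 'I_M => if (a < m)%N then (q U).[0] else (q U).[T'%:R])); last first.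
      by move=> a _; case: ifP.
    rewrite prM horner_coef0 -horner_exp (@horner_coef_wide _ (n * N).+1) ?size_exp // mulr_sumr.
    by apply: eq_bigr => j _; ring.
  rewrite L_sum => [|j]; last by apply: AdmM.
  under eq_bigr do rewrite LZ //.
  rewrite (eq_bigr (fun j : 'I_(n * N).+1 => A j * T'%:R ^+ j)) => [->|j _]; last exact: mulrC.
  congr (_ * _); rewrite /toep.
  have -> : \prod_a ('X - (y a)%:P) = 'X^m * ('X - T'%:R%:P) ^+ n.
    rewrite -prM; apply: eq_bigr => a _; rewrite /y; case: ifP => // _.
    by rewrite polyC0 subr0.
  (* The factor [X^m] of the zero nodes cancels [z^-m]: the symbol becomes a polynomial and its
     Toeplitz matrix is lower triangular. *)
  have convE' i : conv ('X^m * ('X - T'%:R%:P) ^+ n) (delta_seq F m) i =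
      conv (('X - T'%:R%:P) ^+ n) (fun j => (j == 0)%:R) i.
    rewrite convMXn /conv; apply: eq_bigr => r _; rewrite /delta_seq; congr (_ * (nat_of_bool _)%:R).
    lia.
  rewrite /toeplitz det_trig; last first.
    apply/is_trig_mxP => i j ltij; rewrite mxE convE' conv_exp0.
    by case E' : (i%:Z - j%:Z) => [l|l] //; move: E'; lia.
  rewrite (eq_bigr (fun=> (- T'%:R) ^+ n)) => [|i _]; last first.
    by rewrite mxE convE' subrr conv_exp0 -[LHS]horner_coef0 horner_exp hornerXsubC sub0r.
  by rewrite prodr_const card_ord -exprM.
have p0 : \poly_(j < (n * N).+1) A j - (c * (-1) ^+ (n * N)) *: 'X^(n * N) = 0.
  apply: poly_nat_eq0 => T'; rewrite hornerD hornerN hornerZ hornerXn horner_poly E.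
  by rewrite [(- _) ^+ _]exprNn mulrA subrr.
have := congr1 (fun p : {poly F} => p`_(n * N)) p0.
rewrite coef0 coefB coef_poly ltnSn coefZ coefXn eqxx mulr1 => /eqP; rewrite subr_eq0 => /eqP Ac.
(* [q U ^+ n] is monic of degree [n * N], so this coefficient is the normalization [L_q0]. *)
have : A (n * N)%N = (-1) ^+ (m * N).
  rewrite -L_q0 /A; congr L; apply/funext => U.
  have := monic_exp n (q_monic U); rewrite monicE lead_coefE size_exp /= => /eqP ->.
  by rewrite mulr1.
rewrite Ac => e; rewrite -[LHS]mulr1 -[X in _ * X](sqrr_sign F (n * N)) expr2 mulrA e -exprD -mulnDl.
by rewrite /n subnKC.
Qed.

Theorem functional_toeplitz (y : 'I_M -> F) :
  L (fun U => \prod_a (q U).[y a]) =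
  (-1) ^+ (M * N) * toeplitz N (conv (\prod_a ('X - (y a)%:P)) (delta_seq F m)).
Proof. by rewrite -c_sign -L_toep. Qed.
End Functional.

(** * Haar means of bounded Borel functions *)

Local Open Scope classical_set_scope.
Local Open Scope ring_scope.

Section ComplexMeasurable.
Variables (R : realType) (d : measure_display) (T : measurableType d).
Local Notation C := (cplx R).
Implicit Types (D : set T) (f g : T -> C).

Definition cmeasurable D f :=
  measurable_fun D (fun x => complex.Re (f x)) /\ measurable_fun D (fun x => complex.Im (f x)).

Lemma cmeasurable_cst D c : cmeasurable D (fun=> c).
Proof. by split; apply: measurable_cst. Qed.

Lemma cmeasurableD D f g : cmeasurable D f -> cmeasurable D g ->
  cmeasurable D (fun x => f x + g x).
Proof.
move=> [f1 f2] [g1 g2]; split.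
  rewrite (_ : (fun x => _) = (fun x => complex.Re (f x)) \+ (fun x => complex.Re (g x))).
    exact: measurable_funD.
  by apply/funext => x /=; case: (f x) (g x) => [? ?] [? ?].
rewrite (_ : (fun x => _) = (fun x => complex.Im (f x)) \+ (fun x => complex.Im (g x))).
  exact: measurable_funD.
by apply/funext => x /=; case: (f x) (g x) => [? ?] [? ?].
Qed.

Lemma cmeasurableM D f g : cmeasurable D f -> cmeasurable D g ->
  cmeasurable D (fun x => f x * g x).
Proof.
move=> [f1 f2] [g1 g2]; split.
  rewrite (_ : (fun x => _) = (((fun x => complex.Re (f x)) \* (fun x => complex.Re (g x))) \-
     ((fun x => complex.Im (f x)) \* (fun x => complex.Im (g x))))).
    by apply: measurable_funB; apply: measurable_funM.
  by apply/funext => x /=; case: (f x) (g x) => [? ?] [? ?].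
rewrite (_ : (fun x => _) = (((fun x => complex.Re (f x)) \* (fun x => complex.Im (g x))) \+
     ((fun x => complex.Im (f x)) \* (fun x => complex.Re (g x))))).
  by apply: measurable_funD; apply: measurable_funM.
by apply/funext => x /=; case: (f x) (g x) => [? ?] [? ?].
Qed.

Lemma cmeasurableJ D f : cmeasurable D f -> cmeasurable D (fun x => (f x)^*).
Proof.
move=> [f1 f2]; split.
  rewrite (_ : (fun x => _) = fun x => complex.Re (f x)) //.
  by apply/funext => x /=; case: (f x) => ? ?.
rewrite (_ : (fun x => _) = \- fun x => complex.Im (f x)); first exact: measurable_funN.
by apply/funext => x /=; case: (f x) => ? ?.
Qed.

Lemma cmeasurableV D f : cmeasurable D f -> cmeasurable D (fun x => (f x)^-1).
Proof.
move=> [f1 f2].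
have m : measurable_fun D
    (fun x => ((complex.Re (f x)) ^+ 2 + (complex.Im (f x)) ^+ 2)^-1).
  (* [powR] with exponent -1 is measurable and agrees with the inverse on nonnegative reals, zero
     included. *)
  rewrite (_ : (fun x => _) = (@powR R ^~ (-1)) \o
      ((fun x => complex.Re (f x) ^+ 2) \+ (fun x => complex.Im (f x) ^+ 2))).
    apply: measurableT_comp; first exact: measurable_powR.
    by apply: measurable_funD; apply: measurable_funX.
  by apply/funext => x /=; rewrite powR_inv1 // addr_ge0 ?sqr_ge0.
split.
  rewrite (_ : (fun x => _) = (fun x => complex.Re (f x)) \*
      (fun x => ((complex.Re (f x)) ^+ 2 + (complex.Im (f x)) ^+ 2)^-1)).
    exact: measurable_funM.
  by apply/funext => x /=; case: (f x) => ? ?.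
rewrite (_ : (fun x => _) = (\- (fun x => complex.Im (f x))) \*
      (fun x => ((complex.Re (f x)) ^+ 2 + (complex.Im (f x)) ^+ 2)^-1)).
  by apply: measurable_funM => //; apply: measurable_funN.
by apply/funext => x /=; case: (f x) => ? ? /=; rewrite mulNr.
Qed.
End ComplexMeasurable.

(** * Continuity and measurability on the space of matrices *)

Section MatrixBorel.
Variables (R : realType) (N : nat).
Local Notation C := (cplx R).

Lemma Re_continuous : continuous (fun z : C => complex.Re z).
Proof.
move=> z A /nbhs_ballP[e e0 sA]; apply/nbhs_ballP; exists (e%:C)%C => /=.
  by rewrite ltcR.
move=> t zt; apply: sA; rewrite /ball /= -ltcR.
have -> : complex.Re z - complex.Re t = complex.Re (z - t) by case: z t {zt} => [? ?] [? ?].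
exact: le_lt_trans (normc_ge_Re (z - t)) zt.
Qed.

Lemma Im_continuous : continuous (fun z : C => complex.Im z).
Proof.
have -> : (fun z : C => complex.Im z) = (fun z : C => complex.Re z) \o (fun z : C => - 'i%C * z).
  by apply/funext => -[x y] /=; ring.
move=> z; apply: continuous_comp; last exact: Re_continuous.
by apply: mulrl_continuous.
Qed.

Lemma continuous_measurable_borelMx (f : 'M[C]_N -> R) : continuous f ->
  measurable_fun [set: borelMx R N] (f : borelMx R N -> R).
Proof.
move=> /continuousP cf; apply: (measurability _ (RGenOpens.measurableE R)).
move=> _ [_ [x [y ->] <-]]; rewrite setTI; apply: sub_sigma_algebra.
exact/cf/interval_open.
Qed.

Lemma mulmx_continuous (V : 'M[C]_N) : continuous (fun U : 'M[C]_N => V *m U).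
Proof.
move=> U A [P nP sPA].
have cV i j : nbhs U [set W : 'M[C]_N | P i j ((V *m W) i j)].
  have : (V *m W) i j @[W --> U] --> (V *m U) i j.
    under eq_fun do rewrite mxE.
    rewrite mxE.
    apply: (@cvg_big C 'I_N +%R 0 xpredT add_continuous _ (nbhs U)) => l _.
    by apply: (@cvgMl_tmp _ _ (nbhs U)); apply: coord_continuous.
  by apply; apply: nP.
have /filterS : nbhs U [set W : 'M[C]_N | forall i j, P i j ((V *m W) i j)].
  apply: (@filter_forall _ _ _ (nbhs U)) => i.
  by apply: (@filter_forall _ _ _ (nbhs U)) => j; apply: cV.
by apply => W hW; apply: sPA.
Qed.

Lemma measurable_mulmx (V : 'M[C]_N) :
  measurable_fun [set: borelMx R N] (mulmx V : borelMx R N -> borelMx R N).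
Proof.
apply: (@measurability _ _ (borelMx R N) (borelMx R N) setT _ (@open 'M[C]_N) erefl).
move=> _ [B oB <-]; rewrite setTI; apply: sub_sigma_algebra.
by move/continuousP: (@mulmx_continuous V); apply.
Qed.

Lemma cmeasurable_entry i j : cmeasurable [set: borelMx R N] (fun U : 'M[C]_N => U i j).
Proof.
split; apply: (@continuous_measurable_borelMx (fun U : 'M[C]_N => _)) => U.
  by apply: continuous_comp; [apply: coord_continuous | apply: Re_continuous].
by apply: continuous_comp; [apply: coord_continuous | apply: Im_continuous].
Qed.
End MatrixBorel.

Lemma normc_imaginary (R : rcfType) : `|'i%C : R[i]| = 1.
Proof. by rewrite normc_def /= expr0n add0r expr1n sqrtr1. Qed.

Lemma normc_ge_Im (R : rcfType) (z : R[i]) : (`|complex.Im z|%:C)%C <= `|z|.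
Proof.
by have := normc_ge_Re (z * 'i%C); rewrite ReiNIm normrN normrM normc_imaginary mulr1.
Qed.

Lemma unitarymx_mull (C : numClosedFieldType) (n : nat) (V U : 'M[C]_n) :
  V \is unitarymx -> (V *m U \is unitarymx) = (U \is unitarymx).
Proof.
move=> uV; apply/idP/idP => [uVU|]; last exact: mul_unitarymx.
rewrite -[U]mul1mx -(mulVmx (unitarymx_unit uV)) invmx_unitary // -mulmxA.
by rewrite mul_unitarymx // trmxC_unitary.
Qed.

Lemma bounded_fun_on (R : realType) (T : Type) (D : set T) (h : T -> R) (B : R) :
  (forall x, D x -> `|h x| <= B) -> [bounded h x | x in D].
Proof.
move=> hh; exists B; split => [|M BM x Dx /=]; first by rewrite num_real.
by rewrite ltW // (le_lt_trans (hh x Dx)).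
Qed.

(** Change of variables for the pushforward by [phi], which coincides with [mu]; [h] is first
    extended by zero outside [D] to be measurable everywhere. *)
Lemma Rintegral_measure_preserving (R : realType) (d : measure_display)
    (T : measurableType d) (mu : probability T R) (phi : T -> T) (D : set T) (h : T -> R) (B : R) :
    measurable D -> measurable_fun setT phi -> phi @^-1` D = D ->
    (forall A, measurable A -> mu (phi @^-1` A) = mu A) ->
    measurable_fun D h -> (forall x, D x -> `|h x| <= B) ->
  \int[mu]_(x in D) h (phi x) = \int[mu]_(x in D) h x.
Proof.
move=> mD mphi preD inv mh hB; pose h' := h \_ D.
have mh' : measurable_fun setT h' by apply/(measurable_restrictT _ mD).
have h'E x : D x -> h' x = h x by move=> Dx; rewrite /h' patchE mem_set.
have Dphi x : D x -> D (phi x) by rewrite -[X in X x -> _]preD.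
have ih' : mu.-integrable D (EFin \o (h' \o phi)).
  apply: measurable_bounded_integrable => //.
  - by rewrite (le_lt_trans (probability_le1 _ mD)) // ltry.
  - apply: (measurable_funS measurableT) => //.
    exact: (measurableT_comp mh' mphi).
  - by apply: (bounded_fun_on (B := B)) => x Dx; rewrite /= h'E ?hB //; apply: Dphi.
have := @integral_pushforward _ _ _ _ _ _ mphi mu D (EFin \o h').
rewrite preD => /(_ (proj2 (measurable_EFinP _ _) mh') ih' mD) e.
rewrite /Rintegral; congr fine.
transitivity (\int[mu]_(x in D) (EFin \o (h' \o phi)) x)%E.
  by apply: eq_integral => x /set_mem Dx /=; rewrite h'E //; apply: Dphi.
rewrite -e.
transitivity (\int[mu]_(x in D) (EFin \o h') x)%E.
  by apply: eq_measure_integral => A mA _; apply: inv.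
by apply: eq_integral => x /set_mem Dx /=; rewrite h'E.
Qed.

(** * The Haar mean as an invariant linear functional *)

Section HaarIntegral.
Variables (R : realType) (N : nat).
Local Notation C := (cplx R).
Variable haar : probability (borelMx R N) R.
Hypothesis hhaar : is_unitary_haar haar.
Local Notation D := (@unitary_group R N : set (borelMx R N)).
Implicit Types f g : 'M[C]_N -> C.

Definition haar_mean f : C := complex_integral haar D f.

(** The class on which the mean is linear: Borel and bounded on the group, with arbitrary values
    elsewhere. *)
Definition tame f := cmeasurable D (f : borelMx R N -> C) /\
  exists B : R, forall U, D U -> `|f U| <= (B%:C)%C.

Lemma unitary_entry_le1 (U : 'M[C]_N) i j : D U -> `|U i j| <= 1.
Proof.
move=> /= /unitarymxP/matrixP/(_ i i); rewrite !mxE eqxx => h.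
rewrite -(@ler_pXn2r _ 2) ?nnegrE // expr1n; apply: le_trans (_ : _ <= true%:R) _ => //.
rewrite -h (bigD1 j) //= !mxE -normCK lerDl.
by apply: sumr_ge0 => l _; rewrite !mxE -normCK exprn_ge0.
Qed.

(** The group is cut out by finitely many measurable equations in the entries. *)
Lemma measurable_unitary_group : measurable D.
Proof.
pose h i j (U : borelMx R N) : C := \sum_l U i l * (U j l)^* - (i == j)%:R.
have mh i j : cmeasurable [set: borelMx R N] (h i j).
  apply: cmeasurableD; last exact: cmeasurable_cst.
  have: forall s : seq 'I_N, cmeasurable [set: borelMx R N]
      (fun U : borelMx R N => \sum_(l <- s) U i l * (U j l)^* : C).
    elim=> [|l s IH].
      by under eq_fun do rewrite big_nil; apply: cmeasurable_cst.
    under eq_fun do rewrite big_cons.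
    apply: cmeasurableD => //; apply: cmeasurableM; first exact: cmeasurable_entry.
    by apply: cmeasurableJ; apply: cmeasurable_entry.
  exact.
have -> : D = \bigcap_(i in [set: 'I_N]) \bigcap_(j in [set: 'I_N])
   ((fun U : borelMx R N => complex.Re (h i j U)) @^-1` [set 0] `&`
    (fun U : borelMx R N => complex.Im (h i j U)) @^-1` [set 0]).
  apply/seteqP; split => U /=.
    move=> /unitarymxP e i _ j _ /=.
    suff -> : h i j U = 0 by [].
    rewrite /h; move/matrixP/(_ i j): e; rewrite !mxE => <-.
    by apply/eqP; rewrite subr_eq0; apply/eqP/eq_bigr => l _; rewrite !mxE.
  move=> e; apply/unitarymxP/matrixP => i j; rewrite !mxE.
  have [/= e1 e2] := e i I j I.
  have : h i j U = 0 by move: e1 e2; case: (h i j U) => ? ? /= -> ->.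
  by move/eqP; rewrite subr_eq0 => /eqP <-; apply: eq_bigr => l _; rewrite !mxE.
have fin : finite_set [set: 'I_N] by exact: finite_finset.
apply: fin_bigcap_measurable => // i _; apply: fin_bigcap_measurable => // j _.
have [m1 m2] := mh i j.
by apply: measurableI; rewrite -[X in measurable X]setTI; [apply: m1|apply: m2].
Qed.

Lemma tame_cst c : tame (fun=> c).
Proof.
split; first exact: cmeasurable_cst.
exists (complex.Re `|c|) => U _.
by rewrite (RRe_real (normr_real c)).
Qed.

Lemma tameD f g : tame f -> tame g -> tame (fun U => f U + g U).
Proof.
move=> [mf [A hA]] [mg [B hB]]; split; first exact: cmeasurableD.
exists (A + B) => U DU; rewrite rmorphD /=.
by rewrite (le_trans (ler_normD _ _)) // lerD ?hA ?hB.
Qed.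

Lemma tameM f g : tame f -> tame g -> tame (fun U => f U * g U).
Proof.
move=> [mf [A hA]] [mg [B hB]]; split; first exact: cmeasurableM.
exists (A * B) => U DU; rewrite rmorphM /= normrM.
by rewrite ler_pM ?hA ?hB.
Qed.

Lemma tameJ f : tame f -> tame (fun U => (f U)^*).
Proof.
move=> [mf [A hA]]; split; first exact: cmeasurableJ.
by exists A => U DU; rewrite norm_conjC hA.
Qed.

Lemma tameV f (e : R) : 0 < e -> (forall U, D U -> (e%:C)%C <= `|f U|) ->
  tame f -> tame (fun U => (f U)^-1).
Proof.
move=> e0 he [mf _]; split; first exact: cmeasurableV.
exists e^-1 => U DU; rewrite normfV fmorphV /= lef_pV2 ?he //; last by rewrite posrE ltcR.
by rewrite posrE (lt_le_trans _ (he U DU)) // ltcR.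
Qed.

Lemma eq_tame f g : (forall U, D U -> f U = g U) -> tame f -> tame g.
Proof.
move=> e [[m1 m2] [B hB]]; split; last by exists B => U DU; rewrite -e ?hB.
by split; [apply: eq_measurable_fun m1 | apply: eq_measurable_fun m2] => U /set_mem DU;
  rewrite e.
Qed.

Lemma tame_entry i j : tame (fun U => U i j).
Proof.
split; last by exists 1 => U DU; rewrite rmorph1 unitary_entry_le1.
have [m1 m2] := @cmeasurable_entry R N i j.
by split; apply: measurable_funS (measurableT) _ _ => //.
Qed.

Lemma tame_integrable f : tame f ->
  haar.-integrable D (EFin \o (fun U => complex.Re (f U))) /\
  haar.-integrable D (EFin \o (fun U => complex.Im (f U))).
Proof.
move=> [[m1 m2] [B hB]]; have mD := measurable_unitary_group.
have fin : (haar D < +oo)%E by rewrite (le_lt_trans (probability_le1 _ mD)) // ltry.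
split; apply: measurable_bounded_integrable => //; apply: (bounded_fun_on (B := B)) => U DU; rewrite -lecR.
  by rewrite (le_trans (normc_ge_Re _)) ?hB.
by rewrite (le_trans (normc_ge_Im _)) ?hB.
Qed.

Lemma haar_meanD f g : tame f -> tame g ->
  haar_mean (fun U => f U + g U) = haar_mean f + haar_mean g.
Proof.
move=> /tame_integrable[f1 f2] /tame_integrable[g1 g2].
have mD := measurable_unitary_group.
rewrite /haar_mean /complex_integral.
rewrite -[RHS]/(Complex _ _) -!RintegralD //; congr Complex; apply: eq_Rintegral => U _.
  by case: (f U) (g U) => [? ?] [? ?].
by case: (f U) (g U) => [? ?] [? ?].
Qed.

Lemma haar_meanZ c f : tame f -> haar_mean (fun U => c * f U) = c * haar_mean f.
Proof.
move=> /tame_integrable[f1 f2]; have mD := measurable_unitary_group.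
have iZ (k : R) (h : borelMx R N -> R) : haar.-integrable D (EFin \o h) ->
    haar.-integrable D (EFin \o (fun U => k * h U)).
  move=> hh; rewrite (_ : EFin \o _ = fun U => (k%:E * (EFin \o h) U)%E) //.
  exact: integrableZl.
rewrite /haar_mean /complex_integral; case: c => x y.
rewrite -[RHS]/(Complex (_ * _ - _ * _) (_ * _ + _ * _)) -!RintegralZl //.
rewrite -RintegralB ?iZ // -RintegralD ?iZ //.
by congr Complex; apply: eq_Rintegral => U _; case: (f U).
Qed.

Lemma haar_mean1 : haar_mean (fun=> 1) = 1.
Proof.
have mD := measurable_unitary_group.
have mu1 : haar D = 1%E by case: hhaar.
rewrite /haar_mean /complex_integral -[RHS]/(Complex 1 0); congr Complex.
  by rewrite Rintegral_cst // mul1r; exact: (congr1 fine mu1).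
by rewrite Rintegral_cst // mul0r.
Qed.

Lemma eq_haar_mean f g : (forall U, D U -> f U = g U) -> haar_mean f = haar_mean g.
Proof.
move=> e; rewrite /haar_mean /complex_integral.
by congr Complex; apply: eq_Rintegral => U /set_mem DU; rewrite e.
Qed.

(** The factor 2 comes from bounding the real and imaginary parts separately. *)
Lemma haar_mean_le f (B : R) : tame f -> (forall U, D U -> `|f U| <= (B%:C)%C) ->
  `|haar_mean f| <= ((2 * B)%:C)%C.
Proof.
move=> tf hB; have [f1 f2] := tame_integrable tf; have mD := measurable_unitary_group.
have bnd (h : borelMx R N -> R) : haar.-integrable D (EFin \o h) ->
    (forall U, D U -> `|h U| <= B) -> `|\int[haar]_(U in D) h U| <= B.
  move=> ih hh; apply: le_trans (le_normr_Rintegral mD ih) _.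
  have -> : B = \int[haar]_(U in D) (cst B U).
    by rewrite Rintegral_cst // [X in _ * X](_ : _ = 1) ?mulr1 //; exact: (congr1 fine (proj1 hhaar)).
  apply: le_Rintegral => //.
  - exact: (integrable_norm ih).
  - apply: measurable_bounded_integrable => //.
    + by rewrite (le_lt_trans (probability_le1 _ mD)) // ltry.
    + exact: bounded_cst.
rewrite (complexE (haar_mean f)).
rewrite (le_trans (ler_normD _ _)) // normrM normc_imaginary mul1r mulrDl mul1r rmorphD /= lerD //.
  rewrite normc_def /= expr0n addr0 sqrtr_sqr lecR; apply: bnd => // U DU.
  by rewrite -lecR (le_trans (normc_ge_Re _)) ?hB.
rewrite normc_def /= expr0n addr0 sqrtr_sqr lecR; apply: bnd => // U DU.
by rewrite -lecR (le_trans (normc_ge_Im _)) ?hB.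
Qed.

Lemma haar_mean_invariant f V : D V -> tame f -> haar_mean (fun U => f (V *m U)) = haar_mean f.
Proof.
move=> DV tf; have [f1 f2] := tame_integrable tf; have mD := measurable_unitary_group.
have preD : (mulmx V : borelMx R N -> borelMx R N) @^-1` D = D.
  by apply/seteqP; split => U; rewrite /preimage /unitary_group /= unitarymx_mull.
have [[m1 m2] [B hB]] := tf.
rewrite /haar_mean /complex_integral; congr Complex.
  apply: (Rintegral_measure_preserving (B := B) mD (@measurable_mulmx R N V) preD _ m1).
    exact: (proj2 hhaar V DV).
  by move=> U DU; rewrite -lecR (le_trans (normc_ge_Re _)) ?hB.
apply: (Rintegral_measure_preserving (B := B) mD (@measurable_mulmx R N V) preD _ m2).
  exact: (proj2 hhaar V DV).
by move=> U DU; rewrite -lecR (le_trans (normc_ge_Im _)) ?hB.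
Qed.
End HaarIntegral.

(** * Rank-one perturbations and moments *)

Section CharPoly.
Variable F : numFieldType.

Lemma horner_char_poly n (A : 'M[F]_n) x : (char_poly A).[x] = \det (x%:M - A).
Proof.
rewrite /char_poly -[LHS]/(horner_eval x _) -det_map_mx; congr (\det _).
by apply/matrixP => i j; rewrite !mxE /= /horner_eval hornerD hornerN hornerC hornerMn hornerX.
Qed.

Lemma char_poly_conj n (P A : 'M[F]_n) : P \in unitmx ->
  char_poly (invmx P *m A *m P) = char_poly A.
Proof.
move=> uP; apply/eqP; rewrite -subr_eq0; apply/eqP/poly_nat_eq0 => T.
rewrite hornerD hornerN !horner_char_poly; apply/eqP; rewrite subr_eq0; apply/eqP.
have -> : T%:R%:M - invmx P *m A *m P = invmx P *m (T%:R%:M - A) *m P.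
  rewrite mulmxBr mulmxBl; congr (_ - _).
  by rewrite mul_mx_scalar -scalemxAl mulVmx // scalemx1.
by rewrite !det_mulmx det_inv mulrAC mulVr ?mul1r // -unitmxE.
Qed.

(** Determinants of both sides of a product of block triangular matrices. *)
Lemma det_1_add_rank1 n (u : 'cV[F]_n) (v : 'rV[F]_n) :
  \det (1%:M + u *m v) = 1 + (v *m u) 0 0.
Proof.
have e : block_mx 1%:M 0 v 1%:M *m block_mx (1%:M + u *m v) u 0 1%:M *m block_mx 1%:M 0 (- v) 1%:M
   = block_mx 1%:M u 0 (1%:M + v *m u).
  rewrite !mulmx_block !(mul1mx, mulmx1, mul0mx, mulmx0, add0r, addr0).
  rewrite !mulmxN addrK; congr block_mx; last by rewrite addrC.
  by rewrite mulmxDr mulmxDl mulmx1 mul1mx mulmxA [v *m u *m v + v]addrC subrr.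
have := congr1 determinant e.
rewrite !det_mulmx !det_lblock !det_ublock !det1 !(mul1r, mulr1) => ->.
by rewrite det_mx11 !mxE eqxx.
Qed.
End CharPoly.

Section Unitary.
Variables (C : numClosedFieldType) (N : nat).
Implicit Types U P : 'M[C]_N.

(** A unitary matrix is normal, and conjugation by the unitary diagonalizing matrix keeps the
    diagonal factor unitary. *)
Lemma unitary_spectrum U : U \is unitarymx ->
  exists P (z : 'rV[C]_N), [/\ P \in unitmx, U = invmx P *m diag_mx z *m P &
    forall i, `|z 0 i| = 1].
Proof.
move=> uU; have nU : U \is normalmx.
  apply/normalmxP; rewrite (unitarymxP uU) -invmx_unitary // mulVmx //.
  exact: unitarymx_unit.
have := orthomx_spectralP nU; set P := spectralmx U; set z := spectral_diag U => eU.
have uP : P \in unitmx by apply: spectral_unit.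
exists P, z; split=> // i.
have dz : diag_mx z \is unitarymx.
  have -> : diag_mx z = P *m U *m invmx P.
    by rewrite eU !mulmxA mulmxV // mul1mx -mulmxA mulmxV // mulmx1.
  rewrite !mul_unitarymx ?spectral_unitarymx // invmx_unitary ?spectral_unitarymx //.
  by rewrite trmxC_unitary spectral_unitarymx.
move/unitarymxP/matrixP/(_ i i): dz; rewrite mul_diag_mx !mxE eqxx mulr1n -normCK.
by move=> /eqP; rewrite sqrp_eq1 // => /eqP.
Qed.

Lemma char_poly_spectrum U P (z : 'rV[C]_N) : P \in unitmx ->
  U = invmx P *m diag_mx z *m P -> char_poly U = \prod_i ('X - (z 0 i)%:P).
Proof.
move=> uP ->; rewrite char_poly_conj // char_poly_trig ?diag_mx_is_trig //.
by apply: eq_bigr => i _; rewrite mxE eqxx mulr1n.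
Qed.

(** The factor [U] makes this the matrix through which left multiplication by [1 + u v] changes the
    characteristic polynomial; its eigenvalues are [z_i / (y - z_i)]. *)
Definition resolvent U (y : C) : 'M[C]_N := U *m invmx (y%:M - U).

Lemma char_poly_rank1 U (y : C) (u : 'cV[C]_N) (v : 'rV[C]_N) :
    y%:M - U \in unitmx ->
  (char_poly ((1%:M + u *m v) *m U)).[y] =
  (char_poly U).[y] * (1 - (v *m resolvent U y *m u) 0 0).
Proof.
move=> uy; rewrite !horner_char_poly.
have -> : y%:M - (1%:M + u *m v) *m U =
    (1%:M + (- u) *m (v *m resolvent U y)) *m (y%:M - U).
  rewrite !mulmxDl !mul1mx opprD addrA; congr (_ + _).
  by rewrite /resolvent !mulNmx -!mulmxA mulVmx // mulmx1.
by rewrite det_mulmx det_1_add_rank1 mulrC mulmxN !mxE.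
Qed.

Lemma resolvent_spectrum U P (z : 'rV[C]_N) (y : C) : P \in unitmx ->
    U = invmx P *m diag_mx z *m P -> (forall i, y != z 0 i) ->
  y%:M - U \in unitmx /\
  resolvent U y = invmx P *m diag_mx (\row_i (z 0 i / (y - z 0 i))) *m P.
Proof.
move=> uP eU yz.
pose S := invmx P *m diag_mx (\row_i (y - z 0 i)^-1) *m P.
have eY : (y%:M - U) *m S = 1%:M.
  have -> : y%:M - U = invmx P *m diag_mx (\row_i (y - z 0 i)) *m P.
    rewrite (_ : diag_mx _ = y%:M - diag_mx z).
      rewrite mulmxBr mulmxBl eU; congr (_ - _).
      by rewrite mul_mx_scalar -scalemxAl mulVmx // scalemx1.
    by apply/matrixP => i j; rewrite !mxE; case: eqP; rewrite ?mulr1n // !mulr0n subr0.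
  rewrite /S !mulmxA -[_ *m P *m invmx P]mulmxA mulmxV // mulmx1 -[invmx P *m _ *m diag_mx _]mulmxA.
  rewrite mulmx_diag (_ : diag_mx _ = 1%:M) ?mulmx1 ?mulVmx //.
  apply/matrixP => i j; rewrite !mxE; case: eqP => // ->.
  by rewrite mulr1n divff // subr_eq0.
have uY : y%:M - U \in unitmx by have [] := mulmx1_unit eY.
split=> //; rewrite /resolvent.
have -> : invmx (y%:M - U) = S by rewrite -[RHS](mulKmx uY) eY mulmx1.
rewrite {1}eU /S !mulmxA -[_ *m P *m invmx P]mulmxA mulmxV // mulmx1 -[invmx P *m _ *m diag_mx _]mulmxA.
by rewrite mulmx_diag; congr (_ *m diag_mx _ *m _); apply/rowP => i; rewrite !mxE.
Qed.

Lemma mxtrace_conj_diag P (z : 'rV[C]_N) : P \in unitmx ->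
  \tr (invmx P *m diag_mx z *m P) = \sum_i z 0 i.
Proof. by move=> uP; rewrite mxtrace_mulC mulmxA mulmxV // mul1mx mxtrace_diag. Qed.

Lemma mul_conj_diag P (z w : 'rV[C]_N) : P \in unitmx ->
  (invmx P *m diag_mx z *m P) *m (invmx P *m diag_mx w *m P) =
  invmx P *m diag_mx (\row_i (z 0 i * w 0 i)) *m P.
Proof.
move=> uP; rewrite !mulmxA -[_ *m P *m invmx P]mulmxA mulmxV // mulmx1.
by rewrite -[invmx P *m _ *m diag_mx _]mulmxA mulmx_diag.
Qed.

(** [V] is multiplication by [w] on the line of [p] and the identity on its orthogonal
    complement. *)
Lemma rank1_unitary (w : C) (p : 'cV[C]_N) :
    `|w| = 1 -> (p^t* *m p)%sesqui 0 0 != 0 ->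
  let V := 1%:M + (((w - 1) / (p^t* *m p)%sesqui 0 0) *: p) *m (p^t*)%sesqui in
  V \is unitarymx /\ \det V = w.
Proof.
set s := (_ *m _)%sesqui 0 0 => w1 s0 V; split; last first.
  rewrite det_1_add_rank1 -scalemxAr mxE -/s divfK //; ring.
pose Q := p *m (p^t*)%sesqui; pose c := (w - 1) / s.
have QQ : Q *m Q = s *: Q.
  rewrite /Q !mulmxA -[p *m _ *m p]mulmxA (mx11_scalar ((p^t*)%sesqui *m p)) -/s.
  by rewrite mul_mx_scalar -scalemxAl.
have Qadj : (Q^t*)%sesqui = Q.
  apply/matrixP => i j; rewrite !mxE rmorph_sum; apply: eq_bigr => l _.
  by rewrite !mxE rmorphM /= conjCK mulrC.
have sJ : s^* = s.
  rewrite /s !mxE rmorph_sum; apply: eq_bigr => l _.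
  by rewrite !mxE rmorphM /= conjCK mulrC.
have VE : V = 1%:M + c *: Q by rewrite /V -scalemxAl.
have VJ : (V^t*)%sesqui = 1%:M + c^* *: Q.
  by rewrite VE -[in RHS]Qadj; apply/matrixP => i j; rewrite !mxE rmorphD rmorphM rmorph_nat eq_sym.
apply/unitarymxP; rewrite VJ VE mulmxDl mul1mx mulmxDr mulmx1 -scalemxAl -scalemxAr QQ !scalerA.
rewrite -addrA -!scalerDl -[RHS]addr0; congr (_ + _).
rewrite (_ : _ + _ = 0) ?scale0r // /c rmorphM fmorphV rmorphB rmorph1 /= sJ.
have ww : w * w^* = 1 by rewrite -normCK w1 expr1n.
transitivity ((w * w^* - 1) / s); last by rewrite ww subrr mul0r.
by field.
Qed.
End Unitary.

Section PairForm.
Variables (C : numClosedFieldType) (N : nat).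
Definition unit_col (i : 'I_N) : 'cV[C]_N := delta_mx i 0.
Local Notation e := unit_col.

Let adj_pair i j (w : C) :
  ((e i + w *: e j)^t*)%sesqui = delta_mx 0 i + w^* *: delta_mx 0 j.
Proof.
apply/matrixP => r s; rewrite !mxE rmorphD rmorphM /= !rmorph_nat.
by rewrite ![(s == _) && _]andbC.
Qed.

Lemma form_pair (B : 'M[C]_N) i j (w : C) :
  ((e i + w *: e j)^t* *m B *m (e i + w *: e j))%sesqui 0 0 =
  B i i + w * B i j + w^* * B j i + w * w^* * B j j.
Proof.
have ent k l : (delta_mx 0 k *m B *m (delta_mx l 0 : 'cV[C]_N)) (0 : 'I_1) (0 : 'I_1) = B k l.
  by rewrite -rowE -colE !mxE.
rewrite adj_pair mulmxDl -scalemxAl mulmxDl !mulmxDr -!scalemxAl -!scalemxAr.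
have addE (X Y : 'M[C]_1) : (X + Y) 0 0 = X 0 0 + Y 0 0 by rewrite mxE.
have scaleE a (X : 'M[C]_1) : (a *: X) 0 0 = a * X 0 0 by rewrite mxE.
rewrite !(addE, scaleE) !ent.
by ring.
Qed.

Lemma form_delta (B : 'M[C]_N) i :
  ((e i)^t* *m B *m e i)%sesqui 0 0 = B i i.
Proof.
have := form_pair B i i 0; rewrite scale0r !addr0 => ->.
by rewrite rmorph0 !mul0r !addr0.
Qed.

(* The four vectors [e_i + w e_j] with [w^4 = 1] polarize the product of two forms. *)
Lemma form_polarization (X Y : 'M[C]_N) i j :
  let h B w : C := ((e i + w *: e j)^t* *m B *m (e i + w *: e j))%sesqui 0 0 in
  4 * (X i i * Y j j + X i j * Y j i + (Y i i * X j j + Y i j * X j i)) =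
  h X 1 * h Y 1 + h X (-1) * h Y (-1) + h X 'i * h Y 'i + h X (- 'i) * h Y (- 'i) -
  4 * (X i i * Y i i) - 4 * (X j j * Y j j).
Proof.
move=> h; rewrite /h !form_pair !rmorphN /= !rmorph1 !conjCi.
have : 'i ^+ 2 = -1 :> C by exact: sqrCi.
move: 'i => I hI.
by ring: hI.
Qed.

Lemma norm_pair i j (w : C) : i != j ->
  ((e i + w *: e j)^t* *m (e i + w *: e j))%sesqui 0 0 = 1 + w * w^*.
Proof.
move=> nij; have := form_pair 1%:M i j w; rewrite mulmx1 => ->.
by rewrite !mxE !eqxx (negPf nij) eq_sym (negPf nij) !mulr0 !addr0 mulr1.
Qed.

Lemma norm_unit_col i : ((e i)^t* *m e i)%sesqui 0 0 = 1.
Proof. by have := form_delta 1%:M i; rewrite mulmx1 => ->; rewrite mxE eqxx. Qed.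
End PairForm.

Section CirclePolynomials.
Variable C : numClosedFieldType.

(** The Cayley transforms [w n = (n + i) / (n - i)] of the naturals are infinitely many points of
    the circle. *)
Lemma poly_circle_eq0 (p : {poly C}) (s : C) : s != 0 ->
  (forall w, `|w| = 1 -> p.[(w - 1) / s] = 0) -> p = 0.
Proof.
move=> s0 hp; pose den (n : nat) : C := n%:R - 'i.
have den0 n : den n != 0.
  apply/eqP => e; have : (n%:R - 'i) * (n%:R + 'i) = n%:R ^+ 2 + 1 :> C.
    by rewrite -subr_sqr sqrCi opprK.
  rewrite -/(den n) e mul0r => /esym/eqP.
  by rewrite -natrX natr1 pnatr_eq0.
pose w n := (n%:R + 'i) / den n.
have w1 n : `|w n| = 1.
  rewrite /w normf_div -[`|n%:R + 'i|]norm_conjC rmorphD rmorph_nat /= conjCi divff //.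
  by rewrite normr_eq0; apply: den0.
have wE n : (w n - 1) / s = 2 * 'i / (den n * s).
  by rewrite /w; have := den0 n; rewrite /den => ?; field; rewrite s0.
apply: (@roots_geq_poly_eq0 _ _ [seq (w i - 1) / s | i <- iota 0 (size p)]).
- by apply/allP => _ /mapP[n _ ->]; rewrite rootE hp.
- rewrite map_inj_uniq ?iota_uniq // => i j; rewrite !wE => /(mulfI _) e.
  have : (den i * s)^-1 = (den j * s)^-1 by apply: e; rewrite mulf_neq0 ?neq0Ci ?pnatr_eq0.
  move=> /invr_inj/(mulIf s0) /addIr/eqP; by rewrite eqr_nat => /eqP.
by rewrite size_map size_iota.
Qed.

Lemma coef_prod_linear (I : Type) (r : seq I) (x : I -> C) :
  let p := \prod_(i <- r) (1 - x i *: 'X) : {poly C} in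
  [/\ p`_0 = 1, p`_1 = - \sum_(i <- r) x i &
      2 * p`_2 = (\sum_(i <- r) x i) ^+ 2 - \sum_(i <- r) x i ^+ 2].
Proof.
elim: r => [|i r [/= IH0 IH1 IH2]] /=.
  by rewrite !big_nil !coef1 /= expr0n /= !subr0 oppr0 mulr0.
rewrite !big_cons mulrBl mul1r -scalerAl !coefB !coefZ !coefXM /= IH0 IH1 mulr0 subr0.
split=> //; first by ring.
by rewrite mulrBr IH2; ring.
Qed.

Lemma size_prod_linear (I : Type) (r : seq I) (x : I -> C) :
  (size (\prod_(i <- r) (1 - x i *: 'X) : {poly C})%R <= (size r).+1)%N.
Proof.
elim: r => [|i r IH]; first by rewrite big_nil size_poly1.
rewrite big_cons (leq_trans (size_polyMleq _ _)) //.
have : (size (1 - x i *: 'X : {poly C})%R <= 2)%N.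
  rewrite (leq_trans (size_polyD _ _)) // geq_max size_poly1 size_polyN.
  by rewrite (leq_trans (size_scale_leq _ _)) // size_polyX.
by move: IH; set a := size _; set b := size _ => /= ? ?; lia.
Qed.
End CirclePolynomials.

Section HaarToeplitz.
Variables (R : realType) (N : nat).
Local Notation C := (cplx R).
Variable haar : probability (borelMx R N) R.
Hypothesis hhaar : is_unitary_haar haar.
Local Notation D := (@unitary_group R N).
Local Notation tame := (@tame R N).
Local Notation J := (haar_mean haar).

Lemma tame_sum (I : Type) (s : seq I) (P : pred I) (f : I -> 'M[C]_N -> C) :
  (forall i, tame (f i)) -> tame (fun U => \sum_(i <- s | P i) f i U).
Proof. by move=> hf; apply: (Adm_sum (@tame_cst R N) (@tameD R N)). Qed.

Lemma tame_prod (I : Type) (s : seq I) (P : pred I) (f : I -> 'M[C]_N -> C) :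
  (forall i, tame (f i)) -> tame (fun U => \prod_(i <- s | P i) f i U).
Proof. by move=> hf; apply: (Adm_prod (@tame_cst R N) (@tameM R N)). Qed.

Lemma tame_det n (A : 'M[C]_N -> 'M[C]_n) :
  (forall i j, tame (fun U => A U i j)) -> tame (fun U => \det (A U)).
Proof. by move=> hA; apply: (Adm_det (@tame_cst R N) (@tameD R N) (@tameM R N)). Qed.

Lemma tameB f g : tame f -> tame g -> tame (fun U => f U - g U).
Proof.
move=> tf tg; apply: tameD => //.
by under eq_fun do rewrite -mulN1r; apply: tameM => //; apply: tame_cst.
Qed.

Lemma tameX f n : tame f -> tame (fun U => f U ^+ n).
Proof.
move=> tf; elim: n => [|n IH]; first by under eq_fun do rewrite expr0; apply: tame_cst.
by under eq_fun do rewrite exprS; apply: tameM.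
Qed.

Lemma tame_horner_char_poly x : tame (fun U => (char_poly U).[x]).
Proof.
under eq_fun do rewrite horner_char_poly; apply: tame_det => i j.
under eq_fun do rewrite mxE [X in _ + X]mxE.
by apply: tameB; [apply: tame_cst | apply: tame_entry].
Qed.

(** Lagrange interpolation at [0, ..., N] writes a coefficient as a combination of values, which are
    determinants. *)
Lemma tame_coef_char_poly i : tame (fun U => (char_poly U)`_i).
Proof.
pose p (r : 'I_N.+1) : C := (r : nat)%:R.
have injp : injective p by move=> r1 r2 /eqP; rewrite eqr_nat => /eqP/val_inj.
have e (U : 'M[C]_N) : (char_poly U)`_i =
    \sum_r (char_poly U).[p r] / (omit p r).[p r] * (omit p r)`_i.
  have sz : (size (char_poly U) <= N.+1)%N by rewrite size_char_poly.
  rewrite [LHS](congr1 (fun h : {poly C} => h`_i) (lagrange_interp injp sz)) coef_sum.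
  by apply: eq_bigr => r _; rewrite coefZ.
rewrite (_ : (fun U => _) = fun U => \sum_r (char_poly U).[p r] / (omit p r).[p r] * (omit p r)`_i);
  last by apply/funext => U; apply: e.
apply: tame_sum => r; apply: tameM; last exact: tame_cst.
by apply: tameM; [apply: tame_horner_char_poly | apply: tame_cst].
Qed.

Lemma circle_neq_nat (n : nat) (z : C) : (1 < n)%N -> `|z| = 1 -> n%:R != z.
Proof.
by move=> n1 z1; apply: contraTneq n1 => e; rewrite -(ltr_nat C) -[n%:R]normr_nat e z1 ltxx.
Qed.

(** Each factor [n - z_i] has modulus at least [n - 1]; this is the reason for nodes that are
    integers above 1. *)
Lemma norm_char_poly_ge1 (U : 'M[C]_N) (n : nat) : (1 < n)%N -> D U ->
  1 <= `|(char_poly U).[n%:R]|.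
Proof.
move=> n1 /unitary_spectrum[P [z [uP eU z1]]].
rewrite (char_poly_spectrum uP eU) horner_prod normr_prod.
apply: (big_ind (fun x : C => 1 <= x)) => // [x y x1 y1|i _]; first by rewrite mulr_ege1.
rewrite hornerXsubC (le_trans _ (lerB_dist _ _)) // z1 normr_nat lerBrDr -(natrD C 1 1).
by rewrite ler_nat.
Qed.

Lemma resolvent_unit (U : 'M[C]_N) (n : nat) : (1 < n)%N -> D U ->
  n%:R%:M - U \in unitmx.
Proof.
move=> n1 /unitary_spectrum[P [z [uP eU z1]]].
by have [] := resolvent_spectrum uP eU (fun i => circle_neq_nat n1 (z1 i)).
Qed.

(** On the group the inverse is the adjugate over the characteristic polynomial, whose value at [n]
    is bounded below there. *)
Lemma tame_resolvent (n : nat) i j : (1 < n)%N -> tame (fun U => resolvent U n%:R i j).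
Proof.
move=> n1.
apply: (@eq_tame _ _ (fun U => \sum_l U i l * ((char_poly U).[n%:R]^-1 * (\adj (n%:R%:M - U)) l j))).
  move=> U DU; rewrite mxE; apply: eq_bigr => l _.
  by rewrite /invmx resolvent_unit // horner_char_poly [in RHS]mxE.
apply: tame_sum => l; apply: tameM; first exact: tame_entry.
apply: tameM.
  apply: (tameV (e := 1)) => //; last exact: tame_horner_char_poly.
  by move=> U DU; rewrite norm_char_poly_ge1.
under eq_fun do rewrite mxE /cofactor.
apply: tameM; first exact: tame_cst.
apply: tame_det => r c; under eq_fun do rewrite !mxE.
by apply: tameB; [apply: tame_cst | apply: tame_entry].
Qed.
End HaarToeplitz.

(** * Relations from invariance under rank-one unitaries *)

Section RankOneMoments.
Variables (R : realType) (N : nat).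
Local Notation C := (cplx R).
Variable haar : probability (borelMx R N) R.
Hypothesis hhaar : is_unitary_haar haar.
Local Notation D := (@unitary_group R N).
Local Notation tame := (@tame R N).
Local Notation J := (haar_mean haar).
Variables (M m : nat) (n : 'I_M -> nat).
Hypothesis n_gt1 : forall a, (1 < n a)%N.

(** On the group the conjugate of the determinant is its inverse, so the weight is [det(U)^-m]. *)
Definition wmean (f : 'M[C]_N -> C) : C := J (fun U => (\det U)^* ^+ m * f U).

Lemma tame_weight f : tame f -> tame (fun U => (\det U)^* ^+ m * f U).
Proof.
move=> tf; apply: tameM => //; apply: tameX; apply: tameJ.
by apply: tame_det => i j; apply: tame_entry.
Qed.

Lemma wmeanD f g : tame f -> tame g -> wmean (fun U => f U + g U) = wmean f + wmean g.
Proof.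
move=> tf tg; rewrite /wmean -haar_meanD; try exact: tame_weight.
by apply: eq_haar_mean => U _; rewrite mulrDr.
Qed.

Lemma wmeanZ c f : tame f -> wmean (fun U => c * f U) = c * wmean f.
Proof.
move=> tf; rewrite /wmean -haar_meanZ; last exact: tame_weight.
by apply: eq_haar_mean => U _; rewrite mulrCA.
Qed.

Lemma eq_wmean f g : (forall U, D U -> f U = g U) -> wmean f = wmean g.
Proof. by move=> e; apply: eq_haar_mean => U DU; rewrite e. Qed.

Lemma wmean_sum (I : Type) (s : seq I) (P : pred I) (f : I -> 'M[C]_N -> C) :
  (forall i, tame (f i)) ->
  wmean (fun U => \sum_(i <- s | P i) f i U) = \sum_(i <- s | P i) wmean (f i).
Proof. exact: (L_sum (@tame_cst R N) (@tameD R N) wmeanD wmeanZ). Qed.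

Definition cp_prod (U : 'M[C]_N) : C := \prod_a (char_poly U).[(n a)%:R].

Definition form (p : 'cV[C]_N) a (U : 'M[C]_N) : C :=
  ((p^t*)%sesqui *m resolvent U (n a)%:R *m p) 0 0.

Lemma tame_cp_prod : tame cp_prod.
Proof. by apply: tame_prod => a; apply: tame_horner_char_poly. Qed.

Lemma tame_form p a : tame (form p a).
Proof.
rewrite /form; under eq_fun do rewrite mxE; apply: tame_sum => j.
apply: tameM; last exact: tame_cst.
under eq_fun do rewrite mxE; apply: tame_sum => i.
by apply: tameM; [apply: tame_cst | apply: tame_resolvent].
Qed.

(** The factor that [cp_prod] acquires under a rank-one unitary along [p], as a polynomial in
    [(w - 1) / |p|^2]. *)
Let lin p U : {poly C} := \prod_a (1 - form p a U *: 'X).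

Let tame_lin_coef p i : tame (fun U => (lin p U)`_i).
Proof.
rewrite /lin; elim: (index_enum _) i => [|a s IH] i.
  by under eq_fun do rewrite big_nil; apply: tame_cst.
under eq_fun do rewrite big_cons coefM; apply: tame_sum => j; apply: tameM => //.
under eq_fun do rewrite coefB coefZ.
by apply: tameB; [apply: tame_cst | apply: tameM; [apply: tame_form | apply: tame_cst]].
Qed.

Let sq_norm (p : 'cV[C]_N) : C := ((p^t*)%sesqui *m p) 0 0.

Let G := wmean cp_prod.

(** Translation by the rank-one unitary of determinant [w] multiplies the weight by [w^-m] and
    [cp_prod] by a value of [lin]. *)
Let rank1_identity p w : sq_norm p != 0 -> `|w| = 1 ->
  wmean (fun U => cp_prod U * (lin p U).[(w - 1) / sq_norm p]) = w ^+ m * G.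
Proof.
move=> s0 w1; have [uV dV] := rank1_unitary w1 s0; move: uV dV.
set V := _ + _ => uV dV.
have tF : tame (fun U => (\det U)^* ^+ m * cp_prod U) by apply/tame_weight/tame_cp_prod.
have := haar_mean_invariant hhaar (V := V) uV tF => inv.
have ww : w ^+ m * w^* ^+ m = 1 by rewrite -exprMn -normCK w1 !expr1n.
have tcl : tame (fun U => cp_prod U * (lin p U).[(w - 1) / sq_norm p]).
  apply: tameM; first exact: tame_cp_prod.
  rewrite /lin; under eq_fun do rewrite horner_prod; apply: tame_prod => a.
  under eq_fun do rewrite hornerD hornerN hornerC hornerZ hornerX.
  by apply: tameB; [apply: tame_cst | apply: tameM; [apply: tame_form | apply: tame_cst]].
have w0 : w^* ^+ m != 0.
  by apply/eqP => e; move/eqP: ww; rewrite e mulr0 eq_sym oner_eq0.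
apply: (mulfI w0); rewrite [RHS]mulrA [w^* ^+ m * w ^+ m]mulrC ww mul1r.
apply: (etrans (esym (haar_meanZ haar _ (tame_weight tcl)))); apply: etrans inv.
apply: eq_haar_mean => U DU; rewrite det_mulmx dV rmorphM exprMn -!mulrA; congr (_ * (_ * _)).
rewrite /cp_prod /lin horner_prod -big_split; apply: eq_bigr => a _ /=.
rewrite /V char_poly_rank1; last exact: resolvent_unit.
congr (_ * _); rewrite -scalemxAr mxE.
by rewrite hornerD hornerN hornerC hornerZ hornerX mulrC.
Qed.

(* Both sides are polynomials in [(w - 1) / |p|^2] that agree for [w] on the unit circle. *)
Let poly_identity p : sq_norm p != 0 ->
  \poly_(j < M.+1) wmean (fun U => cp_prod U * (lin p U)`_j) =
  G *: \prod_(i < m) (1 - - sq_norm p *: 'X).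
Proof.
move=> s0; apply/eqP; rewrite -subr_eq0; apply/eqP.
apply: (poly_circle_eq0 s0) => w w1; rewrite hornerD hornerN hornerZ horner_poly.
rewrite horner_prod [X in _ - _ * X](eq_bigr (fun=> w)) => [|i _]; last first.
  rewrite hornerD hornerN hornerC hornerZ hornerX; move: (sq_norm p) s0 => s s0.
  by field.
rewrite prodr_const card_ord [G * _]mulrC -(rank1_identity s0 w1).
apply/eqP; rewrite subr_eq0; apply/eqP.
have tc j : tame (fun U => cp_prod U * (lin p U)`_j) by apply: tameM => //; apply: tame_cp_prod.
transitivity (\sum_(j < M.+1) wmean (fun U => ((w - 1) / sq_norm p) ^+ j * (cp_prod U * (lin p U)`_j))).
  by apply: eq_bigr => j _; rewrite wmeanZ // mulrC.
rewrite -wmean_sum => [|j]; last by apply: tameM => //; apply: tame_cst.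
apply: eq_wmean => U _.
have sz : (size (lin p U) <= M.+1)%N.
  rewrite (leq_trans (size_prod_linear _ _)) // /index_enum -enumT size_enum_ord //.
rewrite (horner_coef_wide _ sz) mulr_sumr; apply: eq_bigr => j _.
by rewrite mulrCA [_ ^+ _ * _]mulrC mulrA.
Qed.

Let lin_coef p U := coef_prod_linear (index_enum 'I_M) (fun a => form p a U).
Let pow_coef (s : C) := coef_prod_linear (index_enum 'I_m) (fun=> - s).

Let moment_coef p j : sq_norm p != 0 ->
  wmean (fun U => cp_prod U * (lin p U)`_j) =
  G * (\prod_(i < m) (1 - - sq_norm p *: 'X))`_j.
Proof.
move=> s0; rewrite -coefZ -poly_identity // coef_poly; case: ltnP => // ltMj.
rewrite (eq_wmean (g := fun=> 0 * 0)) => [|U _]; first by rewrite wmeanZ ?mul0r //; apply: tame_cst.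
rewrite mul0r nth_default ?mulr0 // (leq_trans (size_prod_linear _ _)) //.
by rewrite /index_enum -enumT size_enum_ord.
Qed.

Lemma moment1 p : sq_norm p != 0 ->
  wmean (fun U => cp_prod U * \sum_a form p a U) = - (m%:R * sq_norm p) * G.
Proof.
move=> s0; have := moment_coef 1 s0; have [_ -> _] := pow_coef (sq_norm p).
rewrite sumr_const card_ord => e.
rewrite (eq_wmean (g := fun U => -1 * (cp_prod U * (lin p U)`_1))); last first.
  by move=> U _; have [_ -> _] := lin_coef p U; ring.
rewrite wmeanZ; last by apply: tameM; [apply: tame_cp_prod | apply: tame_lin_coef].
by rewrite e -mulr_natl; ring.
Qed.

(** Degree 2 of [poly_identity]: twice the second elementary symmetric function is the sum over
    ordered pairs of distinct indices. *)
Lemma moment2 p : sq_norm p != 0 ->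
  wmean (fun U => cp_prod U * \sum_a \sum_(b | b != a) form p a U * form p b U) =
  m%:R * (m%:R - 1) * sq_norm p ^+ 2 * G.
Proof.
move=> s0; have e := moment_coef 2 s0; have [_ _ e2] := pow_coef (sq_norm p).
rewrite !sumr_const card_ord in e2.
rewrite (eq_wmean (g := fun U => 2 * (cp_prod U * (lin p U)`_2))); last first.
  move=> U _; have [_ _ h] := lin_coef p U.
  rewrite mulrCA h; congr (_ * _); rewrite expr2 mulr_suml -sumrB; apply: eq_bigr => a _.
  by rewrite mulr_sumr [in RHS](bigD1 a) //= expr2 addrAC subrr add0r.
rewrite wmeanZ; last by apply: tameM; [apply: tame_cp_prod | apply: tame_lin_coef].
rewrite e mulrCA e2 -[X in X ^+ 2]mulr_natl -[X in _ - X]mulr_natl; ring.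
Qed.
End RankOneMoments.

Section PairSums.
Variables (C : numClosedFieldType) (N M : nat) (A : 'I_M -> 'M[C]_N).
Local Notation e := (@unit_col C N).

Definition pairs (f : 'I_M -> 'I_M -> C) := \sum_a \sum_(b | b != a) f a b.

Lemma pairs_sym f : pairs f = pairs (fun a b => f b a).
Proof.
rewrite /pairs (exchange_big_dep predT) //=; apply: eq_bigr => a _.
by apply: eq_bigl => b; rewrite eq_sym.
Qed.

Lemma pairsD f g : pairs (fun a b => f a b + g a b) = pairs f + pairs g.
Proof. by rewrite /pairs -big_split; apply: eq_bigr => a _; rewrite big_split. Qed.

Lemma pairsZ c f : pairs (fun a b => c * f a b) = c * pairs f.
Proof. by rewrite /pairs mulr_sumr; apply: eq_bigr => a _; rewrite mulr_sumr. Qed.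

Lemma eq_pairs f g : (forall a b, f a b = g a b) -> pairs f = pairs g.
Proof. by move=> h; apply: eq_bigr => a _; apply: eq_bigr => b _. Qed.

Let h (p : 'cV[C]_N) a : C := ((p^t*)%sesqui *m A a *m p) 0 0.

(** Symmetry of [pairs] merges the two halves of [form_polarization], so 4 becomes 8. *)
Lemma pairs_polarization i j :
  let Q p := pairs (fun a b => h p a * h p b) in
  8 * pairs (fun a b => A a i i * A b j j + A a i j * A b j i) =
  Q (e i + 1 *: e j) + Q (e i + (-1) *: e j) + Q (e i + 'i *: e j) + Q (e i + (- 'i) *: e j) -
  4 * pairs (fun a b => A a i i * A b i i) - 4 * pairs (fun a b => A a j j * A b j j).
Proof.
pose q p a b := h p a * h p b.
pose w a b := A a i i * A b j j + A a i j * A b j i.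
pose d k a b := A a k k * A b k k.
move=> Q; rewrite -/(pairs w) -/(pairs (d i)) -/(pairs (d j)).
have -> : 8 * pairs w = pairs (fun a b => 4 * (w a b + w b a)).
  by rewrite (pairsZ _ (fun a b => w a b + w b a)) (pairsD w (fun a b => w b a)) -(pairs_sym w); ring.
transitivity (pairs (fun a b => q (e i + 1 *: e j) a b + (q (e i + (-1) *: e j) a b +
    (q (e i + 'i *: e j) a b + (q (e i + (- 'i) *: e j) a b +
    (-4 * d i a b + -4 * d j a b)))))).
  apply: eq_pairs => a b; rewrite /w.
  have := form_polarization (A a) (A b) i j => /= ->.
  by rewrite !mulNr !addrA.
rewrite (pairsD (q _)) (pairsD (q _)) (pairsD (q _)) (pairsD (q _)).
rewrite (pairsD (fun a b => -4 * d i a b)) (pairsZ _ (d i)) (pairsZ _ (d j)).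
by rewrite !mulNr !addrA.
Qed.
Lemma pairs_trace :
  pairs (fun a b => \tr (A a) * \tr (A b) + \tr (A a *m A b)) =
  \sum_i \sum_j pairs (fun a b => A a i i * A b j j + A a i j * A b j i).
Proof.
rewrite /pairs; under [RHS]eq_bigr => i _ do rewrite exchange_big.
rewrite exchange_big; apply: eq_bigr => a _ /=.
under [RHS]eq_bigr => i _ do rewrite exchange_big.
rewrite exchange_big; apply: eq_bigr => b _ /=.
rewrite /mxtrace mulr_suml -big_split; apply: eq_bigr => i _ /=.
by rewrite mulr_sumr mxE -big_split.
Qed.

Lemma distr_polarization (F x1 x2 x3 x4 x5 x6 : C) :
  F * (x1 + x2 + x3 + x4 - 4 * x5 - 4 * x6) =
  F * x1 + F * x2 + F * x3 + F * x4 + -4 * (F * x5) + -4 * (F * x6).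
Proof. by ring. Qed.

Lemma sum_polarization (t g : C) :
  4 * t * g + 4 * t * g + 4 * t * g + 4 * t * g + -4 * (t * g) + -4 * (t * g) =
  8 * ((1 + 0) * t * g).
Proof. by ring. Qed.
End PairSums.

Section Traces.
Variables (R : realType) (N : nat).
Local Notation C := (cplx R).
Variable haar : probability (borelMx R N) R.
Hypothesis hhaar : is_unitary_haar haar.
Local Notation D := (@unitary_group R N).
Local Notation tame := (@tame R N).
Variables (M m : nat) (n : 'I_M -> nat).
Hypothesis n_gt1 : forall a, (1 < n a)%N.
Local Notation wmean := (wmean haar m).
Local Notation F := (cp_prod n).
Let G := wmean F.
Let A a (U : 'M[C]_N) := resolvent U (n a)%:R.

Local Notation e := (@unit_col C N).

Let form_e0 i a U : form n (e i) a U = A a U i i.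
Proof. exact: form_delta. Qed.

Let tameA a i j : tame (fun U => A a U i j).
Proof. exact: tame_resolvent. Qed.

Let tameF : tame F. Proof. exact: tame_cp_prod. Qed.

(** The trace is the sum of the forms at the unit columns, each governed by [moment1]. *)
Lemma mean_trace : wmean (fun U => F U * \sum_a \tr (A a U)) = - (m%:R * N%:R) * G.
Proof.
rewrite (eq_wmean haar m (g := fun U => \sum_i F U * \sum_a form n (e i) a U)); last first.
  move=> U _; rewrite -mulr_sumr exchange_big; congr (_ * _); apply: eq_bigr => a _.
  by apply: eq_bigr => i _; rewrite form_e0.
rewrite (wmean_sum haar m) => [|i]; last first.
  by apply: tameM => //; apply: tame_sum => a; apply: tame_form.
under eq_bigr => i _ do rewrite (moment1 hhaar m n_gt1) ?norm_unit_col ?oner_eq0 //.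
rewrite sumr_const card_ord -mulr_natl -/G; ring.
Qed.

Let tame_pairs (f : 'I_M -> 'I_M -> 'M[C]_N -> C) :
  (forall a b, tame (f a b)) -> tame (fun U => pairs (fun a b => f a b U)).
Proof. by move=> h; apply: tame_sum => a; apply: tame_sum. Qed.

Let Q (p : 'cV[C]_N) U := pairs (fun a b => form n p a U * form n p b U).

Let tameQ p : tame (fun U => F U * Q p U).
Proof. by apply: tameM => //; apply: tame_pairs => a b; apply: tameM; apply: tame_form. Qed.

Let W i j (U : 'M[C]_N) := pairs (fun a b => A a U i i * A b U j j + A a U i j * A b U j i).

Let tameW i j : tame (fun U => F U * W i j U).
Proof.
apply: tameM => //; apply: tame_pairs => a b.
by apply: tameD; apply: tameM.
Qed.

Let W_Q i j U : 8 * W i j U =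
  Q (e i + 1 *: e j) U + Q (e i + (-1) *: e j) U + Q (e i + 'i *: e j) U + Q (e i + (- 'i) *: e j) U -
  4 * Q (e i) U - 4 * Q (e j) U.
Proof.
rewrite /W pairs_polarization; congr (_ - 4 * _ - 4 * _); apply: eq_pairs => a b.
all: by rewrite !form_e0.
Qed.

Let mean_Q i j (w : C) : i != j -> `|w| = 1 ->
  wmean (fun U => F U * Q (e i + w *: e j) U) = 4 * (m%:R * (m%:R - 1)) * G.
Proof.
move=> nij w1; have ww : w * w^* = 1 by rewrite -normCK w1 expr1n.
rewrite (moment2 hhaar m n_gt1) // norm_pair // ww; last by rewrite -(natrD _ 1 1) pnatr_eq0.
by rewrite -/G; ring.
Qed.

Let mean_Q0 i : wmean (fun U => F U * Q (e i) U) = m%:R * (m%:R - 1) * G.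
Proof. by rewrite (moment2 hhaar m n_gt1) // norm_unit_col ?oner_eq0 // expr1n mulr1. Qed.

(** In units of [m (m - 1) G]: for [i != j] the four vectors of squared norm 2 contribute 4 each and
    the two unit columns remove 4 each, which leaves 8; [W i i] is twice the form [Q] at one unit
    column. *)
Let mean_W i j : wmean (fun U => F U * W i j U) = (1 + (i == j)%:R) * (m%:R * (m%:R - 1)) * G.
Proof.
have [<-|nij] := eqVneq i j.
  rewrite (eq_wmean haar m (g := fun U => 2 * (F U * Q (e i) U))) => [|U _]; last first.
    rewrite mulrCA; congr (_ * _); rewrite /Q -pairsZ; apply: eq_pairs => a b.
    by rewrite !form_e0 mulr_natl mulr2n.
  by rewrite (wmeanZ haar m) // mean_Q0 [in LHS]mulrA -(natrD _ 1 1).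
have n8 : (8 : C) != 0 by rewrite pnatr_eq0.
apply: (mulfI n8); rewrite -(wmeanZ haar m) //.
pose f k := if k is 0 then fun U => F U * Q (e i + 1 *: e j) U else
  if k is 1 then fun U => F U * Q (e i + (-1) *: e j) U else
  if k is 2 then fun U => F U * Q (e i + 'i *: e j) U else
  if k is 3 then fun U => F U * Q (e i + (- 'i) *: e j) U else
  if k is 4 then fun U => (-4) * (F U * Q (e i) U) else fun U => (-4) * (F U * Q (e j) U).
have tf k : tame (f k).
  by case: k => [|[|[|[|[|k]]]]]; rewrite /f //; apply: tameM => //; apply: tame_cst.
rewrite (eq_wmean haar m (g := fun U => \sum_(k < 6) f k U)) => [|U _]; last first.
  rewrite mulrCA W_Q !big_ord_recr big_ord0 /= add0r.
  by rewrite -[RHS]distr_polarization.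
rewrite (wmean_sum haar m); last by move=> k; exact: tf.
have e0 : wmean (f 0) = 4 * (m%:R * (m%:R - 1)) * G by apply: mean_Q; rewrite ?normr1.
have e1 : wmean (f 1) = 4 * (m%:R * (m%:R - 1)) * G by apply: mean_Q; rewrite ?normrN ?normr1.
have e2 : wmean (f 2) = 4 * (m%:R * (m%:R - 1)) * G by apply: mean_Q; rewrite ?normCi.
have e3 : wmean (f 3) = 4 * (m%:R * (m%:R - 1)) * G by apply: mean_Q; rewrite ?normrN ?normCi.
have e4 : wmean (f 4) = -4 * (m%:R * (m%:R - 1) * G).
  rewrite -(mean_Q0 i); exact: (wmeanZ haar m).
have e5 : wmean (f 5) = -4 * (m%:R * (m%:R - 1) * G).
  rewrite -(mean_Q0 j); exact: (wmeanZ haar m).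
clear tf; clearbody f; rewrite 6!big_ord_recr big_ord0.
transitivity (0 + wmean (f 0) + wmean (f 1) + wmean (f 2) + wmean (f 3) + wmean (f 4) + wmean (f 5)).
  by reflexivity.
rewrite add0r e0 e1 e2 e3 e4 e5.
by rewrite -[RHS]sum_polarization.
Qed.

(** [N (N + 1)] is the sum of [1 + (i == j)] over all [i] and [j]. *)
Lemma mean_trace_pairs :
  wmean (fun U => F U * \sum_a \sum_(b | b != a)
    (\tr (A a U) * \tr (A b U) + \tr (A a U *m A b U))) =
  N%:R * (N%:R + 1) * (m%:R * (m%:R - 1)) * G.
Proof.
rewrite (eq_wmean haar m (g := fun U => \sum_i \sum_j F U * W i j U)) => [|U _]; last first.
  under [RHS]eq_bigr => i _ do rewrite -mulr_sumr.
  rewrite -mulr_sumr; congr (_ * _); exact: pairs_trace.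
rewrite (wmean_sum haar m) => [|i]; last exact: tame_sum.
under eq_bigr => i _ do rewrite (wmean_sum haar m) //.
under eq_bigr => i _.
  under eq_bigr => j _ do rewrite mean_W -mulrA.
  rewrite -mulr_suml big_split /= sumr_const card_ord.
  rewrite (bigD1 i) //= eqxx big1 ?addr0; last by move=> j; rewrite eq_sym => /negPf->.
  over.
by rewrite sumr_const card_ord -[LHS]mulr_natl !mulrA.
Qed.
End Traces.

(** * From traces of resolvents to logarithmic derivatives *)

Section PairIdentity.
Variables (C : numFieldType) (N M : nat) (y : 'I_M -> C) (z : 'I_N -> C).
Hypothesis injy : injective y.
Hypothesis yz : forall a i, y a != z i.
Let t a := \sum_i y a / (y a - z i).
Let s a := \sum_i z i / (y a - z i).

Lemma log_deriv_sum a : t a = N%:R + s a.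
Proof.
rewrite /t /s -[N in N%:R]card_ord -sumr_const -big_split; apply: eq_bigr => i _ /=.
have : y a - z i != 0 by rewrite subr_eq0.
by move=> ?; field.
Qed.

Let sum_neq (f : 'I_M -> C) : \sum_a \sum_(b | b != a) f a = (M%:R - 1) * \sum_a f a.
Proof.
rewrite mulr_sumr; apply: eq_bigr => a _.
have : \sum_(b < M) f a = M%:R * f a by rewrite sumr_const card_ord mulr_natl.
by rewrite (bigD1 a) //= => e; rewrite mulrBl mul1r -e addrC addrK.
Qed.

(** Partial fractions in [z i] turn the products of two resolvent eigenvalues into terms [r a b];
    what then remains of [r] is antisymmetric and cancels over ordered pairs. *)
Lemma log_deriv_pairs :
  \sum_a \sum_(b | b != a) (t a * t b - 2 * t a * (y a / (y a - y b))) =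
  \sum_a \sum_(b | b != a) (s a * s b + \sum_i (z i / (y a - z i)) * (z i / (y b - z i))) +
  2 * N%:R * (M%:R - 1) * \sum_a t a - M%:R * (M%:R - 1) * (N%:R * (N%:R + 1)).
Proof.
pose r a b := y a * t a / (y a - y b).
have hr a b : b != a -> \sum_i (z i / (y a - z i)) * (z i / (y b - z i)) = N%:R - r a b - r b a.
  move=> nba; rewrite /r /t !mulr_sumr !mulr_suml -[N in N%:R]card_ord -sumr_const -!sumrB.
  apply: eq_bigr => i _.
  have h1 : y a - z i != 0 by rewrite subr_eq0.
  have h2 : y b - z i != 0 by rewrite subr_eq0.
  have h3 : y a - y b != 0 by rewrite subr_eq0 (inj_eq injy) eq_sym.
  have h4 : y b - y a != 0 by rewrite subr_eq0 (inj_eq injy).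
  by field; rewrite h1 h2 h3 h4.
have symr (f : 'I_M -> 'I_M -> C) : \sum_a \sum_(b | b != a) f a b = \sum_a \sum_(b | b != a) f b a.
  rewrite (exchange_big_dep predT) //=; apply: eq_bigr => a _.
  by apply: eq_bigl => b; rewrite eq_sym.
have e1 : \sum_a \sum_(b | b != a) (t a * t b - 2 * t a * (y a / (y a - y b))) =
   \sum_a \sum_(b | b != a) (s a * s b + \sum_i (z i / (y a - z i)) * (z i / (y b - z i))
     + (N%:R * t a + N%:R * t b + (- N%:R * (N%:R + 1)) + (r b a - r a b))).
  apply: eq_bigr => a _; apply: eq_bigr => b nba; rewrite hr // /r !log_deriv_sum.
  by move: (y b - _) => w; ring.
have split2 (f g : 'I_M -> 'I_M -> C) : \sum_a \sum_(b | b != a) (f a b + g a b) =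
    \sum_a \sum_(b | b != a) f a b + \sum_a \sum_(b | b != a) g a b.
  by rewrite -big_split; apply: eq_bigr => a _; rewrite big_split.
rewrite e1 split2 -addrA; congr (_ + _).
rewrite split2 split2 split2 (sum_neq (fun a => N%:R * t a)).
rewrite (symr (fun a b => N%:R * t b)) (sum_neq (fun a => N%:R * t a)) (sum_neq (fun=> _)).
rewrite (split2 (fun a b => r b a)) (symr (fun a b => r b a)).
have -> : \sum_a \sum_(b | b != a) - r a b = - \sum_a \sum_(b | b != a) r a b.
  by rewrite -sumrN; apply: eq_bigr => a _; rewrite sumrN.
have sumc (x : C) : \sum_(a < M) x = M%:R * x by rewrite sumr_const card_ord mulr_natl.
by rewrite subrr addr0 -mulr_sumr sumc; ring.
Qed.

Lemma distr_kappa (n m' M' g : C) :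
  n * (n + 1) * (m' * (m' - 1)) * g +
    (2 * n * (M' - 1) * (n * (M' - m') * g) + - (M' * (M' - 1) * (n * (n + 1))) * g) =
  (n * (n + 1) * (m' * (m' - 1)) + 2 * n * (M' - 1) * (M' - m') * n -
    M' * (M' - 1) * n * (n + 1)) * g.
Proof. by ring. Qed.

Lemma distr_pairs (f w c' t' k : C) :
  f * (w + c' * t' - k) = f * w + (c' * (f * t') + - k * f).
Proof. by ring. Qed.
End PairIdentity.

(** * The Haar mean satisfies the assumptions on the abstract mean *)

Section HaarToeplitz.
Variables (R : realType) (N : nat).
Local Notation C := (cplx R).
Variable haar : probability (borelMx R N) R.
Hypothesis hhaar : is_unitary_haar haar.
Local Notation D := (@unitary_group R N).
Local Notation tame := (@tame R N).
Variables (M m : nat).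
Local Notation L := (wmean haar m).

(** Off the group the value [X^N] makes monicity and nonvanishing at integers above 1 hold for every
    matrix; the mean sees only the group. *)
Let q (U : 'M[C]_N) : {poly C} := if U \is unitarymx then char_poly U else 'X^N.

Let qE U : D U -> q U = char_poly U.
Proof. by rewrite /q /unitary_group /= => ->. Qed.

Let q_circle U : exists z : 'I_N -> C, q U = \prod_i ('X - (z i)%:P) /\ forall i, `|z i| <= 1.
Proof.
rewrite /q; case: ifP => [/unitary_spectrum[P [z [uP eU z1]]]|_].
  by exists (z 0); rewrite (char_poly_spectrum uP eU); split=> // i; rewrite z1.
exists (fun=> 0); split=> [|i]; last by rewrite normr0 ler01.
by rewrite subr0 prodr_const card_ord.
Qed.

Let size_q U : (size (q U) <= N.+1)%N.
Proof. by rewrite /q; case: ifP; rewrite ?size_char_poly ?size_polyXn. Qed.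

Let lead_q U : (q U)`_N = 1.
Proof.
rewrite /q; case: ifP => _; last by rewrite coefXn eqxx.
by have /monicP := char_poly_monic U; rewrite lead_coefE size_char_poly.
Qed.

Let tame_q i : tame (fun U => (q U)`_i).
Proof.
apply: (@eq_tame _ _ (fun U => (char_poly U)`_i)) => [U DU|]; first by rewrite qE.
exact: tame_coef_char_poly.
Qed.

(** The constant term is [(-1)^N det(U)], and the weight cancels [det(U)^m]. *)
Let wmean_q0 : L (fun U => (q U)`_0 ^+ m) = (-1) ^+ (m * N).
Proof.
rewrite /wmean (eq_haar_mean haar (g := fun=> (-1) ^+ (m * N) * 1)) => [|U DU].
  by rewrite haar_meanZ ?haar_mean1 ?mulr1 //; apply: tame_cst.
rewrite qE // char_poly_det exprMn -exprM mulrCA mulnC -exprMn mulrC.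
have [P [z [uP eU z1]]] := unitary_spectrum DU.
have dU : `|\det U| = 1.
  rewrite eU !det_mulmx det_inv mulrAC mulVr ?mul1r -?unitmxE // det_diag normr_prod.
  by rewrite big1.
by rewrite -normCKC dU !expr1n mul1r mulr1.
Qed.

Let q_neq0 U n : (1 < n)%N -> (q U).[n%:R] != 0.
Proof.
move=> n1; have [z [-> z1]] := q_circle U; rewrite horner_prod.
apply/prodf_neq0 => i _; rewrite hornerXsubC subr_eq0.
by apply: contraTneq (z1 i) => <-; rewrite normr_nat lt_geF ?ltr1n.
Qed.

Section Node.
Variables (y : 'I_M -> C) (n : 'I_M -> nat).
Hypothesis injy : injective y.
Hypothesis n_gt1 : forall a, (1 < n a)%N.
Hypothesis yE : forall a, y a = (n a)%:R.

Let pr U := \prod_a (q U).[y a].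
Let t_ a U := y a * (q U)^`().[y a] / (q U).[y a].
Let F := @cp_prod R N M n.
Let u_ a (U : 'M[C]_N) := resolvent U (n a)%:R.

Let prE U : D U -> pr U = F U.
Proof. by move=> DU; apply: eq_bigr => a _; rewrite qE // yE. Qed.

Let spectrum U : D U -> exists z : 'I_N -> C, [/\ forall a i, y a != z i,
  forall a, t_ a U = \sum_i y a / (y a - z i),
  forall a, \tr (u_ a U) = \sum_i z i / (y a - z i) &
  forall a b, \tr (u_ a U *m u_ b U) =
    \sum_i (z i / (y a - z i)) * (z i / (y b - z i))].
Proof.
move=> DU; have [P [z [uP eU z1]]] := unitary_spectrum DU.
have yz a i : y a != z 0 i by rewrite yE circle_neq_nat.
have uE a : u_ a U = invmx P *m diag_mx (\row_i (z 0 i / (y a - z 0 i))) *m P.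
  by rewrite /u_ -yE; have [] := resolvent_spectrum uP eU (yz a).
exists (z 0); split=> // [a|a|a b].
- have q0 : (q U).[y a] != 0 by rewrite yE q_neq0.
  apply: (canLR (mulfK q0)); rewrite (qE DU) (char_poly_spectrum uP eU).
  rewrite deriv_prod_XsubC // mulrCA [LHS]mulrC mulr_sumr; congr (_ * _).
- by rewrite uE mxtrace_conj_diag //; apply: eq_bigr => i _; rewrite mxE.
rewrite !uE mul_conj_diag // mxtrace_conj_diag //; apply: eq_bigr => i _.
by rewrite !mxE.
Qed.

Let tame_tr a : tame (fun U => \tr (u_ a U)).
Proof. by apply: tame_sum => i; apply: tame_resolvent. Qed.

Let tameF : tame F. Proof. exact: tame_cp_prod. Qed.

Let L_pr : L pr = L F.
Proof. by apply: eq_wmean => U DU; rewrite prE. Qed.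

Let tame_strace : tame (fun U => F U * \sum_a \tr (u_ a U)).
Proof. by apply: tameM => //; apply: tame_sum. Qed.

Lemma wmean_degree :
  L (fun U => pr U * \sum_a t_ a U) = N%:R * (M%:R - m%:R) * L pr.
Proof.
rewrite (eq_wmean haar m (g := fun U => (M%:R * N%:R) * F U + F U * \sum_a \tr (u_ a U))).
  rewrite (wmeanD haar m) //; last by apply: tameM => //; apply: tame_cst.
  rewrite (wmeanZ haar m) // (mean_trace hhaar m n_gt1) L_pr -mulrDl; congr (_ * _).
  by rewrite mulrBr [N%:R * M%:R]mulrC [N%:R * m%:R]mulrC.
move=> U DU; rewrite prE //; have [z [yz tE uE _]] := spectrum DU.
rewrite [_ * F U]mulrC -mulrDr; congr (_ * _).
under eq_bigr => a _ do rewrite tE log_deriv_sum // -uE.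
by rewrite big_split sumr_const card_ord mulr_natl.
Qed.

Lemma wmean_pairs :
  L (fun U => pr U * \sum_a \sum_(b | b != a)
    (t_ a U * t_ b U - 2 * t_ a U * (y a / (y a - y b)))) =
  (N%:R * (N%:R + 1) * (m%:R * (m%:R - 1)) +
   2 * N%:R * (M%:R - 1) * (M%:R - m%:R) * N%:R -
   M%:R * (M%:R - 1) * N%:R * (N%:R + 1)) * L pr.
Proof.
pose W U := \sum_a \sum_(b | b != a) (\tr (u_ a U) * \tr (u_ b U) + \tr (u_ a U *m u_ b U)).
have tameW : tame (fun U => F U * W U).
  apply: tameM => //; apply: tame_sum => a; apply: tame_sum => b.
  apply: tameD; first exact: tameM.
  apply: tame_sum => i; under eq_fun do rewrite mxE; apply: tame_sum => j.
  by apply: tameM; apply: tame_resolvent.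
have tame_tsum : tame (fun U => pr U * \sum_a t_ a U).
  apply: (@eq_tame _ _ (fun U => (M%:R * N%:R) * F U + F U * \sum_a \tr (u_ a U))); last first.
    by apply: tameD => //; apply: tameM => //; apply: tame_cst.
  move=> U DU; rewrite prE //; have [z [yz tE uE _]] := spectrum DU.
  rewrite [_ * F U]mulrC -mulrDr; congr (_ * _).
  under [RHS]eq_bigr => a _ do rewrite tE log_deriv_sum // -uE.
  by rewrite big_split sumr_const card_ord mulr_natl.
have tame_pr : tame pr by apply: (eq_tame _ tameF) => U DU; rewrite prE.
rewrite (eq_wmean haar m (g := fun U => F U * W U +
   ((2 * N%:R * (M%:R - 1)) * (pr U * \sum_a t_ a U) +
    (- (M%:R * (M%:R - 1) * (N%:R * (N%:R + 1)))) * pr U))).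
  have tame_r : tame (fun U => (2 * N%:R * (M%:R - 1)) * (pr U * \sum_a t_ a U)).
    by apply: tameM => //; apply: tame_cst.
  have tame_c : tame (fun U => (- (M%:R * (M%:R - 1) * (N%:R * (N%:R + 1)))) * pr U).
    by apply: tameM => //; apply: tame_cst.
  rewrite (wmeanD haar m) //; last exact: tameD.
  rewrite (wmeanD haar m) // (wmeanZ haar m) // (wmeanZ haar m) // wmean_degree.
  rewrite (mean_trace_pairs hhaar m n_gt1) -L_pr; move: (L pr) => g.
  exact: distr_kappa.
move=> U DU; have [z [yz tE uE uuE]] := spectrum DU.
have -> : \sum_a \sum_(b | b != a) (t_ a U * t_ b U - 2 * t_ a U * (y a / (y a - y b))) =
   \sum_a \sum_(b | b != a) ((\sum_i y a / (y a - z i)) * (\sum_i y b / (y b - z i)) -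
      2 * (\sum_i y a / (y a - z i)) * (y a / (y a - y b))).
  by apply: eq_bigr => a _; apply: eq_bigr => b _; rewrite !tE.
rewrite log_deriv_pairs // !(prE DU).
have -> : \sum_a t_ a U = \sum_a \sum_i y a / (y a - z i) by apply: eq_bigr.
have -> : W U = \sum_a \sum_(b | b != a) ((\sum_i z i / (y a - z i)) * (\sum_i z i / (y b - z i)) +
    \sum_i (z i / (y a - z i)) * (z i / (y b - z i))).
  by apply: eq_bigr => a _; apply: eq_bigr => b _; rewrite uuE !uE.
by rewrite [LHS]distr_pairs.
Qed.
End Node.

Theorem haar_toeplitz_char_poly (y : 'I_M -> C) : (0 < N)%N -> (m <= M)%N ->
  L (fun U => \prod_a (char_poly U).[y a]) =
  (-1) ^+ (M * N) * toeplitz N (conv (\prod_a ('X - (y a)%:P)) (delta_seq C m)).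
Proof.
move=> N0 mM; have := @functional_toeplitz C _ tame L (@tame_cst R N) (@tameD R N) (@tameM R N)
  (wmeanD haar m) (wmeanZ haar m) N m M q N0 mM size_q lead_q tame_q wmean_q0 q_neq0.
move=> h; rewrite -h.
- by apply: eq_wmean => U DU; apply: eq_bigr => a _; rewrite qE.
- by move=> x [injx /fin_all_exists2[n n1 xE]]; exact: (wmean_degree n1 xE).
by move=> x [injx /fin_all_exists2[n n1 xE]]; exact: (wmean_pairs injx n1 xE).
Qed.
End HaarToeplitz.

(** * Rational symbols *)

Section UniformConvergence.
Variables (C : numClosedFieldType) (I : Type) (F : set_system I).
Context {FF : Filter F}.

(** A bounded limit is required so that products converge. An arbitrary filter serves truncation as
    well as perturbation. *)
Definition uniform_cvg (X : Type) (A : set X) (f : I -> X -> C) (g : X -> C) :=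
  (exists2 B, 0 <= B & forall x, A x -> `|g x| <= B) /\
  forall e, 0 < e -> \forall t \near F, forall x, A x -> `|f t x - g x| <= e.

Section Domain.
Variables (X : Type) (A : set X).
Local Notation ucvg := (@uniform_cvg X A).

Lemma ucvg_comp (Y : Type) (D : set Y) (h : Y -> X) f g : (forall y, D y -> A (h y)) ->
  ucvg f g -> uniform_cvg D (fun t y => f t (h y)) (fun y => g (h y)).
Proof.
move=> hA [[B B0 gB] fg]; split; first by exists B => // y /hA/gB.
by move=> e /fg; apply: filterS => t ft y /hA/ft.
Qed.

Lemma ucvg_bounded g (B : C) : 0 <= B -> (forall x, A x -> `|g x| <= B) -> ucvg (fun=> g) g.
Proof.
move=> B0 gB; split; first by exists B.
by move=> e e0; apply: nearW => t x _; rewrite subrr normr0 ltW.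
Qed.

Lemma ucvg_cst c : ucvg (fun _ _ => c) (fun=> c).
Proof. by apply: (ucvg_bounded (normr_ge0 c)). Qed.

Lemma ucvgD f g f' g' : ucvg f g -> ucvg f' g' ->
  ucvg (fun t x => f t x + f' t x) (fun x => g x + g' x).
Proof.
move=> [[B B0 gB] fg] [[B' B'0 gB'] fg']; split.
  exists (B + B') => [|x Ax]; first exact: addr_ge0.
  by rewrite (le_trans (ler_normD _ _)) // lerD ?gB ?gB'.
move=> e e0; have e2 : 0 < e / 2 by rewrite divr_gt0.
have := fg _ e2; have := fg' _ e2; apply: filterS2 => t h' h x Ax.
rewrite opprD addrACA (splitr e) (le_trans (ler_normD _ _)) // lerD //; [exact: h|exact: h'].
Qed.

Lemma ucvgM f g f' g' : ucvg f g -> ucvg f' g' ->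
  ucvg (fun t x => f t x * f' t x) (fun x => g x * g' x).
Proof.
move=> [[B B0 gB] fg] [[B' B'0 gB'] fg']; split.
  exists (B * B') => [|x Ax]; first exact: mulr_ge0.
  by rewrite normrM ler_pM ?gB ?gB'.
move=> e e0; pose K := 1 + (B + B'); have K0 : 0 < K by rewrite ltr_pwDl ?addr_ge0.
have s0 : 0 < e + K by rewrite addr_gt0.
(* Satisfies [d <= 1], so that the product of the two errors is at most [d], and [d * K <= e]. *)
pose d := e / (e + K); have d0 : 0 < d by rewrite divr_gt0.
have d1 : d <= 1 by rewrite ler_pdivrMr // mul1r lerDl ltW.
have dK : d * K <= e by rewrite /d mulrAC ler_pdivrMr // ler_pM2l // lerDr ltW.
have := fg _ d0; have := fg' _ d0; apply: filterS2 => t h' h x Ax.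
have -> : f t x * f' t x - g x * g' x =
    (f t x - g x) * (f' t x - g' x) + ((f t x - g x) * g' x + g x * (f' t x - g' x)) by ring.
apply: le_trans dK; have -> : d * K = d + (d * B + d * B') by rewrite /K !mulrDr mulr1.
apply: le_trans (ler_normD _ _) _; rewrite normrM; apply: lerD.
  by rewrite -[d]mulr1 ler_pM ?(h x Ax) // (le_trans (h' x Ax)).
apply: le_trans (ler_normD _ _) _; rewrite !normrM [d * B + _]addrC; apply: lerD.
  by rewrite ler_pM ?h ?gB'.
by rewrite mulrC ler_pM ?h' ?gB.
Qed.

Lemma ucvg_sum (J : Type) (s : seq J) (P : pred J) (f : J -> I -> X -> C) g :
  (forall j, P j -> ucvg (f j) (g j)) ->
  ucvg (fun t x => \sum_(j <- s | P j) f j t x) (fun x => \sum_(j <- s | P j) g j x).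
Proof.
move=> h; elim: s => [|j s IH].
  under eq_fun do under eq_fun do rewrite big_nil; under [X in ucvg _ X]eq_fun do rewrite big_nil.
  exact: ucvg_cst.
under eq_fun do under eq_fun do rewrite big_cons; under [X in ucvg _ X]eq_fun do rewrite big_cons.
by case Pj: (P j); last exact: IH; apply: ucvgD => //; apply: h.
Qed.

Lemma ucvg_prod (J : Type) (s : seq J) (P : pred J) (f : J -> I -> X -> C) g :
  (forall j, P j -> ucvg (f j) (g j)) ->
  ucvg (fun t x => \prod_(j <- s | P j) f j t x) (fun x => \prod_(j <- s | P j) g j x).
Proof.
move=> h; elim: s => [|j s IH].
  under eq_fun do under eq_fun do rewrite big_nil; under [X in ucvg _ X]eq_fun do rewrite big_nil.
  exact: ucvg_cst.
under eq_fun do under eq_fun do rewrite big_cons; under [X in ucvg _ X]eq_fun do rewrite big_cons.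
by case Pj: (P j); last exact: IH; apply: ucvgM => //; apply: h.
Qed.

Lemma ucvgV f g (l : C) : 0 < l -> (forall x, A x -> l <= `|g x|) -> ucvg f g ->
  ucvg (fun t x => (f t x)^-1) (fun x => (g x)^-1).
Proof.
move=> l0 lg [_ fg]; split.
  exists l^-1 => [|x Ax]; first by rewrite invr_ge0 ltW.
  by rewrite normfV lef_pV2 ?lg // posrE (lt_le_trans l0) ?lg.
move=> e e0; pose s := 1 + e * l; have s0 : 0 < s by rewrite ltr_pwDl ?mulr_ge0 ?ltW.
(* Satisfies [d <= l / 2], which keeps [f t x] away from 0, and [d <= e * (l * (l / 2))], which
   bounds the quotient. *)
pose d := l / 2 * (e * l / s).
have d0 : 0 < d by rewrite !(mulr_gt0, invr_gt0).
have dl : d <= l / 2.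
  by rewrite -[leRHS]mulr1 ler_pM2l ?divr_gt0 // ler_pdivrMr // mul1r lerDr.
have de : d <= e * (l * (l / 2)).
  rewrite /d [leRHS](_ : _ = l / 2 * (e * l)); last by ring.
  have el : 0 <= e * l by rewrite mulr_ge0 // ltW.
  by rewrite ler_pM2l ?divr_gt0 // ler_pdivrMr // ler_peMr // lerDl.
have := fg _ d0; apply: filterS => t h x Ax.
have g0 : 0 < `|g x| by rewrite (lt_le_trans l0) ?lg.
have fl : l / 2 <= `|f t x|.
  have : `|g x| <= `|f t x| + l / 2.
    rewrite -[g x](subrK (f t x)) (le_trans (ler_normD _ _)) // addrC lerD2l distrC.
    by rewrite (le_trans (h x Ax)).
  rewrite -lerBlDr; apply: le_trans; rewrite lerBrDr -splitr; exact: lg.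
have f0 : 0 < `|f t x| by rewrite (lt_le_trans _ fl) ?divr_gt0.
have -> : (f t x)^-1 - (g x)^-1 = (g x - f t x) / (g x * f t x).
  by move: g0 f0; rewrite !normr_gt0 => ? ?; field; apply/andP.
rewrite normf_div distrC normrM ler_pdivrMr ?mulr_gt0 //.
apply: le_trans (h x Ax) _; apply: le_trans de _; rewrite ler_pM2l //.
have l0' := ltW l0; by apply: ler_pM; rewrite ?divr_ge0 // lg.
Qed.
End Domain.
End UniformConvergence.

(** * Determinants of symbols and Heine-Szego for Laurent polynomials *)

Section DetSymbol.
Variables (R : realType) (N : nat).
Local Notation C := (cplx R).
Variable haar : probability (borelMx R N) R.
Hypothesis hhaar : is_unitary_haar haar.
Local Notation D := (@unitary_group R N).
Local Notation tame := (@tame R N).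
Local Notation J := (haar_mean haar).
Let circle : set C := [set z | `|z| = 1].

(** Unique factorization of the characteristic polynomial identifies the chosen list of eigenvalues,
    up to order, with the spectral diagonal. *)
Lemma det_symbol_spectrum (U : 'M[C]_N) : D U -> exists z : 'I_N -> C,
  [/\ forall i, `|z i| = 1, char_poly U = \prod_i ('X - (z i)%:P),
      \det U = \prod_i z i & forall phi, det_symbol phi U = \prod_i phi (z i)].
Proof.
move=> DU; have [P [z [uP eU z1]]] := unitary_spectrum DU.
have cp := char_poly_spectrum uP eU; exists (z 0); split=> // [|phi].
  by rewrite {1}eU !det_mulmx det_inv mulrAC mulVr ?mul1r -?unitmxE // det_diag.
rewrite /det_symbol /eigenvalues; case: closed_field_poly_normal => r /=.
rewrite (monicP (char_poly_monic U)) scale1r cp => e.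
have : perm_eq r [seq z 0 i | i <- enum 'I_N].
  by apply: prod_XsubC_eq; rewrite -e big_map big_enum.
by move/(perm_big _) ->; rewrite big_map big_enum.
Qed.

Lemma det_symbolM (U : 'M[C]_N) f g :
  det_symbol (fun z => f z * g z) U = det_symbol f U * det_symbol g U.
Proof. exact: big_split. Qed.

Definition tame_symbol (f : C -> C) := tame (det_symbol f).

Lemma tame_symbolM f g :
  tame_symbol f -> tame_symbol g -> tame_symbol (fun z => f z * g z).
Proof.
by move=> tf tg; apply: (eq_tame _ (tameM tf tg)) => U _; rewrite -det_symbolM.
Qed.

Lemma tame_symbolV f (e : C) : 0 < e -> (forall z, `|z| = 1 -> e <= `|f z|) ->
  tame_symbol f -> tame_symbol (fun z => (f z)^-1).
Proof.
move=> e0 ef tf; rewrite /tame_symbol.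
rewrite (_ : @det_symbol C N _ = fun U => (det_symbol f U)^-1); last first.
  by apply/funext => U; rewrite /det_symbol prodfV.
have eE : e = ((complex.Re e)%:C)%C by rewrite RRe_real // gtr0_real.
have re0 : 0 < complex.Re e by move: e0; rewrite {1}eE ltcR.
apply: (tameV (e := complex.Re e ^+ N)) => //; first by rewrite exprn_gt0.
move=> U /det_symbol_spectrum[z [z1 _ _ ->]].
rewrite rmorphXn /= -eE -[N in _ ^+ N]card_ord -prodr_const normr_prod.
by apply: ler_prod => i _; rewrite ltW //= ef.
Qed.

Lemma eq_tame_symbol f g : (forall z, `|z| = 1 -> f z = g z) ->
  tame_symbol f -> tame_symbol g.
Proof.
move=> e; apply: eq_tame => U /det_symbol_spectrum[z [z1 _ _ h]].
by rewrite !h; apply: eq_bigr => i _; apply: e.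
Qed.

Lemma tame_symbol_prod (I : Type) (s : seq I) (f : I -> C -> C) :
  (forall i, tame_symbol (f i)) -> tame_symbol (fun z => \prod_(i <- s) f i z).
Proof.
move=> h; elim: s => [|i s IH].
  under eq_fun do rewrite big_nil.
  apply: (@eq_tame _ _ (fun=> 1)); last exact: tame_cst.
  by move=> U _; rewrite /det_symbol big1.
by under eq_fun do rewrite big_cons; apply: tame_symbolM.
Qed.

(** On the circle the inverse is the conjugate, so the product over the eigenvalues is the conjugate
    of the determinant. *)
Lemma tame_symbol_inv : tame_symbol (fun z => z^-1).
Proof.
apply: (@eq_tame _ _ (fun U => (\det U)^*)); last first.
  by apply: tameJ; apply: tame_det => i j; apply: tame_entry.
move=> U /det_symbol_spectrum[z [z1 _ -> ->]]; rewrite rmorph_prod.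
by apply: eq_bigr => i _; rewrite [RHS]invC_norm z1 expr1n invr1 mul1r.
Qed.

(** Symmetry of the resultant: exchanging roots of [P] and eigenvalues of [U] costs one sign for
    each pair. *)
Lemma det_symbol_poly (P : {poly C}) M (y : 'I_M -> C) (l : C) U : D U ->
  P = l *: \prod_a ('X - (y a)%:P) ->
  det_symbol (fun z => P.[z]) U =
  l ^+ N * ((-1) ^+ (M * N) * \prod_a (char_poly U).[y a]).
Proof.
move=> /det_symbol_spectrum[z [z1 cp _ ->]] ->.
under eq_bigr => i _ do rewrite hornerZ horner_prod.
rewrite big_split prodr_const card_ord /=; congr (_ * _).
rewrite exchange_big /= mulnC exprM.
have -> : (-1) ^+ N ^+ M = \prod_(a < M) (-1) ^+ N :> C by rewrite prodr_const card_ord.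
rewrite -big_split; apply: eq_bigr => a _ /=.
rewrite cp horner_prod -[N in _ ^+ N]card_ord -prodr_const -big_split.
by apply: eq_bigr => i _; rewrite !hornerXsubC /= mulN1r opprB.
Qed.

Lemma poly_factors (P : {poly C}) : P != 0 ->
  exists y : 'I_(size P).-1 -> C, P = lead_coef P *: \prod_a ('X - (y a)%:P).
Proof.
move=> P0; have [r e] := closed_field_poly_normal P.
have sz : size r = (size P).-1.
  by rewrite [in RHS]e size_scale ?lead_coef_eq0 // size_prod_XsubC.
exists (fun a => r`_a); rewrite {1}e; congr (_ *: _).
by rewrite (big_nth 0) sz big_mkord.
Qed.

Lemma tame_symbol_poly (P : {poly C}) : tame_symbol (fun z => P.[z]).
Proof.
have [->|/poly_factors[y e]] := eqVneq P 0.
  under eq_fun do rewrite horner0.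
  apply: (@eq_tame _ _ (fun=> 0 ^+ N)); last exact: tame_cst.
  move=> U /det_symbol_spectrum[z [_ _ _ ->]].
  by rewrite prodr_const card_ord.
apply: eq_tame; first by move=> U DU; rewrite (det_symbol_poly DU e).
apply: tameM; first exact: tame_cst.
apply: tameM; first exact: tame_cst.
by apply: tame_prod => a; apply: tame_horner_char_poly.
Qed.

Lemma haar_mean_cvg (I : Type) (F : set_system I) (FF : Filter F)
    (f : I -> 'M[C]_N -> C) g :
  (\forall t \near F, tame (f t)) -> tame g -> uniform_cvg F D f g ->
  J (f t) @[t --> F] --> J g.
Proof.
move=> tf tg [_ fg]; apply/cvgrPdist_le => e e0.
have e2 : 0 < e / 2 by rewrite divr_gt0.
have eE : e = ((complex.Re e)%:C)%C by rewrite RRe_real // gtr0_real.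
have e2E : e / 2 = ((complex.Re e / 2)%:C)%C by rewrite [X in X / 2]eE rmorphM fmorphV rmorph_nat.
have := fg _ e2; move: tf; apply: filterS2 => t tf h.
have tN : tame (fun U => -1 * f t U) by apply: tameM => //; apply: tame_cst.
have -> : J g - J (f t) = J (fun U => g U + -1 * f t U).
  by rewrite haar_meanD // haar_meanZ // mulN1r.
have -> : e = ((2 * (complex.Re e / 2))%:C)%C by rewrite mulrC divfK // pnatr_eq0.
apply: haar_mean_le => //; first exact: tameD.
by move=> U DU; rewrite mulN1r distrC -e2E h.
Qed.

Lemma haar_mean_symbol_cvg (I : Type) (F : set_system I) (FF : Filter F)
    (f : I -> C -> C) g :
  (\forall t \near F, tame_symbol (f t)) -> tame_symbol g -> uniform_cvg F circle f g ->
  J (det_symbol (f t)) @[t --> F] --> J (det_symbol g).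
Proof.
move=> tf tg fg; apply: haar_mean_cvg => //.
pose T : set ('I_N -> C) := [set z | forall i, circle (z i)].
have [[B B0 gB] h] : uniform_cvg F T (fun t z => \prod_i f t (z i)) (fun z => \prod_i g (z i)).
  by apply: ucvg_prod => i _; apply: ucvg_comp fg => z.
split.
  by exists B => // U /det_symbol_spectrum[z [z1 _ _ ->]]; apply: gB.
move=> e /h; apply: filterS => t ht U /det_symbol_spectrum[z [z1 _ _ e']].
by rewrite !e'; apply: ht.
Qed.

(** After factorization of [P], the sign of [det_symbol_poly] cancels that of
    [haar_toeplitz_char_poly]. *)
Theorem haar_toeplitz (P : {poly C}) (m : nat) : (0 < N)%N -> (m < size P)%N ->
  J (det_symbol (fun z => z^-1 ^+ m * P.[z])) = toeplitz N (conv P (delta_seq C m)).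
Proof.
move=> N0 mP; have P0 : P != 0 by rewrite -size_poly_gt0 (leq_ltn_trans _ mP).
have [y e] := poly_factors P0; move: y e; set M := (size P).-1; set l := lead_coef P => y e.
have mM : (m <= M)%N by rewrite -ltnS prednK // size_poly_gt0.
rewrite e; transitivity (wmean haar m (fun U => l ^+ N * ((-1) ^+ (M * N)) * \prod_a (char_poly U).[y a])).
  apply: eq_haar_mean => U DU; rewrite det_symbolM -e (det_symbol_poly DU e) -[l ^+ N * _ * _]mulrA.
  congr (_ * _); have [z [z1 _ -> ->]] := det_symbol_spectrum DU.
  rewrite rmorph_prod -prodrXl; apply: eq_bigr => i _.
  by rewrite invC_norm z1 expr1n invr1 mul1r.
rewrite (wmeanZ haar m); last by apply: tame_prod => a; apply: tame_horner_char_poly.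
rewrite (haar_toeplitz_char_poly hhaar) // mulrA -[_ * _ * (-1) ^+ _]mulrA -exprD addnn.
rewrite -mul2n exprM sqrrN expr1n expr1n mulr1 /toeplitz -detZ; congr (\det _).
by apply/matrixP => i j; rewrite !mxE convZ.
Qed.
End DetSymbol.

(** * Laurent expansions on the circle and their truncations *)

Section PoleSums.
Variable F : numFieldType.

(** A finite geometric sum: only the half of the range on the side of the pole contributes. *)
Lemma pole_partial_sum (out : bool) (p z : F) n : z != 0 -> z != p -> (out -> p != 0) ->
  \sum_(j < n + n) pole_seq out p (j%:Z - n%:Z) * (z^-1 ^+ n * z ^+ j) =
  (1 - (if out then z / p else p / z) ^+ n) / (z - p).
Proof.
move=> z0 zp p0; have d0 : z - p != 0 by rewrite subr_eq0.
apply: (canRL (mulfK d0)); rewrite big_split_ord mulrDl /= !mulr_suml.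
have zn : z ^+ n != 0 by rewrite expf_neq0.
case: out p0 => [/(_ isT) p0|_].
  rewrite [X in X + _]big1 ?add0r => [|j _]; last first.
    by rewrite /pole_seq (_ : (0 <= j%:Z - n%:Z) = false) ?oppr0 ?mul0r //; have := ltn_ord j; lia.
  have pn : p ^+ n != 0 by rewrite expf_neq0.
  apply: (mulIf pn); rewrite mulrBl mul1r expr_div_n divfK // subrXX mulr_sumr mulr_suml.
  apply: eq_bigr => j _; rewrite /pole_seq (_ : (n + j)%N%:Z - n%:Z = j%:Z); last lia.
  have -> : p ^ (- j%:Z - 1) = (p ^+ j.+1)^-1.
    by rewrite exprnN; congr (_ ^ _); lia.
  have -> : p ^+ n = p ^+ (n.-1 - j) * p ^+ j.+1.
    by rewrite -exprD; congr (_ ^+ _); have := ltn_ord j; lia.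
  have -> : z^-1 ^+ n * z ^+ (n + j) = z ^+ j by rewrite exprD exprVn mulKf.
  have pj : p ^+ j.+1 != 0 by rewrite expf_neq0.
  rewrite (_ : (0 <= j%:Z) = true) // mulr1n.
  move: (p ^+ j.+1) pj (p ^+ (n.-1 - j)) (z ^+ j) => x x0 w v; by field.
rewrite [X in _ + X]big1 ?addr0 => [|j _]; last first.
  by rewrite /pole_seq (_ : ((n + j)%N%:Z - n%:Z < 0) = false) ?mul0r //; lia.
apply: (mulIf zn); rewrite mulrBl mul1r expr_div_n divfK // subrXX mulr_sumr mulr_suml.
rewrite [RHS](reindex_inj rev_ord_inj) /=; apply: eq_bigr => j _.
have nj := ltn_ord j.
rewrite /pole_seq (_ : (j%:Z - n%:Z < 0) = true) ?mulr1n; last lia.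
have -> : p ^ (- (j%:Z - n%:Z) - 1) = p ^+ (n - j.+1).
  by rewrite exprnP; congr (_ ^ _); lia.
have -> : (n.-1 - (n - j.+1))%N = j by lia.
rewrite exprVn; move: (z ^+ n) zn (z ^+ j) (p ^+ _) => x x0 v w; by field.
Qed.
End PoleSums.

Section Laurent.
Variable R : realType.
Local Notation C := (cplx R).
Let circle : set C := [set z | `|z| = 1].
Local Notation ucvg := (@uniform_cvg C nat (\oo) C circle).

Lemma near_expr_le (q e : C) : `|q| < 1 -> 0 < e ->
  \forall n \near \oo, `|q| ^+ n <= e.
Proof.
move=> q1 e0.
have [d eE] : exists d : R, e = (d%:C)%C.
  by exists (complex.Re e); rewrite RRe_real // gtr0_real.
have [r qE] : exists r : R, `|q| = (r%:C)%C.
  by exists (complex.Re `|q|); rewrite RRe_real // normr_real.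
move: (normr_ge0 q) q1 e0; rewrite qE eE => r0 r1 d0.
move: r0 r1 d0; rewrite lecR !ltcR => r0 r1 d0.
have r1' : `|r| < 1 by rewrite ger0_norm.
have /cvgr0Pnorm_le/(_ _ d0) := cvg_expr r1'; apply: filterS => n.
by rewrite ger0_norm ?exprn_ge0 // -rmorphXn lecR.
Qed.

Lemma eq_ucvg f g f' g' : (forall n z, circle z -> f n z = f' n z) ->
  (forall z, circle z -> g z = g' z) -> ucvg f g -> ucvg f' g'.
Proof.
move=> ef eg [[B B0 h] fg]; split; first by exists B => // z cz; rewrite -eg ?h.
by move=> e /fg; apply: filterS => n hn z cz; rewrite -eg // -ef ?hn.
Qed.

Lemma ucvg_expr (f : C -> C) (q : C) : `|q| < 1 -> (forall z, circle z -> `|f z| = `|q|) ->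
  ucvg (fun n z => f z ^+ n) (fun=> 0).
Proof.
move=> q1 fq; split; first by exists 0 => // z _; rewrite normr0.
move=> e e0; have := near_expr_le q1 e0; apply: filterS => n h z cz.
by rewrite subr0 normrX fq.
Qed.

(** The powers from [-n] to [n - 1], with [z^-n] split off to match the symbols of
    [haar_toeplitz]. *)
Definition laurent_sum (u : int -> C) n (z : C) :=
  \sum_(j < n + n) u (j%:Z - n%:Z) * (z^-1 ^+ n * z ^+ j).

Definition laurent (u : int -> C) (g : C -> C) := ucvg (laurent_sum u) g.

Lemma circle_neq0 z : circle z -> z != 0.
Proof. by rewrite -normr_eq0 => ->; apply: oner_neq0. Qed.

Lemma circle_dist (p z : C) : circle z -> `|1 - `|p| | <= `|z - p|.
Proof. by move=> <-; apply: ler_dist_dist. Qed.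

(** The remainder of the geometric sum is an [n]-th power of a function with constant modulus below
    1 on the circle. *)
Lemma laurent_pole (out : bool) p : (if out then 1 < `|p| else `|p| < 1) ->
  laurent (pole_seq out p) (fun z => (z - p)^-1).
Proof.
move=> hp.
have d0 : 0 < `|1 - `|p| |.
  rewrite normr_gt0 subr_eq0 eq_sym; case: out hp => [/gt_eqF->|/lt_eqF->] //.
have zp z : circle z -> z - p != 0.
  by move=> cz; rewrite -normr_gt0 (lt_le_trans d0) ?circle_dist.
pose f z : C := if out then z / p else p / z.
pose q : C := if out then p^-1 else p.
have fq z : circle z -> `|f z| = `|q|.
  by move=> cz; rewrite /f /q; case: (out); rewrite normf_div ?normfV cz ?invr1 ?mulr1 ?mul1r.
have q1 : `|q| < 1.
  by rewrite /q; case: (out) hp => // p1; rewrite normfV invf_lt1 // (lt_trans _ p1).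
have Vg : ucvg (fun _ z => (z - p)^-1) (fun z => (z - p)^-1).
  apply: (@ucvg_bounded _ _ _ _ _ _ _ (`|1 - `|p| |^-1)); first by rewrite invr_ge0 ltW.
  move=> z cz; have zp0 : 0 < `|z - p| by rewrite normr_gt0 zp.
  by rewrite normfV lef_pV2 ?circle_dist.
have h : ucvg (fun n z => (1 + -1 * f z ^+ n) / (z - p)) (fun z => (1 + -1 * 0) / (z - p)).
  by apply: ucvgM Vg; apply: ucvgD; [apply: ucvg_cst|apply: ucvgM; [apply: ucvg_cst|apply: ucvg_expr fq]].
apply: (eq_ucvg _ _ h) => [n z cz|z _]; last by rewrite mulr0 addr0 mul1r.
have z0 := circle_neq0 cz; rewrite mulN1r /laurent_sum pole_partial_sum //.
- by rewrite -subr_eq0 zp.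
move=> o; rewrite o in hp; by rewrite -normr_gt0 (lt_trans _ hp).
Qed.

Lemma laurentD u v f g : laurent u f -> laurent v g ->
  laurent (fun j => u j + v j) (fun z => f z + g z).
Proof.
move=> hu hv; apply: (eq_ucvg _ _ (ucvgD hu hv)) => [n z _|//]; rewrite /laurent_sum -big_split.
by apply: eq_bigr => j _; rewrite /= mulrDl.
Qed.

Lemma laurentZ c u f : laurent u f -> laurent (fun j => c * u j) (fun z => c * f z).
Proof.
move=> hu; apply: (eq_ucvg _ _ (ucvgM (ucvg_cst circle c) hu)) => [n z _|//].
by rewrite /laurent_sum mulr_sumr; apply: eq_bigr => j _; rewrite mulrA.
Qed.

Lemma laurent1 : laurent (fun j => (j == 0)%:R) (fun=> 1).
Proof.
have [b h] := @ucvg_cst C nat \oo _ C circle 1; split => // e e0.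
near=> n => z cz; have n0 : (0 < n)%N by near: n; exists 1%N.
have -> : laurent_sum (fun j => (j == 0)%:R) n z = 1.
  rewrite /laurent_sum big_split_ord /= big1 ?add0r => [|j _]; last first.
    by rewrite (_ : (_ == 0) = false) ?mul0r //; have := ltn_ord j; lia.
  rewrite (bigD1 (Ordinal n0)) //= big1 ?addr0 => [|j].
    by rewrite addn0 subrr eqxx mul1r -exprMn mulVf ?expr1n ?circle_neq0.
  rewrite -val_eqE /= => j0; rewrite (_ : (_ == 0) = false) ?mul0r //; lia.
by rewrite subrr normr0 ltW.
Unshelve. all: by end_near.
Qed.

Lemma laurent0 : laurent (fun=> 0) (fun=> 0).
Proof.
apply: (eq_ucvg _ _ (ucvg_cst circle 0)) => [n z _|//].
by rewrite /laurent_sum big1 // => j _; rewrite mul0r.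
Qed.

(** The partial fraction identity is the Lagrange interpolation of the constant 1 divided by the
    full product. *)
Lemma laurent_pole_sum n (p : 'I_n -> C) (out : 'I_n -> bool) : injective p ->
  (forall r, if out r then 1 < `|p r| else `|p r| < 1) ->
  laurent (pole_sum p out) (fun z => (\prod_(s < n) (z - p s))^-1).
Proof.
move=> injp hp; rewrite /pole_sum.
have [n0|n0] := eqVneq n 0%N.
  apply: (eq_ucvg _ _ laurent1) => // z _; rewrite big1 ?invr1 // => s.
  by have := leq_ltn_trans (leq0n s) (ltn_ord s); rewrite n0.
have zp z s : circle z -> z - p s != 0.
  move=> cz; rewrite subr_eq0; apply: contraTneq (hp s) => <-.
  by rewrite cz ltxx; case: (out s).
have h : laurent (fun j => \sum_r (omit p r).[p r]^-1 * pole_seq (out r) (p r) j)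
    (fun z => \sum_r (omit p r).[p r]^-1 * (z - p r)^-1).
  elim: (index_enum _) => [|r s IH].
    by under eq_fun do rewrite big_nil; under [X in laurent _ X]eq_fun do rewrite big_nil; apply: laurent0.
  under eq_fun do rewrite big_cons; under [X in laurent _ X]eq_fun do rewrite big_cons.
  by apply: laurentD => //; apply: laurentZ; apply: laurent_pole.
apply: (eq_ucvg _ _ h) => // z cz.
have sz1 : (size (1 : {poly C})%R <= n)%N by rewrite size_poly1 lt0n.
have := congr1 (horner^~ z) (lagrange_interp injp sz1); rewrite hornerC horner_sum => e.
have pi0 : \prod_(s < n) (z - p s) != 0 by apply/prodf_neq0 => s _; apply: zp.
apply: (mulIf pi0); rewrite mulVf //.
rewrite [RHS]e mulr_suml; apply: eq_bigr => r _; rewrite hornerZ hornerC div1r -mulrA.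
congr (_ * _); rewrite /omit horner_prod (bigD1 r) //= mulKf ?zp //.
by apply: eq_bigr => s _; rewrite hornerXsubC.
Qed.
End Laurent.

Section Truncation.
Variable F : numFieldType.

(* The term of degree [2n] keeps the degree of the truncation at least [n]. *)
Definition truncation (u : int -> F) n : {poly F} :=
  \poly_(j < n + n) u (j%:Z - n%:Z) + (2^-1 ^+ n) *: 'X^(n + n).

Lemma size_truncation u n : size (truncation u n) = (n + n).+1.
Proof.
rewrite /truncation addrC size_polyDl ?size_scale ?size_polyXn //.
  by rewrite ltnS size_poly.
Qed.

(** The shift by [n] is undone exactly, and the added top term lands at index [n], just outside the
    window. *)
Lemma conv_truncation u n (j : int) : - n%:Z <= j -> j < n%:Z ->
  conv (truncation u n) (delta_seq F n) j = u j.
Proof.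
move=> lo hi.
transitivity (conv (truncation u n) (fun i => (i == 0)%:R) (j + n%:Z)).
  by apply: eq_bigr => r _; rewrite /delta_seq; congr (_ * (_)%:R); lia.
rewrite conv_exp0; case e : (j + n%:Z) => [t|t]; last lia.
rewrite coefD coef_poly coefZ coefXn.
have -> : (t < n + n)%N by lia.
have -> : (t == n + n)%N = false by lia.
by rewrite mulr0 addr0; congr u; lia.
Qed.
End Truncation.

Section PoleSymbol.
Variables (R : realType) (N : nat).
Local Notation C := (cplx R).
Variable haar : probability (borelMx R N) R.
Hypothesis hhaar : is_unitary_haar haar.
Local Notation J := (haar_mean haar).
Local Notation ts := (@tame_symbol R N).
Let circle : set C := [set z | `|z| = 1].

Lemma truncation_cvg (u : int -> C) g : laurent u g ->
  uniform_cvg \oo circle (fun n z => z^-1 ^+ n * (truncation u n).[z]) g.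
Proof.
move=> hg.
have h2 : uniform_cvg \oo circle (fun n z => (2^-1 * z) ^+ n) (fun=> 0).
  apply: (@ucvg_expr R _ (2^-1)) => [|z cz]; last by rewrite normrM cz mulr1.
  by rewrite normfV normr_nat invf_lt1 ?ltr1n ?ltr0n.
have h : uniform_cvg \oo circle (fun n z => laurent_sum u n z + (2^-1 * z) ^+ n) (fun z => g z + 0).
  exact: ucvgD.
apply: (eq_ucvg _ _ h) => [n z cz|z _]; last by rewrite addr0.
have z0 : z != 0 by apply: circle_neq0.
rewrite hornerD horner_poly hornerZ hornerXn mulrDr; congr (_ + _).
  by rewrite mulr_sumr; apply: eq_bigr => j _; rewrite mulrCA.
by rewrite exprMn mulrCA exprD; congr (_ * _); rewrite mulrA -exprMn mulVf // expr1n mul1r.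
Qed.

Lemma tame_symbol_poles n (p : 'I_n -> C) : (forall r, `|p r| != 1) ->
  ts (fun z => (\prod_(s < n) (z - p s))^-1).
Proof.
move=> hp; under eq_fun do rewrite -prodfV; apply: tame_symbol_prod => s.
apply: (@tame_symbolV _ _ _ `|1 - `|p s| |) => [|z z1|].
- by rewrite normr_gt0 subr_eq0 eq_sym.
- exact: circle_dist.
apply: (eq_tame_symbol _ (tame_symbol_poly _ ('X - (p s)%:P))) => z _.
by rewrite hornerXsubC.
Qed.

(** The means converge by uniform convergence of the truncated symbols, while their Toeplitz
    determinants are eventually constant because only finitely many coefficients enter. *)
Theorem haar_mean_poles n (p : 'I_n -> C) (out : 'I_n -> bool) (P : {poly C}) :
    (0 < N)%N -> P != 0 -> injective p ->
    (forall r, if out r then 1 < `|p r| else `|p r| < 1) ->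
  J (det_symbol (fun z => P.[z] / \prod_(s < n) (z - p s))) =
  toeplitz N (conv P (pole_sum p out)).
Proof.
move=> N0 P0 injp hp; pose u := pole_sum p out.
pose f m z := z^-1 ^+ m * (P * truncation u m).[z].
have p1 r : `|p r| != 1.
  by have := hp r; case: (out r) => [/gt_eqF->|/lt_eqF->].
have tf m : ts (f m).
  apply: tame_symbolM; last exact: tame_symbol_poly.
  apply: (eq_tame_symbol _ (tame_symbol_prod (index_enum 'I_m) (fun=> tame_symbol_inv R N))) => z _.
  by rewrite prodr_const card_ord.
have cv : uniform_cvg \oo circle f (fun z => P.[z] / \prod_(s < n) (z - p s)).
  have hP : uniform_cvg \oo circle (fun (_ : nat) z => P.[z]) (fun z => P.[z]).
    under eq_fun do under eq_fun do rewrite horner_coef.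
    under [X in uniform_cvg _ _ _ X]eq_fun do rewrite horner_coef.
    apply: ucvg_sum => j _; apply: ucvgM; first exact: ucvg_cst.
    apply: (@ucvg_bounded _ _ _ _ _ _ _ 1) => // z cz.
    by rewrite normrX cz expr1n.
  apply: (eq_ucvg _ _ (ucvgM hP (truncation_cvg (laurent_pole_sum injp hp)))) => // m z _.
  by rewrite /f hornerM mulrCA.
have ts_lim : ts (fun z => P.[z] / \prod_(s < n) (z - p s)).
  by apply: tame_symbolM; [apply: tame_symbol_poly | apply: tame_symbol_poles].
have cvJ : J (det_symbol (f m)) @[m --> \oo] -->
    J (det_symbol (fun z => P.[z] / \prod_(s < n) (z - p s))).
  by apply: haar_mean_symbol_cvg => //; apply: nearW.
have : J (det_symbol (f m)) @[m --> \oo] --> toeplitz N (conv P u).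
  apply: cvg_near_cst; near=> m.
  (* The entries involve the indices [i - j - r] with [i, j < N] and [r < size P], all in the window
     of [conv_truncation] from here on. *)
  have Nm : (N + size P <= m)%N by near: m; exists (N + size P)%N.
  rewrite haar_toeplitz //; last first.
    rewrite size_mul // -?size_poly_eq0 size_truncation //= addnS /=.
    by move: P0; rewrite -size_poly_gt0; lia.
  congr (\det _); apply/matrixP => i j; rewrite !mxE convM.
  apply: convE => r hr; have := ltn_ord i; have := ltn_ord j => jN iN.
  have Nr : (N + r < m)%N by rewrite (leq_trans _ Nm) // ltn_add2l.
  by apply: conv_truncation; move: Nr jN iN; clear; lia.
move=> h; exact: (@cvg_unique C (@norm_hausdorff C C) _ _ _ _ cvJ h).
Unshelve. all: by end_near.
Qed.
End PoleSymbol.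

(** * The sum over swaps *)

Section HomogeneousSum.
Variables (C : numClosedFieldType) (k : nat).
Implicit Types (a b c d : 'rV[C]_k) (M : {set 'I_(k + k)}).

(* [u_s / v_s] runs through the [a_i] and the [b_j^-1]. *)
Definition ucoord a (s : 'I_(k + k)) : C := row_mx a (const_mx 1 : 'rV_k) 0 s.
Definition vcoord b (s : 'I_(k + k)) : C := row_mx (const_mx 1 : 'rV_k) b 0 s.

(** The summand with the reciprocals of the [a_i] and [b_j] cleared: it stays continuous when some
    of them vanish, since these parameters enter the denominator only through 2 by 2 determinants of
    coordinates. *)
Definition hterm N a b c d M : C :=
  (\prod_(s in M) (vcoord b s ^+ N * \prod_j (vcoord b s - ucoord a s * d 0 j))) *
  (\prod_(t in ~: M) (ucoord a t ^+ N * \prod_i (ucoord a t - c 0 i * vcoord b t))) /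
  ((\prod_(s in M) \prod_(t in ~: M) (ucoord a t * vcoord b s - ucoord a s * vcoord b t)) *
   \prod_i \prod_j (1 - c 0 i * d 0 j)).

Definition hsum N a b c d : C := \sum_(M : {set 'I_(k + k)} | #|M| == k) hterm N a b c d M.

Lemma coord_l a b i : (ucoord a (lshift k i) = a 0 i) * (vcoord b (lshift k i) = 1).
Proof. by rewrite /ucoord /vcoord !row_mxEl mxE. Qed.

Lemma coord_r a b j : (ucoord a (rshift k j) = 1) * (vcoord b (rshift k j) = b 0 j).
Proof. by rewrite /ucoord /vcoord !row_mxEr mxE. Qed.

(** Encodes [A - S + T^-1] among the [2 k] points [u_s / v_s]. *)
Definition join_sets (S T : {set 'I_k}) : {set 'I_(k + k)} :=
  finset (fun s => match fintype.split s with inl i => i \notin S | inr j => j \in T end).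

Lemma lshift_join S T i : (lshift k i \in join_sets S T) = (i \notin S).
Proof. by rewrite inE (unsplitK (inl i)). Qed.

Lemma rshift_join S T j : (rshift k j \in join_sets S T) = (j \in T).
Proof. by rewrite inE (unsplitK (inr j)). Qed.

Lemma prod_join (f : 'I_(k + k) -> C) S T :
  \prod_(s in join_sets S T) f s =
  (\prod_(i in ~: S) f (lshift k i)) * \prod_(j in T) f (rshift k j).
Proof.
rewrite big_mkcond big_split_ord /= [in RHS]big_mkcond [in X in _ = _ * X]big_mkcond.
congr (_ * _); apply: eq_bigr => i _; first by rewrite lshift_join inE.
by rewrite rshift_join.
Qed.

Lemma prod_joinC (f : 'I_(k + k) -> C) S T :
  \prod_(s in ~: join_sets S T) f s =
  (\prod_(i in S) f (lshift k i)) * \prod_(j in ~: T) f (rshift k j).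
Proof.
rewrite big_mkcond big_split_ord /= [in RHS]big_mkcond [in X in _ = _ * X]big_mkcond.
congr (_ * _); apply: eq_bigr => i _; first by rewrite finset.in_setC lshift_join negbK.
by rewrite !finset.in_setC rshift_join.
Qed.

Lemma card_join S T : #|join_sets S T| = (#|~: S| + #|T|)%N.
Proof.
rewrite -!sum1_card big_mkcond big_split_ord /= [in RHS]big_mkcond [in X in _ = (_ + X)%N]big_mkcond.
congr (_ + _)%N; apply: eq_bigr => i _; first by rewrite lshift_join finset.in_setC.
by rewrite rshift_join.
Qed.

Lemma prod_swap a b S T (f : C -> C) :
  \prod_(z <- swap a b S T) f z = \prod_(s in join_sets S T) f (ucoord a s / vcoord b s).
Proof.
rewrite prod_join /swap big_cat !big_map !big_enum /=; congr (_ * _); apply: eq_bigr => i _.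
  by rewrite !(coord_l a b) divr1.
by rewrite !(coord_r a b) mul1r.
Qed.

Lemma prod_swapC a b S T (f : C -> C) :
  \prod_(z <- swap b a T S) f z = \prod_(s in ~: join_sets S T) f (vcoord b s / ucoord a s).
Proof.
rewrite prod_joinC mulrC /swap big_cat !big_map !big_enum /=; congr (_ * _); apply: eq_bigr => i _.
  by rewrite !(coord_r a b) divr1.
by rewrite !(coord_l a b) mul1r.
Qed.

Lemma setpow_join N a b S T : setpow N a S * setpow N b T =
  (\prod_(s in join_sets S T) vcoord b s ^+ N) * \prod_(t in ~: join_sets S T) ucoord a t ^+ N.
Proof.
rewrite prod_join prod_joinC [X in _ = X * _ * _]big1 => [|i _]; last by rewrite (coord_l a b) expr1n.
rewrite [X in _ = _ * (_ * X)]big1 => [|j _]; last by rewrite (coord_r a b) expr1n.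
rewrite mul1r mulr1 mulrC /setpow; congr (_ * _); apply: eq_bigr => i _.
  by rewrite (coord_r a b).
by rewrite (coord_l a b).
Qed.

Lemma prod_entries (c : 'rV[C]_k) (f : C -> C) :
  \prod_(z <- entries c) f z = \prod_i f (c 0 i).
Proof. by rewrite /entries big_map big_enum. Qed.

(** If an entry to be inverted is 0, then [N > 0] makes both sides 0. Otherwise the denominators
    clear, and the powers balance because [M] and its complement both have [k] elements. *)
Lemma summand_hterm N a b c d S T : (0 < N)%N -> #|join_sets S T| = k ->
  setpow N a S * setpow N b T *
    Z4 (swap a b S T) (swap b a T S) (entries c) (entries d) =
  hterm N a b c d (join_sets S T).
Proof.
move=> N0 cM; rewrite setpow_join /hterm !big_split /=.
have cMC : #|~: join_sets S T| = k.
  by have := cardsC (join_sets S T); rewrite cM card_ord => /addnI.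
set M := join_sets S T in cM cMC *; set u := ucoord a; set v := vcoord b.
set PV := \prod_(s in M) v s ^+ N; set PU := \prod_(t in ~: M) u t ^+ N.
have [e0|] := eqVneq (PV * PU) 0.
  rewrite e0 mul0r; move/eqP: e0; rewrite mulf_eq0 => /orP[] /eqP->.
    by rewrite !mul0r.
  by rewrite mul0r mulr0 mul0r.
rewrite mulf_eq0 negb_or => /andP[/prodf_neq0 nv /prodf_neq0 nu].
have v0 s : s \in M -> v s != 0 by move=> /nv; rewrite expf_eq0 N0.
have u0 t : t \in ~: M -> u t != 0 by move=> /nu; rewrite expf_eq0 N0.
pose Vk := \prod_(s in M) v s ^+ k; pose Uk := \prod_(t in ~: M) u t ^+ k.
have Vk0 : Vk != 0 by apply/prodf_neq0 => s Ms; rewrite expf_neq0 ?v0.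
have Uk0 : Uk != 0 by apply/prodf_neq0 => s Ms; rewrite expf_neq0 ?u0.
have eAB : Z2 (swap a b S T) (swap b a T S) =
    Vk * Uk / \prod_(s in M) \prod_(t in ~: M) (u t * v s - u s * v t).
  have -> : Uk = \prod_(s in M) \prod_(t in ~: M) u t.
    by rewrite prodr_const cM /Uk prodrXl.
  rewrite -prodfV -!big_split /Z2 prod_swap; apply: eq_bigr => s Ms.
  rewrite prod_swapC -[k in _ ^+ k]cMC -prodr_const -prodfV -!big_split; apply: eq_bigr => t Mt /=.
  rewrite -/u -/v -[RHS]invf_div; congr (_^-1).
  by have := v0 _ Ms; have := u0 _ Mt => ? ?; field; apply/andP.
have eAD : Z2 (swap a b S T) (entries d) = Vk / \prod_(s in M) \prod_j (v s - u s * d 0 j).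
  rewrite -prodfV -big_split /Z2 prod_swap; apply: eq_bigr => s Ms.
  rewrite prod_entries -[k in _ ^+ k]card_ord -prodr_const -prodfV -!big_split.
  apply: eq_bigr => j _ /=; rewrite -/u -/v -[RHS]invf_div; congr (_^-1).
  by have := v0 _ Ms => ?; field.
have eBC : Z2 (swap b a T S) (entries c) = Uk / \prod_(t in ~: M) \prod_i (u t - c 0 i * v t).
  rewrite -prodfV -big_split /Z2 prod_swapC; apply: eq_bigr => t Mt.
  rewrite prod_entries -[k in _ ^+ k]card_ord -prodr_const -prodfV -!big_split.
  apply: eq_bigr => i _ /=; rewrite -/u -/v -[RHS]invf_div; congr (_^-1).
  by have := u0 _ Mt => ?; field.
have eCD : Z2 (entries c) (entries d) = (\prod_i \prod_j (1 - c 0 i * d 0 j))^-1.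
  rewrite -prodfV /Z2 prod_entries; apply: eq_bigr => i _.
  by rewrite prod_entries prodfV.
rewrite /Z4 eAB eAD eBC eCD !invfM !invrK.
move: (\prod_(s in M) \prod_(t in ~: M) _)^-1 (\prod_i \prod_j _)^-1 => w1 w2.
move: (\prod_(s in M) \prod_j _) (\prod_(t in ~: M) \prod_i _) => Qv Qu.
by field; apply/andP.
Qed.

(** [|S| = |T|] says exactly that [A - S + T^-1] has [k] elements, and every set of [k] points
    arises from one pair. *)
Lemma ratio_sum_hsum N a b c d : (0 < N)%N -> ratio_sum N a b c d = hsum N a b c d.
Proof.
move=> N0; rewrite /ratio_sum pair_big_dep /hsum.
pose g M : {set 'I_k} * {set 'I_k} :=
  (finset (fun i => lshift k i \notin M), finset (fun j => rshift k j \in M)).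
rewrite [RHS](reindex (fun ST => join_sets ST.1 ST.2)) /=; last first.
  apply: onW_bij; exists g => [[S T]|M] /=.
    by congr pair; apply/setP => i; rewrite inE ?lshift_join ?negbK ?rshift_join.
  apply/setP => s; rewrite -[s]splitK; case: (fintype.split s) => i /=.
    by rewrite lshift_join inE negbK.
  by rewrite rshift_join inE.
have card_eq S T : (#|join_sets S T| == k) = (#|S| == #|T|).
  by have := cardsC S; rewrite card_join card_ord => e; lia.
apply: eq_big => [[S T]|[S T] /= eST]; first by rewrite /= card_eq.
by apply: summand_hterm => //; apply/eqP; rewrite card_eq.
Qed.
End HomogeneousSum.

(** * Day's sum in homogeneous coordinates *)

Section DaySum.
Variables (C : numClosedFieldType) (k N : nat) (a b c d : 'rV[C]_k).
Hypothesis b0 : forall j, b 0 j != 0.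
Hypothesis d0 : forall j, d 0 j != 0.

Definition zero_pt (s : 'I_(k + k)) : C := ucoord a s / vcoord b s.
Definition pole_pt (s : 'I_(k + k)) : C := ucoord c s / vcoord d s.

Let pl i : pole_pt (lshift k i) = c 0 i.
Proof. by rewrite /pole_pt !(coord_l c d) divr1. Qed.
Let pr j : pole_pt (rshift k j) = (d 0 j)^-1.
Proof. by rewrite /pole_pt !(coord_r c d) mul1r. Qed.

Lemma vcoord_neq0 s : vcoord b s != 0.
Proof.
rewrite -[s]splitK; case: (fintype.split s) => i /=.
  by rewrite (coord_l a b) oner_eq0.
by rewrite (coord_r a b).
Qed.

Hypothesis cd : forall i j, 1 - c 0 i * d 0 j != 0.

Let u := ucoord a.
Let v := vcoord b.
Let E := \prod_j - (d 0 j)^-1.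

Let prod_v : \prod_j b 0 j = \prod_s v s.
Proof.
rewrite big_split_ord /= [X in _ = X * _]big1 ?mul1r => [|i _]; last by rewrite /v (coord_l a b).
by apply: eq_bigr => j _; rewrite /v (coord_r a b).
Qed.

Let qoutE s : \prod_j (zero_pt s - pole_pt (rshift k j)) =
  E * (v s ^- k * \prod_j (v s - u s * d 0 j)).
Proof.
rewrite -exprVn -[k in _ ^+ k]card_ord -prodr_const -!big_split; apply: eq_bigr => j _ /=.
rewrite pr /zero_pt -/u -/v; have := vcoord_neq0 s; have := d0 j; rewrite -/v => ? ?.
by field; apply/andP.
Qed.

Let qinE t : \prod_i (zero_pt t - pole_pt (lshift k i)) =
  v t ^- k * \prod_i (u t - c 0 i * v t).
Proof.
rewrite -exprVn -[k in _ ^+ k]card_ord -prodr_const -big_split; apply: eq_bigr => i _ /=.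
by rewrite pl /zero_pt -/u -/v; have := vcoord_neq0 t; rewrite -/v => ?; field.
Qed.

Let zero_ptB s t : zero_pt t - zero_pt s = (v s * v t)^-1 * (u t * v s - u s * v t).
Proof.
rewrite /zero_pt -/u -/v; have := vcoord_neq0 s; have := vcoord_neq0 t; rewrite -/v => ? ?.
by field; apply/andP.
Qed.

(** The powers [v_s ^ k] cancel between numerator and denominator, and [\prod_j b_j ^ N] turns the
    exponent [-N] of [v] on the complement of [M] into the exponent [N] on [M]. *)
Lemma day_sum_hsum :
  \prod_j b 0 j ^+ N * day_sum N pole_pt zero_pt =
  hsum N a b c d * \prod_(i < k) \prod_(j < k) (pole_pt (lshift k i) - pole_pt (rshift k j)).
Proof.
have -> : \prod_(i < k) \prod_(j < k) (pole_pt (lshift k i) - pole_pt (rshift k j)) =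
    E ^+ k * \prod_i \prod_j (1 - c 0 i * d 0 j).
  rewrite -[k in _ ^+ k]card_ord -prodr_const -big_split; apply: eq_bigr => i _.
  rewrite -big_split; apply: eq_bigr => j _ /=; rewrite pl pr.
  by have := d0 j => ?; field.
have K0 : \prod_i \prod_j (1 - c 0 i * d 0 j) != 0.
  by apply/prodf_neq0 => i _; apply/prodf_neq0 => j _.
rewrite prodrXl prod_v /day_sum /hsum mulr_sumr mulr_suml; apply: eq_bigr => M /eqP cM.
have cMC : #|~: M| = k by have := cardsC M; rewrite cM card_ord => /addnI.
have vV : \prod_s v s = (\prod_(s in M) v s) * \prod_(t in ~: M) v t.
  rewrite (bigID (mem M)) /=; congr (_ * _).
  by apply: eq_bigl => t; rewrite finset.in_setC.
pose Vm := \prod_(s in M) v s; pose Vc := \prod_(t in ~: M) v t.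
have Vm0 : Vm != 0 by apply/prodf_neq0 => s _; apply: vcoord_neq0.
have Vc0 : Vc != 0 by apply/prodf_neq0 => s _; apply: vcoord_neq0.
pose Qv := \prod_(s in M) \prod_j (v s - u s * d 0 j).
pose Qu := \prod_(t in ~: M) \prod_i (u t - c 0 i * v t).
pose PU := (\prod_(t in ~: M) u t) ^+ N.
pose W := \prod_(s in M) \prod_(t in ~: M) (u t * v s - u s * v t).
have eM : \prod_(s in M) \prod_j (zero_pt s - pole_pt (rshift k j)) = E ^+ k * (Vm ^- k * Qv).
  under eq_bigr => s _ do rewrite qoutE.
  by rewrite !big_split /= prodr_const cM prodfV prodrXl.
have eC : \prod_(t in ~: M) ((\prod_i (zero_pt t - pole_pt (lshift k i))) * zero_pt t ^+ N) =
    Vc ^- k * Qu * (PU * Vc ^- N).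
  under eq_bigr => t _ do rewrite qinE /zero_pt expr_div_n.
  by rewrite !big_split /= !prodfV !prodrXl.
have eW : \prod_(s in M) \prod_(t in ~: M) (zero_pt t - zero_pt s) = (Vm ^+ k * Vc ^+ k)^-1 * W.
  under eq_bigr => s _ do (under eq_bigr => t _ do rewrite zero_ptB invfM).
  under eq_bigr => s _ do rewrite big_split big_split /= prodr_const cMC !prodfV.
  by rewrite !big_split /= prodr_const cM prodrXl prodfV !exprVn invfM.
have -> : \prod_s (if s \in M then \prod_j (zero_pt s - pole_pt (rshift k j))
   else \prod_i (zero_pt s - pole_pt (lshift k i)) * zero_pt s ^+ N) =
   (E ^+ k * (Vm ^- k * Qv)) * (Vc ^- k * Qu * (PU * Vc ^- N)).
  rewrite -eM -eC (bigID (mem M)) /=; congr (_ * _); first by apply: eq_bigr => s ->.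
  by apply: eq_big => [t|t /negPf->]; rewrite ?finset.in_setC.
rewrite eW vV -/Vm -/Vc /hterm !big_split /= -/u -/v !prodrXl -/Vm -/Qv -/Qu -/W.
rewrite -/PU !exprMn !invfM !invrK.
move: W^-1 K0 => w; move: (\prod_i \prod_j _) => K K0.
have VmN : Vm ^+ N != 0 by rewrite expf_neq0.
have VcN : Vc ^+ N != 0 by rewrite expf_neq0.
have Vmk : Vm ^+ k != 0 by rewrite expf_neq0.
have Vck : Vc ^+ k != 0 by rewrite expf_neq0.
move: (Vm ^+ N) (Vc ^+ N) (Vm ^+ k) (Vc ^+ k) VmN VcN Vmk Vck (E ^+ k) => x1 x2 x3 x4 h1 h2 h3 h4 e.
by field; rewrite ?h1 ?h2 ?h3 ?h4 K0.
Qed.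
End DaySum.

(** * Continuity of the mean in the parameters, and the generic case *)

Section Symbol.
Variables (R : realType) (N k : nat).
Local Notation C := (cplx R).
Variable haar : probability (borelMx R N) R.
Hypothesis hhaar : is_unitary_haar haar.
Local Notation J := (haar_mean haar).
Local Notation ts := (@tame_symbol R N).
Let circle : set C := [set z | `|z| = 1].

Lemma cst_ucvg (I : Type) (F : set_system I) (FF : Filter F) (X : Type) (A : set X)
    (s : I -> C) l : s t @[t --> F] --> l -> uniform_cvg F A (fun t _ => s t) (fun=> l).
Proof.
move=> sl; split; first by exists `|l|.
by move=> e e0; have /cvgrPdist_le/(_ _ e0) := sl; apply: filterS => t h x _; rewrite distrC.
Qed.

Lemma factor_lower_bound (c w : C) : `|w| = 1 -> 1 - `|c| <= `|1 - c * w|.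
Proof.
move=> w1; have := lerB_dist 1 (c * w); by rewrite normr1 normrM w1 mulr1.
Qed.

(** On the circle each denominator has modulus at least [(1 - |c_i|) (1 - |d_i|)], so inversion
    preserves uniform convergence. *)
Lemma ucvg_ratio_symbol (I : Type) (F : set_system I) (FF : Filter F)
    (a_ b_ c_ d_ : I -> 'rV[C]_k) (a b c d : 'rV[C]_k) :
    (forall i, `|c 0 i| < 1) -> (forall i, `|d 0 i| < 1) ->
    (forall i, a_ t 0 i @[t --> F] --> a 0 i) -> (forall i, b_ t 0 i @[t --> F] --> b 0 i) ->
    (forall i, c_ t 0 i @[t --> F] --> c 0 i) -> (forall i, d_ t 0 i @[t --> F] --> d 0 i) ->
  uniform_cvg F circle (fun t z => ratio_symbol (a_ t) (b_ t) (c_ t) (d_ t) z)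
    (ratio_symbol a b c d).
Proof.
move=> hc hd la lb lc ld.
have hfac (s : I -> C) (l : C) (f : C -> C) : s t @[t --> F] --> l -> (forall z, circle z -> `|f z| <= 1) ->
    uniform_cvg F circle (fun t z => 1 - s t * f z) (fun z => 1 - l * f z).
  move=> sl f1; under eq_fun do under eq_fun do rewrite -mulNr.
  under [X in uniform_cvg _ _ _ X]eq_fun do rewrite -mulNr.
  apply: ucvgD; first exact: ucvg_cst.
  apply: ucvgM; last exact: ucvg_bounded ler01 f1.
  by apply: cst_ucvg; apply: cvgN.
have c1 z : circle z -> `|z| = 1 by [].
have cV z : circle z -> `|z^-1| = 1 by move=> z1; rewrite normfV z1 invr1.
apply: ucvg_prod => i _; apply: ucvgM.
  by apply: ucvgM; apply: hfac => // z cz; [rewrite cV|rewrite c1].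
apply: (ucvgV (l := (1 - `|c 0 i|) * (1 - `|d 0 i|))).
- by rewrite mulr_gt0 // subr_gt0.
- by move=> z cz; rewrite normrM ler_pM ?subr_ge0 ?(ltW (hc i)) ?(ltW (hd i)) ?factor_lower_bound ?cV.
by apply: ucvgM; apply: hfac => // z cz; [rewrite cV|rewrite c1].
Qed.

Lemma tame_ratio_symbol (a b c d : 'rV[C]_k) :
    (forall i, `|c 0 i| < 1) -> (forall i, `|d 0 i| < 1) -> ts (ratio_symbol a b c d).
Proof.
move=> hc hd.
have tp (x : C) : ts (fun z => 1 - x * z).
  apply: (eq_tame_symbol _ (tame_symbol_poly _ (1 - x *: 'X))) => z _.
  by rewrite hornerD hornerN hornerC hornerZ hornerX.
have ti (x : C) : ts (fun z => 1 - x * z^-1).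
  apply: (eq_tame_symbol _ (tame_symbolM (tame_symbol_inv R N) (tame_symbol_poly _ ('X - x%:P)))).
  move=> z z1; have z0 : z != 0 by apply: circle_neq0.
  by rewrite hornerXsubC mulrBr mulVf // mulrC.
apply: tame_symbol_prod => i; apply: tame_symbolM; first exact: tame_symbolM.
apply: (tame_symbolV (e := (1 - `|c 0 i|) * (1 - `|d 0 i|))); last exact: tame_symbolM.
  by rewrite mulr_gt0 // subr_gt0.
move=> z z1; rewrite normrM ler_pM ?subr_ge0 ?(ltW (hc i)) ?(ltW (hd i)) ?factor_lower_bound //.
by rewrite normfV z1 invr1.
Qed.
End Symbol.

Lemma toeplitzZ (F : comNzRingType) N (x : F) (g : int -> F) :
  toeplitz N (fun j => x * g j) = x ^+ N * toeplitz N g.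
Proof.
by rewrite /toeplitz -detZ; congr (\det _); apply/matrixP => i j; rewrite !mxE.
Qed.

Lemma factor_poles (F : fieldType) (a b c d z : F) :
    z != 0 -> b != 0 -> d != 0 -> z - c != 0 -> 1 - d * z != 0 ->
  (1 - a / z) * (1 - b * z) / ((1 - c / z) * (1 - d * z)) =
  b / d * ((z - a) * (z - b^-1)) / ((z - c) * (z - d^-1)).
Proof.
move=> z0 b0 d0 zc zd; have e1 : 1 - c / z = (z - c) / z by field.
have e2 : z - d^-1 = - (1 - d * z) / d by field.
by rewrite e1 e2; field; rewrite z0 zc oppr_eq0 zd d0 b0.
Qed.

Section Generic.
Variables (R : realType) (N k : nat).
Local Notation C := (cplx R).
Variable haar : probability (borelMx R N) R.
Hypothesis hhaar : is_unitary_haar haar.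
Local Notation J := (haar_mean haar).
Variables a b c d : 'rV[C]_k.
Hypotheses (hc : forall i, `|c 0 i| < 1) (hd : forall i, `|d 0 i| < 1).
Hypotheses (b0 : forall j, b 0 j != 0) (d0 : forall j, d 0 j != 0).

Let p := pole_pt c d.
Let x := zero_pt a b.

Let pl i : p (lshift k i) = c 0 i.
Proof. by rewrite /p /pole_pt !(coord_l c d) divr1. Qed.
Let pr j : p (rshift k j) = (d 0 j)^-1.
Proof. by rewrite /p /pole_pt !(coord_r c d) mul1r. Qed.
Let xl i : x (lshift k i) = a 0 i.
Proof. by rewrite /x /zero_pt !(coord_l a b) divr1. Qed.
Let xr j : x (rshift k j) = (b 0 j)^-1.
Proof. by rewrite /x /zero_pt !(coord_r a b) mul1r. Qed.

Let d_out j : 1 < `|(d 0 j)^-1|.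
Proof. by rewrite normfV invf_gt1 // normr_gt0. Qed.

Lemma cd_neq0 i j : 1 - c 0 i * d 0 j != 0.
Proof.
rewrite subr_eq0; apply: contraTneq (hc i) => e.
have : 1 = `|c 0 i| * `|d 0 j| by rewrite -normrM -e normr1.
move=> e1; apply: contraTN (hd j) => h.
have := mulr_ilt1 (normr_ge0 (c 0 i)) (normr_ge0 (d 0 j)) h (hd j).
by rewrite -e1 ltxx.
Qed.

Let P : {poly C} := \prod_(s < k + k) ('X - (x s)%:P).
Let K := \prod_j (b 0 j / d 0 j).

Let symbol_poles z : `|z| = 1 ->
  ratio_symbol a b c d z = (K *: P).[z] / \prod_(s < k + k) (z - p s).
Proof.
move=> z1; have z0 : z != 0 by apply: circle_neq0.
rewrite hornerZ horner_prod !big_split_ord /=.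
rewrite /K -big_split -big_split -big_split -prodfV -big_split; apply: eq_bigr => i _ /=.
rewrite !hornerXsubC pl pr xl xr.
have zc : z - c 0 i != 0.
  by rewrite subr_eq0; apply: contraTneq (hc i) => <-; rewrite z1 ltxx.
have zd : 1 - d 0 i * z != 0.
  rewrite subr_eq0; apply: contraTneq (hd i) => e.
  by have := congr1 Num.norm e; rewrite normr1 normrM z1 mulr1 => <-; rewrite ltxx.
exact: factor_poles.
Qed.

(** The symbol is [K] times a quotient of monic polynomials. In [K ^+ N] the powers of [b_j] are
    those of [day_sum_hsum], and the powers of [1 / d_j] those of the outer poles in
    [toeplitz_pole_sum]. *)
Lemma haar_mean_generic : (0 < N)%N -> injective x ->
    injective (fun i => c 0 i) -> injective (fun i => d 0 i) ->
  J (det_symbol (ratio_symbol a b c d)) = hsum N a b c d.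
Proof.
move=> N0 injx injc injd.
have p_out (r : 'I_(k + k)) : if (k <= r)%N then 1 < `|p r| else `|p r| < 1.
  rewrite -[r]splitK; case: (fintype.split r) => i /=.
    by rewrite leqNgt ltn_ord pl hc.
  by rewrite leq_addr pr d_out.
have injp : injective p.
  move=> r s; have := p_out r; have := p_out s; rewrite -[r]splitK -[s]splitK.
  case: (fintype.split r) => i; case: (fintype.split s) => j /=;
    rewrite ?leq_addr ?[(k <= i)%N]leqNgt ?[(k <= j)%N]leqNgt ?ltn_ord.
  - by rewrite !pl => _ _ /injc->.
  - by move=> h1 h2 e; move: h1; rewrite -e => /lt_trans/(_ h2); rewrite ltxx.
  - by move=> h1 h2 e; move: h1; rewrite -e => /(lt_trans h2); rewrite ltxx.
  by rewrite !pr => _ _ /invr_inj/injd->.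
have P0 : K *: P != 0.
  rewrite scaler_eq0 negb_or; apply/andP; split.
    by apply/prodf_neq0 => j _; rewrite mulf_neq0 ?invr_eq0.
  exact: monic_neq0 (monic_prod_XsubC _ _ _).
have p0 j : p (rshift k j) != 0 by rewrite pr invr_eq0.
have -> : J (det_symbol (ratio_symbol a b c d)) =
   J (det_symbol (fun z => (K *: P).[z] / \prod_(s < k + k) (z - p s))).
  apply: eq_haar_mean => U /det_symbol_spectrum[z [z1 _ _ e]].
  by rewrite !e; apply: eq_bigr => i _; rewrite symbol_poles.
rewrite (haar_mean_poles hhaar N0 P0 injp p_out).
have -> : toeplitz N (conv (K *: P) (pole_sum p (fun s => (k <= s)%N))) =
    K ^+ N * toeplitz N (conv P (pole_sum p (fun s => (k <= s)%N))).
  rewrite -toeplitzZ; congr (\det _); apply/matrixP => i j; by rewrite !mxE convZ.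
have := toeplitz_pole_sum N injp p0 injx; rewrite -/P.
set T := toeplitz _ _ => e.
have := day_sum_hsum N a b0 d0 cd_neq0; rewrite -/p -/x -e.
set Q := \prod_(i < k) \prod_(j < k) _ => e2.
have Q0 : Q != 0.
  apply/prodf_neq0 => i _; apply/prodf_neq0 => j _.
  by rewrite subr_eq0 (inj_eq injp) -val_eqE /= neq_ltn ltn_addr.
apply: (mulIf Q0); rewrite -e2 /K -prodrXl.
under eq_bigr => j _ do rewrite expr_div_n.
rewrite big_split /= prodfV -!mulrA; congr (_ * _).
under [in RHS]eq_bigr => j _ do rewrite pr exprVn.
by rewrite prodfV mulrC mulrA.
Qed.
End Generic.

(** * Removal of the genericity assumptions *)

Section Perturbation.
Variables (R : realType) (N k : nat).
Local Notation C := (cplx R).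
Variable haar : probability (borelMx R N) R.
Hypothesis hhaar : is_unitary_haar haar.
Local Notation J := (haar_mean haar).
Variables a b c d : 'rV[C]_k.
Hypotheses (hc : forall i, `|c 0 i| < 1) (hd : forall i, `|d 0 i| < 1).

Lemma affine_cvg (y w : C) : y + w * t @[t --> 0^'] --> y.
Proof.
rewrite -[X in _ --> X]addr0 -[X in _ + X](mulr0 w).
apply: cvgD; first exact: cvg_cst.
apply: cvgM; first exact: cvg_cst.
exact: cvg_within.
Qed.

Lemma near_affine_neq0 (y w : C) : w != 0 -> \forall t \near 0^', y + w * t != 0.
Proof.
move=> w0; have [->|y0] := eqVneq y 0; last by apply: (cvgr_neq0 y) => //; exact: affine_cvg.
near=> t; rewrite add0r mulf_neq0 //; near: t; exact: nbhs_dnbhs_neq.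
Unshelve. all: by end_near.
Qed.

(** A common shift keeps the [a_i], and the [b_j], distinct and moves the [b_j] off 0. The slopes
    [i + 1] are distinct, to separate the [c_i] and the [d_i], and nonzero, to move the [d_i] off
    0. *)
Let a_ (t : C) : 'rV[C]_k := \row_i (a 0 i + t).
Let b_ (t : C) : 'rV[C]_k := \row_i (b 0 i + t).
Let c_ (t : C) : 'rV[C]_k := \row_i (c 0 i + i.+1%:R * t).
Let d_ (t : C) : 'rV[C]_k := \row_i (d 0 i + i.+1%:R * t).

Let cvg_a i : a_ t 0 i @[t --> 0^'] --> a 0 i.
Proof. under eq_fun do rewrite mxE -[t in _ + t]mul1r; exact: affine_cvg. Qed.
Let cvg_b i : b_ t 0 i @[t --> 0^'] --> b 0 i.
Proof. under eq_fun do rewrite mxE -[t in _ + t]mul1r; exact: affine_cvg. Qed.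
Let cvg_c i : c_ t 0 i @[t --> 0^'] --> c 0 i.
Proof. under eq_fun do rewrite mxE; exact: affine_cvg. Qed.
Let cvg_d i : d_ t 0 i @[t --> 0^'] --> d 0 i.
Proof. under eq_fun do rewrite mxE; exact: affine_cvg. Qed.

Let near_lt1 (y : 'rV[C]_k) (y_ : C -> 'rV[C]_k) : (forall i, `|y 0 i| < 1) ->
  (forall i, y_ t 0 i @[t --> 0^'] --> y 0 i) ->
  \forall t \near 0^', forall i, `|y_ t 0 i| < 1.
Proof. by move=> h l; apply: filter_forall => i; apply: cvgr_norm_lt (l i) _ (h i). Qed.

Let near_neq0 (y : 'rV[C]_k) (w : 'I_k -> C) : (forall i, w i != 0) ->
  \forall t \near 0^', forall i, (\row_i (y 0 i + w i * t)) 0 i != 0.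
Proof.
move=> w0; apply: filter_forall => i; under eq_near do rewrite mxE.
exact: near_affine_neq0.
Qed.

Let near_inj (y : 'rV[C]_k) :
  \forall t \near 0^', injective (fun i => (\row_(i < k) (y 0 i + i.+1%:R * t)) 0 i).
Proof.
have h : \forall t \near 0^', forall i j : 'I_k, i != j ->
    y 0 i - y 0 j + (i.+1%:R - j.+1%:R) * t != 0.
  apply: filter_forall => i; apply: filter_forall => j.
  have [->|nij] := eqVneq i j; first by apply: nearW.
  have w0 : i.+1%:R - j.+1%:R != 0 :> C.
    by rewrite subr_eq0 eqr_nat eqSS val_eqE.
  by have := near_affine_neq0 (y 0 i - y 0 j) w0; apply: filterS.
apply: filterS h => t h i j; rewrite !mxE => e; apply/eqP/negPn/negP => /h/eqP; apply.
by move/eqP: e; rewrite -subr_eq0 => /eqP <-; ring.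
Qed.

(** The conditions of [nonsingular] correspond to the kinds of pairs of coordinates: two from [a],
    two from [b], or one of each. *)
Lemma coord_det_neq0 s t : nonsingular (a, b) -> s != t ->
  ucoord a t * vcoord b s - ucoord a s * vcoord b t != 0.
Proof.
move=> [/= inja injb ab1]; rewrite -[s]splitK -[t]splitK.
case: (fintype.split s) => i; case: (fintype.split t) => j /=;
  rewrite ?(coord_l a b) ?(coord_r a b) ?mul1r ?mulr1 => st.
- by rewrite subr_eq0; apply: contra_neq st => /inja->.
- by rewrite subr_eq0 eq_sym.
- by rewrite subr_eq0.
by rewrite subr_eq0; apply: contra_neq st => /injb->.
Qed.

(** Ordinary limits are uniform convergence on a one-point set, so the algebra of [uniform_cvg]
    applies to them. *)
Let U0 : set unit := setT.
Local Notation ucvg f l := (uniform_cvg 0^' U0 (fun t _ => f t) (fun=> l)).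

Let ucvg_cvg (f : C -> C) l : ucvg f l -> f t @[t --> 0^'] --> l.
Proof.
move=> [_ h]; apply/cvgrPdist_le => e /h; apply: filterS => t /(_ tt I).
by rewrite distrC.
Qed.

Let ucvgB (f g : C -> C) l m : ucvg f l -> ucvg g m -> ucvg (fun t => f t - g t) (l - m).
Proof.
move=> hf hg; have h : ucvg (fun t => f t + -1 * g t) (l + -1 * m).
  by apply: ucvgD => //; apply: ucvgM => //; apply: ucvg_cst.
by move: h; under eq_fun do rewrite mulN1r; rewrite mulN1r.
Qed.

Lemma hsum_cvg : nonsingular (a, b) ->
  hsum N (a_ t) (b_ t) (c_ t) (d_ t) @[t --> 0^'] --> hsum N a b c d.
Proof.
move=> ns; apply: ucvg_cvg.
have hu s : ucvg (fun t => ucoord (a_ t) s) (ucoord a s).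
  rewrite -[s]splitK; case: (fintype.split s) => i /=.
    rewrite (coord_l a b); under eq_fun do rewrite (coord_l _ b); exact: cst_ucvg.
  rewrite (coord_r a b); under eq_fun do rewrite (coord_r _ b); exact: ucvg_cst.
have hv s : ucvg (fun t => vcoord (b_ t) s) (vcoord b s).
  rewrite -[s]splitK; case: (fintype.split s) => i /=.
    rewrite (coord_l a b); under eq_fun do rewrite (coord_l a); exact: ucvg_cst.
  rewrite (coord_r a b); under eq_fun do rewrite (coord_r a); exact: cst_ucvg.
have hvc i : ucvg (fun t => c_ t 0 i) (c 0 i) by apply: cst_ucvg.
have hvd i : ucvg (fun t => d_ t 0 i) (d 0 i) by apply: cst_ucvg.
have hX n (f : C -> C) l : ucvg f l -> ucvg (fun t => f t ^+ n) (l ^+ n).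
  move=> hf; rewrite (_ : l ^+ n = \prod_(i < n) l); last by rewrite prodr_const card_ord.
  rewrite (_ : (fun t _ => f t ^+ n) = fun t (_ : unit) => \prod_(i < n) f t); last first.
    by apply/funext => t; apply/funext => _; rewrite prodr_const card_ord.
  by apply: ucvg_prod.
apply: ucvg_sum => M _; apply: ucvgM.
  by apply: ucvgM; apply: ucvg_prod => s _; apply: ucvgM; do ?apply: hX => //;
    apply: ucvg_prod => j _; apply: ucvgB => //; apply: ucvgM.
set den := (X in X^-1); have den0 : 0 < `|den|.
  rewrite normr_gt0 mulf_neq0 //; apply/prodf_neq0 => s.
    move=> sM; apply/prodf_neq0 => t; rewrite finset.in_setC => tM; apply: coord_det_neq0 => //.
    by apply: contraNneq tM => <-.
  by move=> _; apply/prodf_neq0 => j _; apply: cd_neq0.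
apply: (ucvgV den0) => //; apply: ucvgM; apply: ucvg_prod => s _; apply: ucvg_prod => t _.
  by apply: ucvgB; apply: ucvgM.
by apply: ucvgB; [apply: ucvg_cst | apply: ucvgM].
Qed.

Lemma haar_mean_nonsingular : (0 < N)%N -> nonsingular (a, b) ->
  J (det_symbol (ratio_symbol a b c d)) = hsum N a b c d.
Proof.
move=> N0 ns; have [/= inja injb ab1] := ns.
have ab1' : \forall t \near 0^', forall i j, a_ t 0 i * b_ t 0 j != 1.
  apply: filter_forall => i; apply: filter_forall => j.
  have : a_ t 0 i * b_ t 0 j - 1 @[t --> 0^'] --> a 0 i * b 0 j - 1.
    apply: (ucvg_cvg (f := fun t => a_ t 0 i * b_ t 0 j - 1)).
    apply: (ucvgB (f := fun t => a_ t 0 i * b_ t 0 j)); last exact: ucvg_cst.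
    have ha : ucvg (fun t => a_ t 0 i) (a 0 i) by apply: cst_ucvg.
    have hb : ucvg (fun t => b_ t 0 j) (b 0 j) by apply: cst_ucvg.
    exact: (ucvgM ha hb).
  move/cvgr_neq0; rewrite subr_eq0 => /(_ (ab1 i j)).
  by apply: filterS => t; rewrite subr_eq0.
have near_b : \forall t \near 0^', forall j, b_ t 0 j != 0.
  have := @near_neq0 b (fun=> 1) (fun=> oner_neq0 _).
  by apply: filterS => t h j; have := h j; rewrite !mxE mul1r.
have eqn : \forall t \near 0^', J (det_symbol (ratio_symbol (a_ t) (b_ t) (c_ t) (d_ t))) =
    hsum N (a_ t) (b_ t) (c_ t) (d_ t).
  have near_c := near_lt1 hc cvg_c; have near_d := near_lt1 hd cvg_d.
  have near_d0 := @near_neq0 d (fun i => i.+1%:R) (fun i => lt0r_neq0 (ltr0Sn _ i)).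
  have near_injc := near_inj c; have near_injd := near_inj d.
  near=> t.
  have bt : forall j, b_ t 0 j != 0 by near: t.
  have abt : forall i j, a_ t 0 i * b_ t 0 j != 1 by near: t.
  have ct : forall i, `|c_ t 0 i| < 1 by near: t.
  have dt : forall i, `|d_ t 0 i| < 1 by near: t.
  have dt0 : forall i, d_ t 0 i != 0 by near: t.
  have injct : injective (fun i => c_ t 0 i) by near: t.
  have injdt : injective (fun i => d_ t 0 i) by near: t.
  apply: (haar_mean_generic hhaar ct dt bt dt0 N0 _ injct injdt).
  move=> r s; rewrite -[r]splitK -[s]splitK /zero_pt.
  case: (fintype.split r) => i; case: (fintype.split s) => j /=;
    rewrite ?(coord_l (a_ t) (b_ t)) ?(coord_r (a_ t) (b_ t)) ?divr1 ?mul1r.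
  - by rewrite !mxE => /addIr/inja->.
  - by move=> e; have := abt i j; rewrite e mulVf ?eqxx.
  - by move=> e; have := abt j i; rewrite -e mulVf ?eqxx.
  by move=> /invr_inj; rewrite !mxE => /addIr/injb->.
have lim : J (det_symbol (ratio_symbol (a_ t) (b_ t) (c_ t) (d_ t))) @[t --> 0^'] -->
    J (det_symbol (ratio_symbol a b c d)).
  apply: haar_mean_symbol_cvg => //.
  - have hc_ := near_lt1 hc cvg_c; have hd_ := near_lt1 hd cvg_d.
    by apply: filterS2 hc_ hd_ => t hct hdt; apply: tame_ratio_symbol.
  - exact: tame_ratio_symbol.
  exact: (ucvg_ratio_symbol _ hc hd cvg_a cvg_b cvg_c cvg_d).
have hlim : hsum N (a_ t) (b_ t) (c_ t) (d_ t) @[t --> 0^'] --> hsum N a b c d.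
  exact: hsum_cvg.
have h : J (det_symbol (ratio_symbol (a_ t) (b_ t) (c_ t) (d_ t))) @[t --> 0^'] --> hsum N a b c d.
  by apply: cvg_trans hlim; apply: near_eq_cvg; apply: filterS eqn => t ->.
exact: (@cvg_unique C (@norm_hausdorff C C) _ _ _ _ lim h).
Unshelve. all: by end_near.
Qed.
End Perturbation.

Theorem theorem6p6 (R : realType) (N k : nat) (hN : (0 < N)%N)
    (haar : probability (borelMx R N) R) (hhaar : is_unitary_haar haar)
    (a b c d : 'rV[cplx R]_k)
    (hc : forall i, `|c 0 i| < 1) (hd : forall i, `|d 0 i| < 1) :
  let integral := complex_integral haar (@unitary_group R N)
                    (det_symbol (ratio_symbol a b c d)) in
  (nonsingular (a, b) -> integral = ratio_sum N a b c d) /\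
  ratio_sum N ab.1 ab.2 c d
    @[ab --> within (@nonsingular (cplx R) k) (nbhs (a, b))] --> integral.
Proof.
move=> integral.
have eqJ (x : 'rV[cplx R]_k * 'rV[cplx R]_k) : nonsingular x ->
    haar_mean haar (det_symbol (ratio_symbol x.1 x.2 c d)) = ratio_sum N x.1 x.2 c d.
  by case: x => a' b' ns; rewrite ratio_sum_hsum // (haar_mean_nonsingular hhaar).
split; first by move/eqJ.
(* Along the filter the sum equals the mean, and the mean is continuous in [(a, b)] at singular
   points too. *)
apply: (@cvg_trans _ (haar_mean haar (det_symbol (ratio_symbol ab.1 ab.2 c d))
    @[ab --> within (@nonsingular (cplx R) k) (nbhs (a, b))])).
  apply: near_eq_cvg; near=> x; rewrite eqJ //; near: x; exact: withinT.
apply: haar_mean_symbol_cvg => //.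
- by apply: nearW => x; apply: tame_ratio_symbol.
- exact: tame_ratio_symbol.
apply: ucvg_ratio_symbol => // i; apply: cvg_within_filter.
- apply: (@cvg_comp _ _ _ fst (fun M : 'rV[cplx R]_k => M 0 i) _ (nbhs a)); first exact: cvg_fst.
  exact: coord_continuous.
- apply: (@cvg_comp _ _ _ snd (fun M : 'rV[cplx R]_k => M 0 i) _ (nbhs b)); first exact: cvg_snd.
  exact: coord_continuous.
- exact: cvg_cst.
exact: cvg_cst.
Unshelve. all: by end_near.
Qed.
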